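(* Let $M=(0,o_1|(q,p),(1,b))$ and let $G$ be a finite group. There exists an action $\varphi:G\to \mathrm{Diff}_+^{fp}(M)$ if and only if $G$ is isomorphic to a subgroup of $\mathrm{Dih}(\mathbb{Z}_m\times\mathbb{Z}_n)$ for some $m,n\in\mathbb{N}$.
   Context: $M=(g,o_1|(q_1,p_1),\ldots,(q_n,p_n),(1,b))$ denotes the closed oriented Seifert-fibered $3$-manifold with orientable base of genus $g$, normalized Seifert invariants $(q_i,p_i)$ ($\gcd(q_i,p_i)=1$, $0<p_i<q_i$) and obstruction class $b\in\mathbb{Z}$: it is obtained from $S^1\times F$ ($F$ a compact genus $g$ surface with $n+1$ boundary circles, $S^1$ the fiber direction) by gluing in solid tori whose meridians are identified with $q_i$ times the boundary curve of $F$ plus $p_i$ times the fiber, respectively (for the last one) once the boundary curve plus $b$ times the fiber. Thus $(0,o_1|(q,p),(1,b))$ fibers over $S^2$ with exactly one critical fiber. $\mathrm{Diff}_+^{fp}(M)$ is the group of orientation-preserving self-diffeomorphisms of $M$ that send each fiber of this Seifert fibration to a fiber. An action of $G$ is an injective homomorphism $\varphi:G\to \mathrm{Diff}_+^{fp}(M)$. For an abelian group $H$, $\mathrm{Dih}(H)$ is the semidirect product of $H$ with $\mathbb{Z}_2$ whose generator acts on $H$ by inversion. *)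

(* Defs.v *)
From HB Require Import structures.
From mathcomp Require Import all_boot all_order all_algebra all_fingroup.
From mathcomp Require Import all_solvable.
From mathcomp Require Import all_classical all_reals all_analysis.
From mathcomp Require Import complex.
Import numFieldNormedType.Exports.
Import Order.TTheory GRing.Theory Num.Theory.

Set Implicit Arguments.
Unset Strict Implicit.
Unset Printing Implicit Defensive.

Local Open Scope classical_set_scope.
Local Open Scope ring_scope.

Definition circle (R : realType) : Type := {z : R[i] | `|z| == 1}.

Section Circle.
Variable R : realType.

Lemma dir_subproof (z : R[i]) : `|if z == 0 then 1 else z / `|z| | == 1.
Proof.
case: (boolP (z == 0)) => [_|z0]; first by rewrite normr1.
by rewrite normrM normfV normr_id divff // normr_eq0.
Qed.

(* z / |z|, and 1 for z = 0. *)
Definition dir (z : R[i]) : circle R :=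
  exist (fun w : R[i] => `|w| == 1) _ (dir_subproof z).

Definition expi (a : R) : circle R := dir (cos a +i* sin a)%C.

End Circle.

(* C^infinity at x, i.e. on a neighbourhood of x: all iterated directional
   derivatives are differentiable there. *)
Section Smooth.
Variables (R : realType) (m n : nat).
Implicit Types f : 'rV[R]_m -> 'rV[R]_n.

Definition iter_derive f (vs : seq 'rV[R]_m) : 'rV[R]_m -> 'rV[R]_n :=
  foldr (fun v h => 'D_v h) f vs.

Definition smooth_at f (x : 'rV[R]_m) : Prop :=
  \forall z \near x, forall vs, differentiable (iter_derive f vs) z.

End Smooth.

(* The manifold (0, o_1 | (q, p), (1, b)).

   F is the annulus [-1, 1] x S^1 with coordinates (t, beta), oriented by
   (dt, dbeta), so that its boundary curve at t = e (e = 1, -1), with the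
   boundary orientation, is c_e = e * beta; h denotes the fiber coordinate.
   A solid torus V_e = {|z| <= 1} x S^1 is glued along the boundary torus t = e,
   with invariants (q, p) for e = 1 and (1, b) for e = -1.  To get the smooth
   structure, F is enlarged by open collars to R x S^1 and the discs to the
   complex plane; the gluing extends to z != 0 by t = e * (1 - ln |z|), which
   identifies |z| = 1 with t = e.  Now V_e minus its core {z = 0} lies in
   F x S^1, so as a set the result of the gluing is the disjoint union of F x S^1
   (the points Reg t beta h) and of the two cores (the points Core e v).  The
   parameters q, p, b only enter into the smooth structure, given by [chart]. *)
Variant seifert (R : realType) (q p b : int) : Type :=
| Reg of R & circle R & circle R
| Core of bool & circle R.

Section Seifert.
Variables (R : realType) (q p b : int).
Local Notation M := (seifert R q p b).

Definition end_sign (e : bool) : int := if e then 1 else -1.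

Definition end_inv (e : bool) : int * int := if e then (q, p) else (1, b).

(* The map V_e -> M.  The meridian goes to q' c_e + p' h, where (q', p') are the
   invariants of V_e, and the longitude to s c_e - r h, where r q' + s p' = 1:
   the determinant is -1 because the gluing map reverses the boundary
   orientations.  Another longitude differs by a twist along the meridian disc,
   which extends to V_e, so this choice does not affect M. *)
Definition fill (e : bool) (z : R[i]) (v : circle R) : M :=
  if z == 0 then Core q p b e v else
  let: (q', p') := end_inv e in
  let: (r, s) := egcdz q' p' in
  Reg q p b ((end_sign e)%:~R * (1 - ln (complex.Re `|z|)))
    (dir ((z ^ q' * val v ^ s) ^ end_sign e))
    (dir (z ^ p' * val v ^ (- r))).

(* Parametrizations by R^3 of the pieces F x S^1 (None), V_1 and V_-1.  They are
   local diffeomorphisms onto open subsets of M, and equally oriented: the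
   change of coordinates from V_e to F x S^1 has Jacobian 1 / |z|^2 > 0. *)
Definition chart (i : option bool) (x : 'rV[R]_3) : M :=
  match i with
  | None => Reg q p b (x 0 0) (expi (x 0 1)) (expi (x 0 2))
  | Some e => fill e (x 0 0 +i* x 0 1)%C (expi (x 0 2))
  end.

(* g is a smooth expression of f near x in the charts i and j. *)
Definition local_expr (f : M -> M) i j (g : 'rV[R]_3 -> 'rV[R]_3) x : Prop :=
  smooth_at g x /\ \forall z \near x, chart j (g z) = f (chart i z).

Definition smooth_map (f : M -> M) : Prop :=
  forall i j x y, chart j y = f (chart i x) ->
  exists2 g, g x = y & local_expr f i j g x.

Definition orientation_preserving (f : M -> M) : Prop :=
  forall i j g x, local_expr f i j g x -> 0 < \det ('J g x).

Definition diffeomorphism (f : M -> M) : Prop :=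
  smooth_map f /\ exists2 f', smooth_map f' & cancel f f' /\ cancel f' f.

Definition fiber (L : set M) : Prop :=
  (exists t beta, L = range (Reg q p b t beta)) \/
  (exists e, L = range (Core q p b e)).

Definition fiber_preserving (f : M -> M) : Prop :=
  forall L, fiber L -> fiber (f @` L).

Definition Diff_plus_fp : set (M -> M) :=
  [set f | [/\ diffeomorphism f, orientation_preserving f
             & fiber_preserving f]].

Definition fp_action (gT : finGroupType) (G : {group gT})
    (phi : gT -> M -> M) : Prop :=
  [/\ forall x, x \in G -> Diff_plus_fp (phi x),
      {in G &, forall x y, phi (x * y)%g = phi x \o phi y}
    & {in G &, injective phi}].

End Seifert.

(* Dih(A), with 'Z_2 acting on the abelian group A by inversion. *)
Section Dih.
Local Open Scope group_scope.
Variables (gT : finGroupType) (A : {group gT}) (cA : abelian A).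

Definition inversion (x : gT) (a : 'Z_2) : gT :=
  if (x \in A) && (a != 1) then x^-1 else x.

Lemma inversion1 : inversion^~ 1 =1 id.
Proof. by move=> x; rewrite /inversion eqxx andbF. Qed.

Lemma inversionM x : act_morph inversion x.
Proof.
by move=> [[|[|//]] a] [[|[|//]] b]; rewrite /inversion /eq_op /= ?andbT ?andbF //;
  case: (boolP (x \in A)) => xA; rewrite ?groupV ?xA ?invgK // (negbTE xA).
Qed.

Definition inversion_action := TotalAction inversion1 inversionM.

Lemma inversion_is_groupAction : is_groupAction A inversion_action.
Proof.
move=> a _; rewrite inE; apply/andP; split.
  apply/fintype.subsetP => x; apply: contraR => xA.
  by rewrite actpermE /= /inversion (negbTE xA).
apply/morphicP => x y Ax Ay; rewrite !actpermE /= /inversion Ax Ay groupM //=.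
by case: ifP => // _; rewrite invMg (centsP cA) ?groupV.
Qed.

Definition Dih : finGroupType :=
  sdprod_groupType (GroupAction inversion_is_groupAction).
End Dih.

(* Z_m x Z_n for m, n > 0. *)
Definition ZpX (m n : nat) := [group of finset.setX (Zp m) (Zp n)].
Lemma ZpX_abelian m n : abelian (ZpX m n).
Proof.
apply/centsP => -[x1 x2] _ [y1 y2] _.
by congr pair; apply: addrC.
Qed.

(* Main.v *)
Require Import Defs.
From mathcomp Require Import all_boot all_order all_algebra all_fingroup.
From mathcomp Require Import all_solvable.
From mathcomp Require Import all_classical all_reals all_analysis.
From mathcomp Require Import complex.
From mathcomp Require Import ring lra zify.
Import Order.TTheory GRing.Theory Num.Theory.
Import numFieldNormedType.Exports.

Set Implicit Arguments.
Unset Strict Implicit.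
Unset Printing Implicit Defensive.

Local Open Scope classical_set_scope.
Local Open Scope ring_scope.

(** The manifold [M = seifert R q p b] fibers over the sphere with one critical fiber [Core true],
along which the nearby fibers run [q >= 2] times; the other core [Core false] is a regular fiber.

From actions to groups. A fiber-preserving diffeomorphism preserves the critical fiber, the only
one with a nontrivial local monodromy ([Core_preserved]). Near it the map is a product of a map of
the fiber and of a map of the normal disc ([local_product]), so it is described there by a pair
[(phi, A)]: a lift [phi] to the line of the map induced on the critical fiber, and a normal
differential [A] which does not depend on the point ([lift_exists]). The pair is unique up to a deck
transformation ([lift_uniq]), and for a map of finite order it determines the map ([lift_rigid]): if
[phi] is the identity and [A] is [1], then the map is tangent to the identity at a fixed point, a
finite order map with this property is the identity nearby ([germ_rigid]), and the interior of its
fixed point set is closed.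

Let [G] act, and let [G0] be the subgroup, of index at most [2], of the elements which preserve the
orientation of the critical fiber, hence also that of the normal planes. Averaging the lifts over
[G0] makes all the [phi] translations, and averaging a scalar product makes all the [A] rotations.
The translation length and the angle of rotation, both defined up to the deck transformations, give
two characters of [G0] which together are injective. An element outside [G0] reverses the critical
fiber, so it has a fixed point there; its square then acts trivially on this fiber, and has trivial
normal differential because [A] reverses the orientation ([orientation_reversing_square]). So all
elements outside [G0] are involutions, and [G] embeds in a generalized dihedral group
([dihedral_embedding]).

From groups to actions. The rotations of both circles of [F x S^1], and their simultaneous
reflection, preserve the fibration and extend over the cores ([shift]). Since the gluing maps are
affine in logarithmic polar coordinates, these maps are affine in suitable charts of the solid tori
([shift_straight]), also at the cores; smoothness in all charts then follows from the compatibility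
of the charts ([transition]). The group they generate contains [Dih (ZpX m n)]. *)

(** * Strict differentiability *)

Section RowNorm.
Variables (R : realType).

Lemma entry_norm_le m n (v : 'M[R]_(m, n)) i j : `|v i j| <= `|v|.
Proof.
rewrite [leRHS]/Num.Def.normr/= mx_normrE.
exact: (le_bigmax _ (fun ij : 'I_m * 'I_n => `|v ij.1 ij.2|) (i, j)).
Qed.

Lemma row_norm_le n (v : 'rV[R]_n) c :
  0 <= c -> (forall j, `|v 0 j| <= c) -> `|v| <= c.
Proof.
move=> c0 H; rewrite [leLHS]/Num.Def.normr/= mx_normrE.
by apply: bigmax_le => // -[i j] _; rewrite (ord1 i).
Qed.

Lemma mulmx_norm_le m n (M : 'M[R]_(m, n)) c (v : 'rV[R]_m) :
  0 <= c -> (forall i j, `|M i j| <= c) -> `|v *m M| <= c *+ m * `|v|.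
Proof.
move=> c0 H; apply: row_norm_le => [|j]; first by rewrite mulr_ge0 ?mulrn_wge0.
rewrite mxE (le_trans (ler_norm_sum _ _ _))// mulrnAl -[m in _ *+ m]card_ord.
rewrite -sumr_const; apply: ler_sum => i _; rewrite normrM mulrC.
by rewrite ler_pM// entry_norm_le.
Qed.

Lemma mulmx_bounded m n (M : 'M[R]_(m, n)) :
  exists2 c : R, 0 < c & forall v : 'rV_m, `|v *m M| <= c * `|v|.
Proof.
exists (`|M| *+ m + 1) => [|v]; first by rewrite ltr_wpDl ?mulrn_wge0.
apply: le_trans (mulmx_norm_le v (normr_ge0 M) _) _.
  by move=> i j; exact: entry_norm_le.
by rewrite ler_wpM2r// lerDl.
Qed.

Lemma mulmx_small0 m n (M : 'M[R]_(m, n)) :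
  (forall e, 0 < e -> forall v : 'rV_m, `|v *m M| <= e * `|v|) -> M = 0.
Proof.
move=> H; apply/row_matrixP => i; rewrite row0 rowE; apply/eqP.
rewrite -normr_le0; apply/ler_addgt0Pr => e e0; rewrite add0r.
set u := delta_mx 0 i.
have [d d0 de] : exists2 d, 0 < d & d * `|u| <= e.
  exists (e / (`|u| + 1)); first by rewrite divr_gt0// ltr_wpDl.
  by rewrite mulrAC ler_pdivrMr ?ltr_wpDl// ler_pM2l// lerDl.
exact: le_trans (H _ d0 _) de.
Qed.

End RowNorm.

Section StrictDiff.
Variables (R : realType).

(** Vectors are rows, so that differentials act by multiplication on the right and compose in the
order of the arrows. With two moving points [a] and [b], differentiability at [x] already controls
[f] on a neighbourhood of [x] and needs no coordinates: composition, uniqueness and near-continuity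
of the differential are formal. *)
Definition sdiff m n (f : 'rV[R]_m -> 'rV[R]_n) (x : 'rV[R]_m)
    (M : 'M[R]_(m, n)) : Prop :=
  forall e : R, 0 < e -> exists2 d : R, 0 < d & forall a b : 'rV[R]_m,
    `|a - x| < d -> `|b - x| < d -> `|f a - f b - (a - b) *m M| <= e * `|a - b|.

Lemma near_normP n (x : 'rV[R]_n) (P : 'rV[R]_n -> Prop) :
  (\forall z \near x, P z) <->
  exists2 d : R, 0 < d & forall z : 'rV[R]_n, `|z - x| < d -> P z.
Proof.
split=> [/nbhs_ballP[d /= d0 H]|[d d0 H]].
  by exists d => // z zx; apply: H; rewrite -ball_normE /= distrC.
by apply/nbhs_ballP; exists d => //= z; rewrite -ball_normE /= distrC; exact: H.
Qed.

Lemma sdiff_near m n (f g : 'rV[R]_m -> 'rV[R]_n) (x : 'rV[R]_m) M :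
  (\forall z \near x, f z = g z) -> sdiff f x M -> sdiff g x M.
Proof.
move=> /near_normP[d1 d10 H1] H e e0; have [d d0 Hd] := H e e0.
exists (Num.min d d1); first by rewrite lt_min d0.
by move=> a b; rewrite !lt_min => /andP[? ?] /andP[? ?]; rewrite -!H1// Hd.
Qed.

Lemma sdiff_linear m n (M : 'M[R]_(m, n)) (c : 'rV[R]_n) (x : 'rV[R]_m) :
  sdiff (fun z => z *m M + c) x M.
Proof.
move=> e e0; exists 1 => // a b _ _.
rewrite mulmxBl opprD addrACA subrr addr0 subrr normr0.
by rewrite mulr_ge0 ?(ltW e0)// normr_ge0.
Qed.

Lemma sdiff_id m (x : 'rV[R]_m) : sdiff id x 1%:M.
Proof.
apply: sdiff_near (sdiff_linear 1%:M 0 x).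
by apply/near_normP; exists 1 => // z _; rewrite mulmx1 addr0.
Qed.

Lemma sdiff_lipschitz m n (f : 'rV[R]_m -> 'rV[R]_n) (x : 'rV[R]_m) M :
  sdiff f x M ->
  exists2 c : R, 0 < c & exists2 d : R, 0 < d & forall a b : 'rV[R]_m,
    `|a - x| < d -> `|b - x| < d -> `|f a - f b| <= c * `|a - b|.
Proof.
move=> H; have [d d0 Hd] := H 1 ltr01; have [c c0 Hc] := mulmx_bounded M.
exists (1 + c); first by rewrite addr_gt0.
exists d => // a b ax bx.
rewrite -[f a - f b](subrK ((a - b) *m M)) (le_trans (ler_normD _ _))//.
by rewrite mulrDl lerD// Hd.
Qed.

Lemma sdiff_cvg m n (f : 'rV[R]_m -> 'rV[R]_n) (x : 'rV[R]_m) M : sdiff f x M ->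
  forall e : R, 0 < e -> exists2 d : R, 0 < d &
  forall z : 'rV[R]_m, `|z - x| < d -> `|f z - f x| < e.
Proof.
move=> /sdiff_lipschitz[c c0 [d d0 H]] e e0.
exists (Num.min d (e / c)); first by rewrite lt_min d0 divr_gt0.
move=> z; rewrite lt_min ltr_pdivlMr// => /andP[zd ze].
by apply: le_lt_trans (H _ _ _ _) _; rewrite ?subrr ?normr0// mulrC.
Qed.

Lemma sdiff_comp m n p (f : 'rV[R]_m -> 'rV[R]_n) (g : 'rV[R]_n -> 'rV[R]_p)
    (x : 'rV[R]_m) M N :
  sdiff f x M -> sdiff g (f x) N -> sdiff (g \o f) x (M *m N).
Proof.
move=> Hf Hg e e0.
have [c c0 [d1 d10 Lf]] := sdiff_lipschitz Hf.
have [k k0 Hk] := mulmx_bounded N.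
have e20 : 0 < e / 2 by rewrite divr_gt0.
have [d2 d20 Hd2] := Hf (e / 2 / k) (divr_gt0 e20 k0).
have [d3 d30 Hd3] := Hg (e / 2 / c) (divr_gt0 e20 c0).
have [d4 d40 Hd4] := sdiff_cvg Hf d30.
exists (Num.min (Num.min d1 d2) d4); first by rewrite !lt_min d10 d20.
move=> a b; rewrite !lt_min => /andP[/andP[a1 a2] a4] /andP[/andP[b1 b2] b4].
have -> : (g \o f) a - (g \o f) b - (a - b) *m (M *m N) =
   (g (f a) - g (f b) - (f a - f b) *m N) + (f a - f b - (a - b) *m M) *m N.
  by rewrite /= [(_ - _ *m M) *m N]mulmxBl mulmxA addrA subrK.
rewrite (le_trans (ler_normD _ _))// [e in e * _]splitr mulrDl lerD//.
  rewrite (le_trans (Hd3 _ _ (Hd4 _ a4) (Hd4 _ b4)))//.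
  rewrite -mulrA ler_pM2l// mulrC ler_pdivrMr// mulrC.
  exact: Lf.
rewrite (le_trans (Hk _))// mulrC -ler_pdivlMr// (le_trans (Hd2 _ _ a2 b2))//.
by rewrite mulrAC.
Qed.

(** Where the differential exists near [x], it is close to the one at [x]: both approximate the
same increments of [f]. *)
Lemma sdiff_deriv_continuous m n (f : 'rV[R]_m -> 'rV[R]_n) (x : 'rV[R]_m) M :
  sdiff f x M -> forall e : R, 0 < e -> exists2 d : R, 0 < d &
  forall (y : 'rV[R]_m) (N : 'M[R]_(m, n)), `|y - x| < d -> sdiff f y N ->
  forall v : 'rV[R]_m, `|v *m (N - M)| <= e * `|v|.
Proof.
move=> Hf e e0; have e20 : 0 < e / 2 by rewrite divr_gt0.
have [d d0 Hd] := Hf _ e20; exists d => // y N yx HN v.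
have [->|v0] := eqVneq v 0; first by rewrite mul0mx !normr0 mulr0.
have vp : 0 < `|v| by rewrite normr_gt0.
have [d' d'0 Hd'] := HN _ e20.
pose mn := Num.min (d - `|y - x|) d'.
have m0 : 0 < mn by rewrite lt_min subr_gt0 yx.
pose r := mn / 2 / `|v|.
have r0 : 0 < r by rewrite !divr_gt0.
have rv : `|r *: v| < mn.
  rewrite normrZ gtr0_norm// /r divfK ?gt_eqF//.
  by rewrite ltr_pdivrMr// ltr_pMr// (ltr_nat _ 1 2).
have /andP[rv1 rv2] : (`|r *: v| < d - `|y - x|) && (`|r *: v| < d').
  by rewrite -lt_min.
have E : y + r *: v - y = r *: v by rewrite addrC addKr.
have H1 := Hd (y + r *: v) y; rewrite E in H1.
have H2 := Hd' (y + r *: v) y; rewrite E subrr normr0 in H2.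
have {}H1 : `|f (y + r *: v) - f y - (r *: v) *m M| <= e / 2 * `|r *: v|.
  apply: H1 => //; rewrite addrAC (le_lt_trans (ler_normD _ _))//.
  by rewrite -ltrBrDl.
have {}H2 := H2 rv2 d'0.
rewrite -(ler_pM2l r0) -{1}(gtr0_norm r0) -normrZ scalemxAl.
have -> : (r *: v) *m (N - M) = (f (y + r *: v) - f y - (r *: v) *m M) -
    (f (y + r *: v) - f y - (r *: v) *m N).
  by rewrite mulmxBr [in RHS]opprB [RHS]addrC addrA subrK.
rewrite (le_trans (ler_normB _ _))//.
have -> : r * (e * `|v|) = e / 2 * `|r *: v| + e / 2 * `|r *: v|.
  by rewrite -mulrDl -splitr normrZ gtr0_norm// mulrCA.
exact: lerD.
Qed.

Lemma sdiff_uniq m n (f : 'rV[R]_m -> 'rV[R]_n) (x : 'rV[R]_m) M N :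
  sdiff f x M -> sdiff f x N -> M = N.
Proof.
move=> HM HN; apply/esym/subr0_eq/mulmx_small0 => e e0 v.
have [d d0 Hd] := sdiff_deriv_continuous HM e0.
by apply: (Hd x) => //; rewrite subrr normr0.
Qed.

Lemma is_derive_line m n (f : 'rV[R]_m -> 'rV[R]_n) (b w : 'rV[R]_m) (t : R) :
  differentiable f (b + t *: w) ->
  is_derive t (1 : R) (fun s : R => f (b + s *: w)) ('D_w f (b + t *: w)).
Proof.
move=> df.
have E : (fun h : R => h^-1 *: (f (b + (h *: 1 + t) *: w) - f (b + t *: w))) =
    (fun h : R => h^-1 *: (f (h *: w + (b + t *: w)) - f (b + t *: w))).
  apply/funext => h; congr (_ *: (f _ - _)).
  by rewrite scalerDl addrCA [h *: 1]mulr1.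
have df1 : derivable f (b + t *: w) w by exact: diff_derivable.
by apply: DeriveDef; rewrite /derivable /derive E.
Qed.

(** By the mean value theorem on the segment from [b] to [a], one coordinate at a time. *)
Lemma sdiff_C1 m n (f : 'rV[R]_m -> 'rV[R]_n) (x : 'rV[R]_m)
    (J : 'rV[R]_m -> 'M[R]_(m, n)) :
  (\forall z \near x, differentiable f z /\ forall v, 'D_v f z = v *m J z) ->
  (forall v, 'D_v f z @[z --> x] --> 'D_v f x) ->
  sdiff f x (J x).
Proof.
move=> ndf cJ e e0; have /near_normP[d1 d10 Df] := ndf.
have /near_normP[d2 d20 H2] : \forall z \near x,
    forall i, `|row i (J z) - row i (J x)| < e / m.+1%:R.
  have Dfx : forall v, 'D_v f x = v *m J x by apply: (Df x _).2; rewrite subrr normr0.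
  suff H i : \forall z \near x, `|row i (J z) - row i (J x)| < e / m.+1%:R.
    exact: (@filter_forall 'rV[R]_m 'I_m
      (fun i z => `|row i (J z) - row i (J x)| < e / m.+1%:R) (nbhs x) _ H).
  have /cvgrPdist_lt/(_ (e / m.+1%:R)) := cJ (delta_mx 0 i).
  rewrite divr_gt0// => /(_ isT) H; apply: filterS2 H ndf => z Hz [_ Dz].
  by rewrite !rowE -Dz -Dfx distrC.
exists (Num.min d1 d2); first by rewrite lt_min d10.
move=> a b ax bx.
have cvx (t : R) : t \in `[0, 1] -> `|b + t *: (a - b) - x| < Num.min d1 d2.
  rewrite in_itv/= => /andP[t0 t1].
  have -> : b + t *: (a - b) - x = (1 - t) *: (b - x) + t *: (a - x).
    by rewrite !scalerBr !scalerBl !scale1r; apply/matrixP => i j; rewrite !mxE; ring.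
  rewrite (le_lt_trans (ler_normD _ _))// !normrZ !ger0_norm ?subr_ge0//.
  case: (eqVneq t 0) => [->|tn0]; first by rewrite subr0 mul1r mul0r addr0.
  have -> : Num.min d1 d2 = (1 - t) * Num.min d1 d2 + t * Num.min d1 d2 by ring.
  by rewrite ler_ltD ?ler_wpM2l ?subr_ge0 ?ltr_pM2l ?(ltW bx)// lt_neqAle eq_sym tn0.
apply: row_norm_le => [|j]; first by rewrite mulr_ge0 ?(ltW e0)// normr_ge0.
pose w := a - b.
pose F (t : R) : 'rV[R]_n := f (b + t *: w) - t *: (w *m J x).
pose h (t : R) : R := F t 0 j.
have dh (t : R) : t \in `[0, 1] ->
    is_derive t (1 : R) h ((w *m (J (b + t *: w) - J x)) 0 j).
  move=> /cvx; rewrite lt_min => /andP[/Df[/is_derive_line D Dw] _].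
  have D2 : is_derive t (1 : R) (fun s : R => s *: (w *m J x)) (w *m J x).
    have := @is_derive_line _ _ id 0 (w *m J x) t; rewrite derive_id.
    rewrite (_ : (fun s : R => id _) = (fun s : R => s *: (w *m J x))).
      by apply; exact: ex_diff.
    by apply/funext => s; rewrite add0r.
  have D3 : is_derive t (1 : R) F (w *m (J (b + t *: w) - J x)).
    by rewrite mulmxBr -Dw; exact: is_deriveB.
  have D4 := @ex_derive _ _ _ _ _ _ _ D3.
  apply: DeriveDef; first by have /derivable_mxP := D4; exact.
  have := @derive_val _ _ _ _ _ _ _ D3; rewrite derive_mx//.
  by move=> /matrixP/(_ 0 j); rewrite mxE.
pose dd (c : R) : R := (w *m (J (b + c *: w) - J x)) 0 j.
have dh1 (t : R) : t \in `]0, 1[ -> is_derive t (1 : R) h (dd t).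
  by move=> t01; apply: dh; apply: subset_itv_oo_cc t01.
have ch : {within `[0, 1], continuous h}.
  apply: derivable_within_continuous => t t01.
  exact: (@ex_derive _ _ _ _ _ _ _ (dh t t01)).
have [c c01 E] := MVT_segment ler01 dh1 ch.
have -> : (f a - f b - w *m J x) 0 j = h 1 - h 0.
  rewrite /h /F !scale0r subr0 addr0 !scale1r [b + _]addrC subrK.
  by rewrite !mxE; ring.
rewrite E subr0 mulr1 /dd (le_trans (entry_norm_le _ _ _))//.
have /H2 Hc : `|b + c *: w - x| < d2.
  by have := cvx c c01; rewrite lt_min => /andP[].
apply: le_trans (mulmx_norm_le (c := e / m.+1%:R) _ _ _) _.
- by rewrite divr_ge0// ltW.
- move=> i k; apply: le_trans (ltW (Hc i)).
  by apply: le_trans (entry_norm_le _ 0 k); rewrite !mxE.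
rewrite ler_wpM2r// -[_ *+ m]mulr_natr mulrAC ler_pdivrMr ?ltr0n//.
by rewrite ler_pM2l// ler_nat.
Qed.

Lemma sdiff_smooth m n (f : 'rV[R]_m -> 'rV[R]_n) (x : 'rV[R]_m) :
  smooth_at f x -> sdiff f x ('J f x).
Proof.
move=> sf; have Df : \forall z \near x, differentiable f z.
  by apply: filterS sf => z /(_ [::]).
apply: (@sdiff_C1 _ _ f x (fun z => 'J f z)).
  by apply: filterS Df => z dz; split=> // v; exact: deriveEjacobian.
move=> v; exact: differentiable_continuous (nbhs_singleton sf [:: v]).
Qed.

End StrictDiff.

(** * Angles and the gluing in polar coordinates *)

Section Cis.
Variable R : realType.
Implicit Types (a b x y : R) (k : int).

Definition cis a : R[i] := (cos a +i* sin a)%C.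

Lemma norm_cis a : `|cis a| = 1.
Proof. by rewrite normc_def /= cos2Dsin2 sqrtr1. Qed.

Lemma cis_neq0 a : cis a != 0.
Proof. by rewrite -normr_eq0 norm_cis oner_eq0. Qed.

Lemma cis0 : cis 0 = 1.
Proof. by rewrite /cis cos0 sin0. Qed.

Lemma cisD a b : cis (a + b) = cis a * cis b.
Proof. by rewrite /cis cosD sinD; simpc; congr (_ +i* _)%C; rewrite addrC. Qed.

Lemma cisN a : cis (- a) = (cis a)^-1.
Proof.
by apply: (mulfI (cis_neq0 a)); rewrite divff ?cis_neq0// -cisD subrr cis0.
Qed.

Lemma cisMn a n : cis (a *+ n) = cis a ^+ n.
Proof. by elim: n => [|n IH]; rewrite ?cis0// mulrS cisD IH exprS. Qed.

Lemma cisMz a k : cis (k%:~R * a) = cis a ^ k.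
Proof.
case: k => n; first by rewrite -[_%:~R]/(n%:R) mulr_natl cisMn.
by rewrite NegzE mulrNz mulNr cisN -[_%:~R]/(n.+1%:R) mulr_natl cisMn exprnN.
Qed.

Lemma cis_pi2 : cis (pi *+ 2) = 1.
Proof. by rewrite /cis cos2pi sin2pi. Qed.

Lemma cis_period a k : cis (a + k%:~R * (pi *+ 2)) = cis a.
Proof. by rewrite cisD cisMz cis_pi2 exp1rz mulr1. Qed.

Lemma cos_eq1 x : cos x = 1 -> exists k, x = k%:~R * (pi *+ 2).
Proof.
move=> cx; have pi20 : 0 < pi *+ 2 :> R by rewrite mulrn_wgt0// pi_gt0.
pose k := Num.floor (x / (pi *+ 2)); exists k.
have := floor_itv (x / (pi *+ 2)); rewrite -/k => /andP[k1 k2].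
rewrite ler_pdivlMr// in k1; rewrite ltr_pdivrMr// intrD mulrDl mul1r in k2.
pose y := x - k%:~R * (pi *+ 2).
have y0 : 0 <= y by rewrite subr_ge0.
have y2 : y < pi *+ 2 by rewrite ltrBlDl.
have cy : cos y = cos 0.
  have := cis_period x (- k); rewrite mulrNz mulNr -/y => -[-> _].
  by rewrite cos0.
apply/eqP; rewrite -subr_eq0 -/y; apply/eqP.
have [yp|yp] := leP y pi.
  by apply: cos_inj => //; rewrite in_itv/= ?y0 ?yp ?lexx ?pi_ge0.
have : pi *+ 2 - y = 0; last by move/eqP; rewrite subr_eq0 => /eqP E; rewrite E ltxx in y2.
apply: cos_inj; rewrite ?in_itv/= ?lexx ?pi_ge0 ?subr_ge0 ?(ltW y2)//.
  by rewrite mulr2n lerBlDr lerD2l ltW.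
by rewrite -cy addrC cosD2pi cosN.
Qed.

Lemma int_tau_small k : `|k%:~R * (pi *+ 2) : R| < pi *+ 2 -> k = 0.
Proof.
have t0 : 0 < pi *+ 2 :> R by rewrite mulrn_wgt0// pi_gt0.
rewrite normrM (gtr0_norm t0) gtr_pMl// -intr_norm ltrz1 => ?; lia.
Qed.

Lemma cis_eq a b : cis a = cis b -> exists k, a = b + k%:~R * (pi *+ 2).
Proof.
move=> E; have : cis (a - b) = 1 by rewrite cisD cisN E divff ?cis_neq0.
by case=> /cos_eq1[k E1] _; exists k; rewrite -E1 addrC subrK.
Qed.

Lemma cis_surj (z : R[i]) : `|z| = 1 -> exists a, z = cis a.
Proof.
case: z => x y; rewrite normc_def /= => /complexI/(congr1 (fun u => u ^+ 2)).
rewrite sqr_sqrtr ?addr_ge0 ?sqr_ge0// expr1n => xy1.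
have x1 : -1 <= x <= 1.
  rewrite -ler_norml -(ler_pXn2r (n := 2)) ?nnegrE// expr1n real_normK ?num_real//.
  by rewrite -xy1 lerDl sqr_ge0.
have E : Num.sqrt (1 - x ^+ 2) = `|y|.
  by rewrite -xy1 addrC addKr sqrtr_sqr.
have [y0|y0] := leP 0 y.
  exists (acos x); rewrite /cis acosK// sin_acos// E ger0_norm//.
exists (- acos x); rewrite /cis cosN sinN acosK// sin_acos// E ltr0_norm//.
by rewrite opprK.
Qed.

Lemma polar (z : R[i]) : z != 0 -> exists rho a, z = (expR rho)%:C%C * cis a.
Proof.
move=> z0.
have zp : 0 < complex.Re `|z|.
  by move: z0; rewrite -normr_gt0 ltcE /= => /andP[].
have E : `|z| = (complex.Re `|z|)%:C%C by rewrite normc_def.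
have [a Ea] : exists a, z / `|z| = cis a.
  by apply: cis_surj; rewrite normrM normfV normr_id divff// normr_eq0.
exists (ln (complex.Re `|z|)), a.
by rewrite lnK ?posrE// -E -Ea mulrC divfK// normr_eq0.
Qed.

Lemma expRMz k x : (expR (k%:~R * x))%:C%C = (expR x)%:C%C ^ k :> R[i].
Proof.
case: k => n; first by rewrite -[_%:~R]/(n%:R) expRM_natl rmorphXn.
by rewrite NegzE mulrNz mulNr expRN -[_%:~R]/(n.+1%:R) expRM_natl fmorphV rmorphXn.
Qed.

Lemma circle_inj : injective (@proj1_sig _ _ : circle R -> R[i]).
Proof. by move=> [u Pu] [v Pv] /= E; subst v; congr exist; exact: bool_irrelevance. Qed.

Lemma dir_polar rho a : dir ((expR rho)%:C%C * cis a) = expi a.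
Proof.
apply: circle_inj => /=.
have r0 : (expR rho)%:C%C != 0 :> R[i] by rewrite eq_complex /= gt_eqF ?expR_gt0.
rewrite -/(cis a) mulf_eq0 (negbTE r0) (negbTE (cis_neq0 a)) /= normrM norm_cis.
rewrite divr1 mulr1 ger0_norm ?ler0c ?expR_ge0//.
by rewrite mulrC mulKf.
Qed.

Lemma val_expi a : proj1_sig (expi a) = cis a.
Proof.
by rewrite /= -/(cis a) (negbTE (cis_neq0 a)) norm_cis divr1.
Qed.

Lemma expi_eq a b : expi a = expi b <-> exists k, a = b + k%:~R * (pi *+ 2).
Proof.
split=> [/(congr1 (@proj1_sig _ _))|[k ->]]; first by rewrite !val_expi; exact: cis_eq.
by apply: circle_inj; rewrite !val_expi cis_period.
Qed.

Lemma expi_surj (v : circle R) : exists a, v = expi a.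
Proof.
case: v => z Pz; have [a Ea] := cis_surj (eqP Pz); exists a.
by apply: circle_inj; rewrite val_expi.
Qed.

End Cis.

Section Row3.
Variable R : realType.
Implicit Types a b c : R.

Definition row3 a b c : 'rV[R]_3 := \row_j [:: a; b; c]`_j.

Lemma row30 a b c : row3 a b c 0 0 = a. Proof. by rewrite mxE. Qed.
Lemma row31 a b c : row3 a b c 0 1 = b. Proof. by rewrite mxE. Qed.
Lemma row32 a b c : row3 a b c 0 2 = c. Proof. by rewrite mxE. Qed.
Definition row3E := (row30, row31, row32).

Lemma ord3P (P : 'I_3 -> Prop) : P 0 -> P 1 -> P 2 -> forall i, P i.
Proof.
move=> P0 P1 P2 [[|[|[|//]]] Hi].
- by rewrite (_ : Ordinal _ = 0)//; exact: val_inj.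
- by rewrite (_ : Ordinal _ = 1)//; exact: val_inj.
- by rewrite (_ : Ordinal _ = 2)//; exact: val_inj.
Qed.

Lemma row3_eq (x y : 'rV[R]_3) :
  x 0 0 = y 0 0 -> x 0 1 = y 0 1 -> x 0 2 = y 0 2 -> x = y.
Proof. by move=> *; apply/rowP; apply: ord3P. Qed.

Lemma row3_eta (x : 'rV[R]_3) : x = row3 (x 0 0) (x 0 1) (x 0 2).
Proof. by apply: row3_eq; rewrite row3E. Qed.

Lemma row3_inj a b c a' b' c' :
  row3 a b c = row3 a' b' c' -> [/\ a = a', b = b' & c = c'].
Proof.
move=> E; have H i := congr1 (fun x : 'rV_3 => x 0 i) E.
by have := (H 0, H 1, H 2); rewrite !row3E => -[[]].
Qed.

(** The radius is given by its logarithm [rho], since the gluing map is affine in [rho], [a] and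
[t]. *)
Definition polar3 rho a t := row3 (expR rho * cos a) (expR rho * sin a) t.

Lemma row3_polarP (x : 'rV[R]_3) :
  (exists t, x = row3 0 0 t) \/ (exists rho a t, x = polar3 rho a t).
Proof.
rewrite (row3_eta x); have [z0|/polar[rho [a]]] := eqVneq (x 0 0 +i* x 0 1)%C 0.
  by case: z0 => -> ->; left; exists (x 0 2).
rewrite /cis; simpc => -[-> ->]; right.
by exists rho, a, (x 0 2).
Qed.

(** A screw motion about the third axis. It extends to the core as the identity, and it changes
the slope of the fibers in a solid torus. *)
Definition twist (k : R) (x : 'rV[R]_3) : 'rV[R]_3 :=
  let t := k * x 0 2 in
  row3 (x 0 0 * cos t - x 0 1 * sin t) (x 0 0 * sin t + x 0 1 * cos t) (x 0 2).

Lemma twist_polar k rho a t : twist k (polar3 rho a t) = polar3 rho (a + k * t) t.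
Proof. by rewrite /twist /polar3 !row3E cosD sinD; congr row3; ring. Qed.

Lemma twist_core k t : twist k (row3 0 0 t) = row3 0 0 t.
Proof. by rewrite /twist !row3E !mul0r subr0 addr0. Qed.

Lemma twistK k : cancel (twist k) (twist (- k)).
Proof.
move=> x; case: (row3_polarP x) => [[t ->]|[rho [a [t ->]]]].
  by rewrite !twist_core.
by rewrite !twist_polar mulNr addrK.
Qed.

Lemma twistNK k : cancel (twist (- k)) (twist k).
Proof. by move=> x; rewrite -{1}[k]opprK twistK. Qed.

End Row3.
Arguments row3 {R}.
Arguments polar3 {R}.

Section Kappa.
Variables (R : realType) (q p b : int).
Hypotheses (cop_qp : coprimez q p) (q_gt0 : 0 < q).
Local Notation M := (seifert R q p b).
Local Notation Reg := (Reg q p b).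
Local Notation Core := (Core q p b).
Local Notation chart := (@chart R q p b).
Implicit Types e : bool.

(** The coefficients of the gluing map: the meridian of the solid torus [e] goes to [mer] times
the boundary curve plus [twi] times the fiber, and the longitude is given by [lon1] and [lon2]. *)
Definition mer e : int := (end_inv q p b e).1.
Definition twi e : int := (end_inv q p b e).2.
Definition lon1 e : int := (egcdz (mer e) (twi e)).1.
Definition lon2 e : int := (egcdz (mer e) (twi e)).2.

Lemma bezout_end e : lon1 e * mer e + lon2 e * twi e = 1.
Proof.
rewrite /lon1 /lon2; case: (egcdzP (mer e) (twi e)) => r s -> _.
by case: e; [apply/eqP; exact: cop_qp|rewrite /mer /twi /= gcd1z].
Qed.

Lemma mer_gt0 e : 0 < mer e.
Proof. by case: e. Qed.

Definition slope e : R := (lon2 e)%:~R / (mer e)%:~R.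

Local Notation sgn e := ((end_sign e)%:~R : R).

Lemma fill_polar e rho a t : chart (Some e) (polar3 rho a t) =
  Reg (sgn e * (1 - rho)) (expi (sgn e * ((mer e)%:~R * a + (lon2 e)%:~R * t)))
    (expi ((twi e)%:~R * a - (lon1 e)%:~R * t)).
Proof.
rewrite /chart /polar3 !row3E /fill; move: (expi t) (val_expi t) => v Ev.
have -> : ((expR rho * cos a) +i* (expR rho * sin a))%C = (expR rho)%:C%C * cis a :> R[i].
  by rewrite /cis; simpc.
have r0 : (expR rho)%:C%C != 0 :> R[i] by rewrite eq_complex /= gt_eqF ?expR_gt0.
have N : complex.Re `|(expR rho)%:C%C * cis a| = expR rho.
  by rewrite normrM norm_cis mulr1 ger0_norm ?ler0c ?expR_ge0.
rewrite N expRK mulf_eq0 (negbTE r0) (negbTE (cis_neq0 a)) {N} /=.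
rewrite /lon1 /lon2 /mer /twi; case: (end_inv q p b e) => q' p' /=.
case: (egcdz q' p') => r s /=.
have dirE (k : int) c : dir ((expR rho)%:C%C ^ k * cis c) = expi c.
  by rewrite -(dir_polar (k%:~R * rho)) expRMz.
have unit_r : (expR rho)%:C%C \is a @GRing.unit R[i] by rewrite unitfE.
have unit_c c : cis c \is a @GRing.unit R[i] by rewrite unitfE cis_neq0.
have E (k l : int) : ((expR rho)%:C%C * cis a) ^ k * cis t ^ l =
    (expR rho)%:C%C ^ k * cis (k%:~R * a + l%:~R * t).
  by rewrite exprzMl// -!cisMz -mulrA -cisD.
have E2 : (((expR rho)%:C%C * cis a) ^ q' * cis t ^ s) ^ end_sign e =
    (expR rho)%:C%C ^ (q' * end_sign e) *
    cis ((end_sign e)%:~R * (q'%:~R * a + s%:~R * t)).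
  by rewrite (E q' s) exprzMl ?unitrXz// exprz_exp -cisMz.
by rewrite Ev E2 (E p' (- r)) !dirE mulrNz mulNr.
Qed.

Lemma fill_core e t : chart (Some e) (row3 0 0 t) = Core e (expi t).
Proof. by rewrite /chart !row3E /fill eqxx. Qed.

(** Charts straightened so that the fibers become the lines of the third coordinate: in the solid
torus [e] the fibers turn about the core with slope [- slope e], which [twist] undoes. The price
is that [kappa e] is periodic only up to a rotation of the disc. *)
Definition kappa e (x : 'rV[R]_3) : M := chart (Some e) (twist (- slope e) x).

Lemma kappa_core e t : kappa e (row3 0 0 t) = Core e (expi t).
Proof. by rewrite /kappa twist_core fill_core. Qed.

Lemma kappa_polar e rho a t : kappa e (polar3 rho a t) =
  Reg (sgn e * (1 - rho)) (expi (sgn e * ((mer e)%:~R * a)))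
    (expi ((twi e)%:~R * a - t / (mer e)%:~R)).
Proof.
have m0 : (mer e)%:~R != 0 :> R by rewrite intr_eq0 gt_eqF ?mer_gt0.
have : (lon1 e)%:~R * (mer e)%:~R + (lon2 e)%:~R * (twi e)%:~R = 1 :> R.
  by rewrite -!intrM -intrD bezout_end.
rewrite /kappa twist_polar fill_polar /slope.
move: ((lon1 e)%:~R : R) ((lon2 e)%:~R : R) ((twi e)%:~R : R) ((mer e)%:~R : R) m0.
move=> r s u m m0 E; congr (Defs.Reg _ _ _ _ (expi _) (expi _)); first by field.
have -> : r = (1 - s * u) / m by rewrite -E addrK mulfK.
by field.
Qed.

Lemma chart_kappa e x : chart (Some e) x = kappa e (twist (slope e) x).
Proof. by rewrite /kappa twistK. Qed.

End Kappa.

(** * Smoothness of explicit maps *)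

Section Elementary.
Variables (R : realType) (n : nat).
Implicit Types (U : set 'rV[R]_n) (f : 'rV[R]_n -> R)
  (df : 'rV[R]_n -> 'rV[R]_n -> R).

(** Functions built from the coordinates by arithmetic and a few real functions, together
with their differential.  This class is closed under differentiation, so that its members
are smooth. *)
Inductive elem U : ('rV[R]_n -> R) -> ('rV[R]_n -> 'rV[R]_n -> R) -> Prop :=
| ElemCst c : elem U (fun=> c) (fun _ _ => 0)
| ElemCoord i : elem U (fun x => x 0 i) (fun _ v => v 0 i)
| ElemAdd f df g dg : elem U f df -> elem U g dg ->
    elem U (fun x => f x + g x) (fun x v => df x v + dg x v)
| ElemMul f df g dg : elem U f df -> elem U g dg ->
    elem U (fun x => f x * g x) (fun x v => df x v * g x + f x * dg x v)
| ElemInv f df : (forall x, U x -> f x != 0) -> elem U f df ->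
    elem U (fun x => (f x)^-1) (fun x v => - df x v * ((f x)^-1 * (f x)^-1))
| ElemExp f df : elem U f df ->
    elem U (fun x => expR (f x)) (fun x v => df x v * expR (f x))
| ElemLn f df : (forall x, U x -> 0 < f x) -> elem U f df ->
    elem U (fun x => ln (f x)) (fun x v => df x v * (f x)^-1)
| ElemSin f df : elem U f df ->
    elem U (fun x => sin (f x)) (fun x v => df x v * cos (f x))
| ElemCos f df : elem U f df ->
    elem U (fun x => cos (f x)) (fun x v => df x v * - sin (f x))
| ElemAtan f df : elem U f df ->
    elem U (fun x => atan (f x)) (fun x v => df x v * (1 + f x * f x)^-1).

Lemma elem_opp U f df : elem U f df -> elem U (fun x => - f x) (fun x v => - df x v).
Proof.
move=> Hf; have := ElemMul (ElemCst U (-1)) Hf.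
congr elem; apply/funext => x; first by rewrite mulN1r.
by apply/funext => v; rewrite mul0r add0r mulN1r.
Qed.

Lemma elem_derive U f df : elem U f df ->
  forall v, exists ddf, elem U (fun x => df x v) ddf.
Proof.
elim=> {f df} [c|i|f df g dg _ IHf _ IHg|f df g dg Ef IHf Eg IHg|f df f0 Ef IHf|
  f df Ef IHf|f df f0 Ef IHf|f df Ef IHf|f df Ef IHf|f df Ef IHf] v.
- by eexists; exact: ElemCst.
- by eexists; exact: ElemCst.
- by have [? ?] := IHf v; have [? ?] := IHg v; eexists; apply: ElemAdd; eassumption.
- have [? ?] := IHf v; have [? ?] := IHg v.
  by eexists; apply: ElemAdd; apply: ElemMul; eassumption.
- have [? ?] := IHf v; have Ei := ElemInv f0 Ef.
  by eexists; apply: ElemMul; [apply: elem_opp; eassumption|exact: (ElemMul Ei Ei)].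
- by have [? ?] := IHf v; eexists; apply: ElemMul; [eassumption|exact: ElemExp Ef].
- have [? ?] := IHf v; eexists; apply: ElemMul; [eassumption|].
  by apply: ElemInv Ef => x /f0/lt0r_neq0.
- by have [? ?] := IHf v; eexists; apply: ElemMul; [eassumption|exact: ElemCos Ef].
- have [? ?] := IHf v; eexists; apply: ElemMul; first eassumption.
  exact: elem_opp (ElemSin Ef).
- have [? ?] := IHf v; eexists; apply: ElemMul; first eassumption.
  apply: ElemInv (ElemAdd (ElemCst U 1) (ElemMul Ef Ef)) => x _.
  by rewrite gt_eqF// ltr_pwDl// -expr2 sqr_ge0.
Qed.

Lemma derive_chain (phi : R -> R) d f x : is_derive (f x) (1 : R) phi d ->
  differentiable f x ->
  differentiable (phi \o f) x /\ forall v, 'D_v (phi \o f) x = 'D_v f x * d.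
Proof.
move=> Hphi Hf; have dphi : differentiable phi (f x).
  by apply/derivable1_diffP; exact: ex_derive.
split=> [|v]; first exact: differentiable_comp.
rewrite !deriveE//; last exact: differentiable_comp.
by rewrite diff_comp//= [in LHS]diff1E// derive1E (@derive_val _ _ _ _ _ _ _ Hphi).
Qed.

Lemma elem_differentiable U f df : elem U f df -> forall x, U x ->
  differentiable f x /\ forall v, 'D_v f x = df x v.
Proof.
elim=> {f df} [c|i|f df g dg _ IHf _ IHg|f df g dg _ IHf _ IHg|f df f0 _ IHf|
  f df _ IHf|f df f0 _ IHf|f df _ IHf|f df _ IHf|f df _ IHf] x Ux.
- by split=> [|v]; [exact: differentiable_cst|rewrite derive_cst].
- have dc : differentiable (fun x : 'rV[R]_n => x 0 i) x by exact: differentiable_coord.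
  split=> // v; have di : derivable (@id 'rV[R]_n) x v by exact: derivable_id.
  have := derive_mx di.
  by rewrite derive_id => /matrixP/(_ 0 i); rewrite mxE.
- have [df1 Df] := IHf _ Ux; have [dg1 Dg] := IHg _ Ux.
  split=> [|v]; first exact: differentiableD.
  by rewrite deriveD ?Df ?Dg//; exact: diff_derivable.
- have [df1 Df] := IHf _ Ux; have [dg1 Dg] := IHg _ Ux.
  split=> [|v]; first exact: differentiableM.
  rewrite deriveM ?Df ?Dg; [|exact: diff_derivable..].
  by rewrite addrC [_ *: df x v]mulrC.
- have [df1 Df] := IHf _ Ux; have fx0 := f0 _ Ux.
  have dV : is_derive (f x) (1 : R) (fun y : R => y^-1) (- ((f x)^-1 * (f x)^-1)).
    apply: DeriveDef; first exact: derivableV.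
    have di : derivable (@id R) (f x) 1 by exact: derivable_id.
    have := deriveV fx0 di; rewrite derive_id /= => ->.
    by rewrite -exprVn expr2 scaleNr; congr (- _); rewrite [_ *: _]mulr1.
  have [H1 H2] := derive_chain dV df1; split=> // v.
  by rewrite -[LHS]/('D_v ((fun y : R => y^-1) \o f) x) H2 Df mulrN mulNr.
- have [df1 Df] := IHf _ Ux.
  have [H1 H2] := derive_chain (is_derive_expR _) df1; split=> // v.
  by rewrite -[LHS]/('D_v (@expR R \o f) x) H2 Df.
- have [df1 Df] := IHf _ Ux.
  have [H1 H2] := derive_chain (is_derive1_ln (f0 _ Ux)) df1; split=> // v.
  by rewrite -[LHS]/('D_v (@ln R \o f) x) H2 Df.
- have [df1 Df] := IHf _ Ux.
  have [H1 H2] := derive_chain (is_derive_sin _) df1; split=> // v.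
  by rewrite -[LHS]/('D_v (@sin R \o f) x) H2 Df.
- have [df1 Df] := IHf _ Ux.
  have [H1 H2] := derive_chain (is_derive_cos _) df1; split=> // v.
  by rewrite -[LHS]/('D_v (@cos R \o f) x) H2 Df.
- have [df1 Df] := IHf _ Ux.
  have [H1 H2] := derive_chain (is_derive1_atan _) df1; split=> // v.
  by rewrite -[LHS]/('D_v (@atan R \o f) x) H2 Df expr2.
Qed.

Definition elem_map m U (F : 'rV[R]_n -> 'rV[R]_m) : Prop :=
  forall j, exists df, elem U (fun x => F x 0 j) df.

Lemma elem_map_differentiable m U (F : 'rV[R]_n -> 'rV[R]_m) x :
  elem_map U F -> U x -> differentiable F x.
Proof.
move=> EF Ux.
have -> : F = \sum_(j < m) (fun y => F y 0 j *: (delta_mx 0 j : 'rV[R]_m)).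
  by apply/funext => y /=; rewrite fct_sumE; exact: row_sum_delta.
apply: differentiable_sum => j; apply: differentiableZl.
by have [df Ef] := EF j; exact: (elem_differentiable Ef Ux).1.
Qed.

Lemma elem_map_derive m U (F : 'rV[R]_n -> 'rV[R]_m) x v j df :
  elem_map U F -> U x -> elem U (fun x => F x 0 j) df -> ('D_v F x) 0 j = df x v.
Proof.
move=> EF Ux Ef; rewrite derive_mx; last first.
  exact: diff_derivable (elem_map_differentiable EF Ux).
by rewrite mxE (elem_differentiable Ef Ux).2.
Qed.

Lemma differentiable_near0 m (d : 'rV[R]_n -> 'rV[R]_m) x :
  (\forall z \near x, d z = 0) -> differentiable d x.
Proof.
move=> d0; have dx : d x = 0 by exact: nbhs_singleton d0.
pose z0 : {linear 'rV[R]_n -> 'rV[R]_m} := [the {linear _ -> _} of \0].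
have z0c : continuous z0 by move=> y; exact: cst_continuous.
have E : d \o shift x = cst (d x) + z0 +o_ 0 id.
  apply/eqaddoP => _/posnumP[e]; rewrite dx.
  have : \forall h \near 0, d (h + x) = 0.
    have := d0; rewrite (near_shift 0) /= subr0 //.
  apply: filterS => h /= dh.
  by rewrite fctE /= dh /= !fctE /= addr0 subr0 normr0 mulr_ge0.
by apply/diff_locallyP; rewrite (diff_unique z0c E).
Qed.

Lemma near_differentiable m (f g : 'rV[R]_n -> 'rV[R]_m) x :
  (\forall z \near x, f z = g z) -> differentiable f x -> differentiable g x.
Proof.
move=> fg df; have -> : g = f + (g - f) by apply/funext => z; rewrite !fctE addrC subrK.
apply: (differentiableD df); apply: differentiable_near0.
by apply: filterS fg => z; rewrite !fctE => ->; rewrite subrr.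
Qed.

Lemma elem_iter_derive m U (F : 'rV[R]_n -> 'rV[R]_m) vs :
  open U -> elem_map U F -> exists2 G : 'rV[R]_n -> 'rV[R]_m,
    elem_map U G & forall z, U z -> iter_derive F vs z = G z.
Proof.
move=> oU EF; elim: vs => [|v vs [G EG FG]] /=; first by exists F.
have near_eq z : U z -> \forall y \near z, iter_derive F vs y = G y.
  by move=> Uz; apply: filterS (open_nbhs_nbhs (conj oU Uz)) => y; exact: FG.
have [dG EdG] := fin_all_exists EG.
exists (fun x => \row_j dG j x v) => [j|z Uz].
  have [ddg Edg] := elem_derive (EdG j) v.
  by exists ddg; congr elem: Edg; apply/funext => x; rewrite mxE.
rewrite (near_eq_derive _ (near_eq z Uz)); apply/rowP => j.
by rewrite mxE (elem_map_derive v EG Uz (EdG j)).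
Qed.

(** Iterated derivatives of elementary maps are elementary on an open set, hence differentiable
there. *)
Lemma elem_smooth m U (F : 'rV[R]_n -> 'rV[R]_m) x :
  open U -> elem_map U F -> U x -> smooth_at F x.
Proof.
move=> oU EF Ux; apply: filterS (open_nbhs_nbhs (conj oU Ux)) => z Uz vs.
have [G EG FG] := elem_iter_derive vs oU EF.
apply: near_differentiable (elem_map_differentiable EG Uz).
by apply: filterS (open_nbhs_nbhs (conj oU Uz)) => y /FG.
Qed.
Lemma elem_sdiff m U (F : 'rV[R]_n -> 'rV[R]_m) x dF :
  open U -> (forall j, elem U (fun x => F x 0 j) (dF j)) -> U x ->
  sdiff F x (\matrix_(i, j) dF j x (delta_mx 0 i)).
Proof.
move=> oU EF Ux; have EF' : elem_map U F by move=> j; exists (dF j); exact: EF.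
have E i j : ('D_(delta_mx 0 i) F x) 0 j = dF j x (delta_mx 0 i).
  exact: elem_map_derive EF' Ux (EF j).
rewrite (_ : (\matrix_(i, j) _) = 'J F x).
  exact: sdiff_smooth (elem_smooth oU EF' Ux).
apply/row_matrixP => i; rewrite [RHS]rowE.
rewrite -deriveEjacobian; last exact: elem_map_differentiable EF' Ux.
by apply/rowP => j; rewrite !mxE E.
Qed.

End Elementary.

Lemma elem_comp (R : realType) m n (V : set 'rV[R]_m) (U : set 'rV[R]_n)
    (G : 'rV[R]_m -> 'rV[R]_n) f df :
  elem_map V G -> (forall x, V x -> U (G x)) -> elem U f df ->
  exists df', elem V (f \o G) df'.
Proof.
move=> EG VU; elim=> {f df} [c|i|f df g dg _ [f' Ef] _ [g' Eg]|
  f df g dg _ [f' Ef] _ [g' Eg]|f df f0 _ [f' Ef]|f df _ [f' Ef]|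
  f df f0 _ [f' Ef]|f df _ [f' Ef]|f df _ [f' Ef]|f df _ [f' Ef]].
- by eexists; exact: ElemCst.
- exact: EG.
- by eexists; exact: (ElemAdd Ef Eg).
- by eexists; exact: (ElemMul Ef Eg).
- by eexists; apply: (ElemInv _ Ef) => x /VU/f0.
- by eexists; exact: (ElemExp Ef).
- by eexists; apply: (ElemLn _ Ef) => x /VU/f0.
- by eexists; exact: (ElemSin Ef).
- by eexists; exact: (ElemCos Ef).
- by eexists; exact: (ElemAtan Ef).
Qed.

Lemma elem_map_comp (R : realType) m n p (V : set 'rV[R]_m) (U : set 'rV[R]_n)
    (G : 'rV[R]_m -> 'rV[R]_n) (F : 'rV[R]_n -> 'rV[R]_p) :
  elem_map V G -> (forall x, V x -> U (G x)) -> elem_map U F -> elem_map V (F \o G).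
Proof. by move=> EG VU EF j; have [df /(elem_comp EG VU)] := EF j. Qed.


(** * The straightened charts *)

Section Planar.
Variable R : realType.
Implicit Types (a b t rho : R) (v : 'rV[R]_2) (x : 'rV[R]_3).

(** The transpose of the usual rotation matrix, because vectors are rows. *)
Definition rotmx a : 'M[R]_2 :=
  \matrix_(i, j) (if i == j then cos a else if i == 0 then sin a else - sin a).

Definition pol rho a : 'rV[R]_2 :=
  \row_j (expR rho * (if j == 0 then cos a else sin a)).

Definition pt v t : 'rV[R]_3 := row_mx v (t%:M : 'M[R]_1).

Lemma ord2P (P : 'I_2 -> Prop) : P 0 -> P 1 -> forall i, P i.
Proof.
move=> P0 P1 [[|[|//]] Hi].
- by rewrite (_ : Ordinal _ = 0)//; exact: val_inj.
- by rewrite (_ : Ordinal _ = 1)//; exact: val_inj.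
Qed.

Lemma det2 (A : 'M[R]_2) : \det A = A 0 0 * A 1 1 - A 0 1 * A 1 0.
Proof.
rewrite (expand_det_row _ 0) big_ord_recl big_ord1 /cofactor !det_mx11 !mxE /=.
rewrite expr0 expr1 mul1r mulN1r mulrN.
by congr (A _ _ * A _ _ - A _ _ * A _ _); apply: val_inj.
Qed.

Lemma rotmxD a b : rotmx (a + b) = rotmx a *m rotmx b.
Proof.
apply/matrixP; apply: ord2P; apply: ord2P; rewrite !mxE big_ord_recl big_ord1 !mxE /=
  ?cosD ?sinD; ring.
Qed.

Lemma rotmx0 : rotmx 0 = 1%:M.
Proof.
by apply/matrixP; apply: ord2P; apply: ord2P; rewrite !mxE /= ?cos0 ?sin0 ?oppr0.
Qed.

Lemma rotmx_period a (k : int) : rotmx (a + k%:~R * (pi *+ 2)) = rotmx a.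
Proof.
have [Ec Es] : cos (a + k%:~R * (pi *+ 2)) = cos a /\
    sin (a + k%:~R * (pi *+ 2)) = sin a.
  by have := cis_period a k; rewrite /cis => -[-> ->].
by apply/matrixP => i j; rewrite !mxE Ec Es.
Qed.

Lemma det_rotmx a : \det (rotmx a) = 1.
Proof.
rewrite det2 !mxE /= -(cos2Dsin2 a); ring.
Qed.

Lemma pol_rot rho a b : pol rho a *m rotmx b = pol rho (a + b).
Proof.
apply/rowP; apply: ord2P; rewrite !mxE big_ord_recl big_ord1 !mxE /= ?cosD ?sinD; ring.
Qed.

Lemma pt0 v t : pt v t 0 0 = v 0 0.
Proof.
have -> : (0 : 'I_3) = lshift 1 (0 : 'I_2) by apply: val_inj.
by rewrite /pt (row_mxEl v).
Qed.

Lemma pt1 v t : pt v t 0 1 = v 0 1.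
Proof.
have -> : (1 : 'I_3) = lshift 1 (1 : 'I_2) by apply: val_inj.
by rewrite /pt (row_mxEl v).
Qed.

Lemma pt2 v t : pt v t 0 2 = t.
Proof.
have -> : (2 : 'I_3) = rshift 2 (0 : 'I_1) by apply: val_inj.
by rewrite /pt (row_mxEr v) mxE eqxx.
Qed.

Lemma ptE v t : pt v t = row3 (v 0 0) (v 0 1) t.
Proof. by apply: row3_eq; rewrite row3E ?pt0 ?pt1 ?pt2. Qed.

Lemma ptP (x : 'rV[R]_3) : exists v t, x = pt v t.
Proof.
exists (\row_j (if j == 0 then x 0 0 else x 0 1)), (x 0 2).
by apply: row3_eq; rewrite ?pt0 ?pt1 ?pt2 ?mxE.
Qed.

Lemma pt_inj v t v' t' : pt v t = pt v' t' -> v = v' /\ t = t'.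
Proof. by rewrite !ptE => /row3_inj[E0 E1 E2]; split=> //; apply/rowP; apply: ord2P. Qed.

Lemma pt_core t : pt 0 t = row3 0 0 t.
Proof. by rewrite ptE !mxE. Qed.

Lemma pt_pol rho a t : pt (pol rho a) t = polar3 rho a t.
Proof. by rewrite ptE !mxE. Qed.

Lemma polP v : v = 0 \/ exists rho a, v = pol rho a.
Proof.
have [[t]|[rho [a [t]]]] := row3_polarP (pt v 0).
  by rewrite -pt_core => /pt_inj[-> _]; left.
by rewrite -pt_pol => /pt_inj[-> _]; right; exists rho, a.
Qed.

Lemma pol_neq0 rho a : pol rho a <> 0.
Proof.
move=> /(congr1 (fun v : 'rV_2 => v *m v^T)) /matrixP/(_ 0 0).
rewrite mul0mx !mxE big_ord_recl big_ord1 !mxE /=.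
have -> : expR rho * cos a * (expR rho * cos a) + expR rho * sin a * (expR rho * sin a) =
  expR rho ^+ 2 * (cos a ^+ 2 + sin a ^+ 2) by ring.
by rewrite cos2Dsin2 mulr1 => /eqP; rewrite sqrf_eq0 expR_eq0.
Qed.

Lemma ptD v t v' t' : pt v t + pt v' t' = pt (v + v') (t + t').
Proof. by rewrite /pt (add_row_mx v) -raddfD. Qed.

Lemma ptB v t v' t' : pt v t - pt v' t' = pt (v - v') (t - t').
Proof. by rewrite /pt (opp_row_mx v') (add_row_mx v) -raddfN -raddfD. Qed.

Lemma pt_norm v t : `|pt v t| = Num.max `|v| `|t|.
Proof.
apply/eqP; rewrite eq_le; apply/andP; split.
  apply: row_norm_le => [|j]; first by rewrite le_max normr_ge0.
  move: j; apply: ord3P; rewrite ?pt0 ?pt1 ?pt2 le_max ?lexx ?orbT//;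
    by rewrite entry_norm_le.
rewrite ge_max; apply/andP; split; last first.
  by apply: le_trans (entry_norm_le _ 0 2); rewrite pt2.
apply: row_norm_le; first exact: normr_ge0.
apply: ord2P.
  by apply: le_trans (entry_norm_le _ 0 0); rewrite pt0.
by apply: le_trans (entry_norm_le _ 0 1); rewrite pt1.
Qed.

Definition xi (x : 'rV[R]_3) : 'rV[R]_2 := \row_j (if j == 0 then x 0 0 else x 0 1).

Lemma xi_pt v t : xi (pt v t) = v.
Proof. by apply/rowP; apply: ord2P; rewrite mxE /= ?pt0 ?pt1. Qed.

Lemma xiB (x y : 'rV[R]_3) : xi (x - y) = xi x - xi y.
Proof. by apply/rowP; apply: ord2P; rewrite !mxE. Qed.

Lemma xi_norm x : `|xi x| <= `|x|.
Proof.
apply: row_norm_le; first exact: normr_ge0.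
by apply: ord2P; rewrite mxE entry_norm_le.
Qed.

(** The differentials, along the core, of the maps that preserve the core; [A] is the differential
in the normal directions. *)
Definition blk (A : 'M[R]_2) (u : 'M[R]_(2, 1)) (c : R) : 'M[R]_3 :=
  block_mx A u 0 (c%:M : 'M[R]_1).

Lemma blkM A u c A' u' c' :
  blk A u c *m blk A' u' c' = blk (A *m A') (A *m u' + c' *: u) (c * c').
Proof.
rewrite /blk (mulmx_block A u 0 c%:M A' u' 0 c'%:M) !mul0mx !mulmx0 !addr0 !add0r.
by rewrite -scalar_mxM mul_mx_scalar.
Qed.

Lemma blk1 : blk 1%:M 0 1 = 1%:M.
Proof. by rewrite /blk -(scalar_mx_block 2 1 (1 : R)). Qed.

Lemma det_blk A u c : \det (blk A u c) = \det A * c.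
Proof. by rewrite /blk (det_ublock A u c%:M) det_scalar1. Qed.

Lemma mul_pt_blk v t A u c :
  pt v t *m blk A u c = pt (v *m A) ((v *m u) 0 0 + t * c).
Proof.
rewrite /pt /blk (mul_row_block v t%:M A u 0 c%:M) mulmx0 addr0.
have -> : v *m u + t%:M *m c%:M = ((v *m u) 0 0 + t * c)%:M => //.
by rewrite -scalar_mxM {1}[v *m u]mx11_scalar -raddfD.
Qed.

Lemma blk_inj A u c A' u' c' :
  blk A u c = blk A' u' c' -> [/\ A = A', u = u' & c = c'].
Proof.
move=> /(@eq_block_mx _ 2 1 2 1)[-> -> _ /matrixP/(_ 0 0)]; by rewrite !mxE eqxx.
Qed.

Lemma blkP (M : 'M[R]_3) c : pt 0 1 *m M = pt 0 c -> exists A u, M = blk A u c.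
Proof.
rewrite -(@submxK _ 2 1 2 1 M); move: (@ulsubmx _ 2 1 2 1 M) (@ursubmx _ 2 1 2 1 M)
  (@dlsubmx _ 2 1 2 1 M) (@drsubmx _ 2 1 2 1 M) => A u d e.
rewrite /pt (mul_row_block 0 1%:M A u d e) !mul0mx !add0r !mul1mx.
by move=> E; have [-> ->] := @eq_row_mx _ 1 2 1 _ _ _ _ E; exists A, u.
Qed.

End Planar.

Section KappaGeometry.
Variables (R : realType) (q p b : int).
Hypotheses (cop_qp : coprimez q p) (q_gt0 : 0 < q).
Local Notation M := (seifert R q p b).
Local Notation Reg := (Reg q p b).
Local Notation Core := (Core q p b).
Local Notation mer := (mer q p b).
Local Notation twi := (twi q p b).
Local Notation lon1 := (lon1 q p b).
Local Notation lon2 := (lon2 q p b).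
Local Notation kappa := (@kappa R q p b).
Local Notation slope := (@slope R q p b).
Local Notation tau := (pi *+ 2 : R).
Implicit Types (e : bool) (k : int) (t : R).

Let mer_neq0 e : (mer e)%:~R != 0 :> R.
Proof. by rewrite intr_eq0 gt_eqF ?mer_gt0. Qed.

Let bezoutR e :
  (lon1 e)%:~R * (mer e)%:~R + (lon2 e)%:~R * (twi e)%:~R = 1 :> R.
Proof. by rewrite -!intrM -intrD bezout_end. Qed.

Let tau_gt0 : 0 < tau.
Proof. by rewrite mulrn_wgt0// pi_gt0. Qed.

Lemma Reg_inj t beta h t' beta' h' : Reg t beta h = Reg t' beta' h' ->
  [/\ t = t', beta = beta' & h = h'].
Proof. by case. Qed.

Lemma Core_inj e (v : circle R) e' v' : Core e v = Core e' v' -> e = e' /\ v = v'.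
Proof. by move=> H; split; case: H. Qed.

Lemma kappa_pt0 e t : kappa e (pt 0 t) = Core e (expi t).
Proof. by rewrite pt_core kappa_core. Qed.

Lemma kappa_pol e rho a t : kappa e (pt (pol rho a) t) =
  Reg ((end_sign e)%:~R * (1 - rho)) (expi ((end_sign e)%:~R * ((mer e)%:~R * a)))
    (expi ((twi e)%:~R * a - t / (mer e)%:~R)).
Proof. by rewrite pt_pol kappa_polar. Qed.

(** A full turn along the core, compensated by a rotation of the disc, is a deck transformation
of the chart [kappa e]: by the relation of Bezout between [mer], [twi], [lon1] and [lon2]. *)
Lemma kappa_deck e k (v : 'rV[R]_2) t :
  kappa e (pt (v *m rotmx (k%:~R * tau * slope e)) (t + k%:~R * tau)) =
  kappa e (pt v t).
Proof.
have E := bezoutR e.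
case: (polP v) => [->|[rho [a ->]]].
  by rewrite mul0mx !kappa_pt0; congr (Defs.Core _ _ _ _ _); apply/expi_eq; exists k.
rewrite pol_rot !kappa_pol /slope; congr (Defs.Reg _ _ _ _ _ _); apply/expi_eq.
  exists (end_sign e * (lon2 e * k)); rewrite !intrM.
  by have := mer_neq0 e; move: ((mer e)%:~R : R) => m m0; field.
exists (- (k * lon1 e)); rewrite intrN intrM.
have := mer_neq0 e; move: E.
move: ((mer e)%:~R : R) ((lon1 e)%:~R : R) ((lon2 e)%:~R : R) ((twi e)%:~R : R).
move=> m r s u E m0; have -> : r = (1 - s * u) / m by rewrite -E addrK mulfK.
by field.
Qed.

Lemma end_sign_unit e : (end_sign e)%:~R * (end_sign e)%:~R = 1 :> R.
Proof. by case: e => /=; rewrite ?mulr1// mulrNN mulr1. Qed.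

Lemma end_sign_inj e (x y : R) :
  (end_sign e)%:~R * x = (end_sign e)%:~R * y -> x = y.
Proof.
by move=> E; rewrite -[x]mul1r -[y]mul1r -(end_sign_unit e) -!mulrA E.
Qed.

Lemma end_sign_flip e (x y : R) k :
  (end_sign e)%:~R * x = (end_sign e)%:~R * y + k%:~R * tau ->
  x = y + (end_sign e * k)%:~R * tau.
Proof.
move=> H; rewrite -[x]mul1r -(end_sign_unit e) -mulrA H mulrDr mulrA end_sign_unit.
by rewrite mul1r intrM mulrA.
Qed.

(** The chart [kappa e] is the quotient map by the deck transformations of [kappa_deck]. *)
Lemma kappa_inj e (v : 'rV[R]_2) t (v' : 'rV[R]_2) t' : kappa e (pt v t) = kappa e (pt v' t') ->
  exists k, t' = t + k%:~R * tau /\ v' = v *m rotmx (k%:~R * tau * slope e).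
Proof.
have E := bezoutR e.
case: (polP v) => [->|[rho [a ->]]]; case: (polP v') => [->|[rho' [a' ->]]].
- rewrite !kappa_pt0 => /Core_inj[_ /esym/(expi_eq _ _).1[k Ek]]; exists k; split=> //.
  by rewrite mul0mx.
- by rewrite kappa_pt0 kappa_pol.
- by rewrite kappa_pt0 kappa_pol.
rewrite !kappa_pol => /Reg_inj[/end_sign_inj/addrI/oppr_inj Er /expi_eq[j Ej] /expi_eq[l El]].
move: (end_sign_flip Ej); move: (end_sign e * j) => {}j {}Ej.
have {}Ej' : (mer e)%:~R * a' = (mer e)%:~R * a - j%:~R * tau.
  by rewrite Ej addrK.
exists (mer e * l - twi e * j); rewrite pol_rot Er /slope.
have m0 := mer_neq0 e.
have Ea : a' = a - j%:~R * tau / (mer e)%:~R.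
  by apply: (mulfI m0); rewrite mulrBr Ej' [_ * (_ / _)]mulrC divfK.
split.
  have := El; rewrite Ea intrB !intrM.
  move: ((mer e)%:~R : R) ((twi e)%:~R : R) m0 => m u m0 {}El.
  have -> : t' = m * (u * (a - j%:~R * tau / m) - (u * (a - j%:~R * tau / m) - t' / m)).
    by field.
  have -> : u * (a - j%:~R * tau / m) - t' / m = u * a - t / m - l%:~R * tau.
    by rewrite El addrK.
  by field.
have Es : pol rho' a' = pol rho' (a' + (lon2 e * l + lon1 e * j)%:~R * tau).
  by apply/rowP => i; rewrite !mxE; have := cis_period a' (lon2 e * l + lon1 e * j);
     rewrite /cis => -[-> ->].
rewrite Es Ea; congr pol; rewrite intrD intrB !intrM.
move: ((mer e)%:~R : R) ((lon1 e)%:~R : R) ((lon2 e)%:~R : R) ((twi e)%:~R : R) m0 E.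
move=> m r s u m0 E; have -> : r = (1 - s * u) / m by rewrite -E addrK mulfK.
by field.
Qed.

Lemma kappa_loc_inj e (v : 'rV[R]_2) t (v' : 'rV[R]_2) t' :
  kappa e (pt v t) = kappa e (pt v' t') -> `|t - t'| < tau -> v = v' /\ t = t'.
Proof.
move=> /kappa_inj[k [-> ->]].
rewrite opprD addrA subrr add0r normrN normrM (gtr0_norm tau_gt0).
rewrite gtr_pMl// -intr_norm ltrz1 => k1.
have -> : k = 0 by lia.
by rewrite !mul0r rotmx0 mulmx1 addr0.
Qed.

Lemma kappa_loc_inj3 e (x y : 'rV[R]_3) :
  kappa e x = kappa e y -> `|x - y| < 1 -> x = y.
Proof.
have [v [t ->]] := ptP x; have [v' [t' ->]] := ptP y.
move=> E; rewrite ptB pt_norm gt_max => /andP[_ t1].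
have [|-> ->//] := kappa_loc_inj E.
by apply: lt_trans t1 _; rewrite mulr2n; have := @pi_ge2 R; lra.
Qed.

(** In the chart [kappa e] a fiber is the union of the vertical lines over an orbit of the rotation
by [2 pi / mer e] in the disc. *)
Lemma fiber_kappa e (v : 'rV[R]_2) : exists2 L, fiber L &
  forall k t, L (kappa e (pt (v *m rotmx (k%:~R * tau / (mer e)%:~R)) t)).
Proof.
case: (polP v) => [->|[rho [a ->]]].
  exists (range (Core e)); first by right; exists e.
  by move=> k t; rewrite mul0mx kappa_pt0; exists (expi t).
exists (range (Reg ((end_sign e)%:~R * (1 - rho))
    (expi ((end_sign e)%:~R * ((mer e)%:~R * a))))).
  by left; do 2 eexists.
move=> k t; rewrite pol_rot kappa_pol.
eexists; first by []; congr (Defs.Reg _ _ _ _ _ _); apply/expi_eq.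
exists (- (end_sign e * k)); rewrite intrN intrM.
by have := mer_neq0 e; move: ((mer e)%:~R : R) => m m0; field.
Qed.

Lemma fiber_kappa_inv e L (v : 'rV[R]_2) t (v' : 'rV[R]_2) t' : fiber L ->
  L (kappa e (pt v t)) -> L (kappa e (pt v' t')) ->
  exists k, v' = v *m rotmx (k%:~R * tau / (mer e)%:~R).
Proof.
case: (polP v) => [->|[rho [a ->]]]; case: (polP v') => [->|[rho' [a' ->]]];
  rewrite ?kappa_pt0 ?kappa_pol => -[[t0 [beta ->]]|[e0 ->]] [h _ E] [h' _ E'] //.
- by exists 0; rewrite mul0mx.
have [Et Eb _] := Reg_inj E; have [Et' Eb' _] := Reg_inj E'.
have Er : rho = rho' by move: Et; rewrite Et' => /end_sign_inj/addrI/oppr_inj.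
have : expi ((end_sign e)%:~R * ((mer e)%:~R * a')) =
  expi ((end_sign e)%:~R * ((mer e)%:~R * a)) by rewrite -Eb.
move=> /expi_eq[k Ek]; exists (end_sign e * k); rewrite pol_rot -Er; congr pol.
have {}Ek : (mer e)%:~R * a' = (mer e)%:~R * a + (end_sign e * k)%:~R * tau.
  exact: end_sign_flip.
by rewrite -[a'](mulKf (mer_neq0 e)) Ek; have := mer_neq0 e; move: ((mer e)%:~R : R) => m m0; field.
Qed.

Lemma Reg_kappa e t beta h : exists v t', v != 0 /\ Reg t beta h = kappa e (pt v t').
Proof.
have [x ->] := expi_surj beta; have [y ->] := expi_surj h.
pose a := (end_sign e)%:~R * x / (mer e)%:~R.
exists (pol (1 - (end_sign e)%:~R * t) a), ((mer e)%:~R * ((twi e)%:~R * a - y)).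
split; first exact/eqP/pol_neq0.
rewrite kappa_pol; congr (Defs.Reg _ _ _ _ (expi _) (expi _)).
- by rewrite opprB addrCA subrr addr0 mulrA end_sign_unit mul1r.
- by rewrite /a [_ * (_ / _)]mulrC divfK ?mer_neq0// mulrA end_sign_unit mul1r.
by rewrite mulrAC divff ?mer_neq0// mul1r opprB addrCA subrr addr0.
Qed.

Lemma seifert_cover e (P : M) : (exists v, P = Core (~~ e) v) \/ exists x, P = kappa e x.
Proof.
case: P => [t beta h|e' v].
  by right; have [w [t' [_ ->]]] := Reg_kappa e t beta h; eexists.
have [->|ne] := eqVneq e' e; last by left; exists v; case: e e' ne => -[].
by right; have [t ->] := expi_surj v; exists (pt 0 t); rewrite kappa_pt0.
Qed.

Lemma kappa_Core e e0 (v : 'rV[R]_2) t w : kappa e (pt v t) = Core e0 w -> v = 0 /\ e = e0.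
Proof.
by case: (polP v) => [->|[rho [a ->]]]; rewrite ?kappa_pt0 ?kappa_pol => // -[].
Qed.

End KappaGeometry.

(** * Fiber-preserving diffeomorphisms in the straightened charts *)

Section Jacobian3.
Variable R : realType.

Lemma det3 (N : 'M[R]_3) : \det N =
  N 0 0 * (N 1 1 * N 2 2 - N 1 2 * N 2 1) - N 0 1 * (N 1 0 * N 2 2 - N 1 2 * N 2 0)
  + N 0 2 * (N 1 0 * N 2 1 - N 1 1 * N 2 0).
Proof.
pose n (i j : nat) := N (inord i) (inord j).
have NE i j : N i j = n i j by rewrite /n !inord_val.
rewrite (expand_det_row _ 0) !big_ord_recl big_ord0 /cofactor !det2 !mxE !NE /=.
by rewrite /bump /= !addn0 ?addn1 ?add0n expr0 expr1 sqrrN expr1n; ring.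
Qed.

Lemma delta3 (i : 'I_3) : (delta_mx 0 i : 'rV[R]_3) =
  row3 (i == 0)%:R (i == 1)%:R (i == 2)%:R.
Proof. by apply: row3_eq; rewrite row3E !mxE /= eq_sym. Qed.

Lemma sdiff3 U (F : 'rV[R]_3 -> 'rV[R]_3) x d0 d1 d2 :
  open U -> U x ->
  elem U (fun x => F x 0 0) d0 -> elem U (fun x => F x 0 1) d1 ->
  elem U (fun x => F x 0 2) d2 ->
  exists2 N, sdiff F x N & \det N = (fun e0 e1 e2 =>
  d0 x e0 * (d1 x e1 * d2 x e2 - d2 x e1 * d1 x e2)
  - d1 x e0 * (d0 x e1 * d2 x e2 - d2 x e1 * d0 x e2)
  + d2 x e0 * (d0 x e1 * d1 x e2 - d1 x e1 * d0 x e2))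
    (row3 1 0 0) (row3 0 1 0) (row3 0 0 1).
Proof.
move=> oU Ux E0 E1 E2.
pose dF (j : 'I_3) := if j == 0 then d0 else if j == 1 then d1 else d2.
exists (\matrix_(i, j) dF j x (delta_mx 0 i)).
  by apply: elem_sdiff oU _ Ux; apply: ord3P; rewrite /dF /=.
by rewrite det3 !mxE !delta3 /dF /=.
Qed.

Lemma elem_map3 (n : nat) U (F : 'rV[R]_n -> 'rV[R]_3) :
  (exists d, elem U (fun x => F x 0 0) d) -> (exists d, elem U (fun x => F x 0 1) d) ->
  (exists d, elem U (fun x => F x 0 2) d) -> elem_map U F.
Proof. by move=> *; apply: ord3P. Qed.

Lemma elem_twist k : elem_map setT (@twist R k) /\
  forall x, exists2 N, sdiff (twist k) x N & \det N = 1.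
Proof.
have Ek := ElemMul (ElemCst (n := 3) setT k) (ElemCoord setT 2).
have E0 := ElemAdd (ElemMul (ElemCoord setT 0) (ElemCos Ek))
  (elem_opp (ElemMul (ElemCoord setT 1) (ElemSin Ek))).
have E1 := ElemAdd (ElemMul (ElemCoord setT 0) (ElemSin Ek))
  (ElemMul (ElemCoord setT 1) (ElemCos Ek)).
have T0 : (fun x => twist k x 0 0) =
  (fun x => x 0 0 * cos (k * x 0 2) + - (x 0 1 * sin (k * x 0 2))).
  by apply/funext => x; rewrite row3E.
have T1 : (fun x => twist k x 0 1) =
  (fun x => x 0 0 * sin (k * x 0 2) + x 0 1 * cos (k * x 0 2)).
  by apply/funext => x; rewrite row3E.
have T2 : (fun x => twist k x 0 2) = (fun x => x 0 2).
  by apply/funext => x; rewrite row3E.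
have E2 : elem setT (fun x => twist k x 0 2) (fun _ v => v 0 2).
  by rewrite T2; exact: ElemCoord.
move: E0 E1; rewrite -T0 -T1 => E0 E1.
split=> [|x]; first by apply: elem_map3; eexists; eassumption.
have /= [N dN EN] := sdiff3 openT (I : setT x) E0 E1 E2; exists N; rewrite // EN.
rewrite !row3E -[RHS](cos2Dsin2 (k * x 0 2)) /=; ring.
Qed.

End Jacobian3.

Section LocalExpressions.
Variables (R : realType) (q p b : int).
Hypotheses (cop_qp : coprimez q p) (q_gt0 : 0 < q).
Local Notation M := (seifert R q p b).
Local Notation kappa := (@kappa R q p b).
Local Notation Diff := (@Diff_plus_fp R q p b).

Lemma near_sdiff m n (g : 'rV[R]_m -> 'rV[R]_n) x N (P : 'rV[R]_n -> Prop) :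
  sdiff g x N -> (\forall z \near g x, P z) -> \forall z \near x, P (g z).
Proof.
move=> /sdiff_cvg C /near_normP[d d0 H]; have [d' d'0 H'] := C d d0.
by apply/near_normP; exists d' => // z /H'/H.
Qed.

Lemma kappa_local_expr f e e' (x y : 'rV[R]_3) : Diff f ->
  kappa e' y = f (kappa e x) ->
  exists g N, [/\ g x = y, \forall z \near x, kappa e' (g z) = f (kappa e z),
    sdiff g x N & 0 < \det N].
Proof.
move=> [[sf _] of_ _] Exy.
pose k := slope R q p b e; pose k' := slope R q p b e'.
have [g0 g0x [sg0 Eg0]] := sf (Some e) (Some e') (twist (- k) x) (twist (- k') y) Exy.
have dg0 := sdiff_smooth sg0.
have [N1 dN1 det1] := (elem_twist (- k)).2 x.
have [N2 dN2 det2] := (elem_twist k').2 (g0 (twist (- k) x)).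
exists (twist k' \o g0 \o twist (- k)), (N1 *m 'J g0 (twist (- k) x) *m N2); split.
- by rewrite /= g0x twistNK.
- apply: filterS (near_sdiff dN1 Eg0) => z Ez.
  by rewrite -[RHS]Ez /= /Defs.chart -chart_kappa.
- exact: sdiff_comp (sdiff_comp dN1 dg0) dN2.
by rewrite !det_mulmx det1 det2 mul1r mulr1; apply: (of_ _ _ _ _ (conj sg0 Eg0)).
Qed.

Lemma scale_pt (c : R) u s : c *: pt u s = pt (c *: u) (c * s).
Proof. by rewrite /pt (scale_row_mx c u) -scale_scalar_mx. Qed.

Lemma pt_core_norm (t t' : R) : `|pt 0 t - pt 0 t' : 'rV[R]_3| = `|t - t'|.
Proof.
rewrite ptB subrr pt_norm normr0; apply/max_idPr; exact: normr_ge0.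
Qed.

(** This is where [q] must be at least [2]. A diffeomorphism mapping the critical fiber to another
fiber would have, at a point of the
critical fiber, a singular differential transversally to the fibers: composed with the
projection to the local quotient by the fibers, it is invariant by a nontrivial rotation. *)
Lemma Core_preserved f : Diff f -> 1 < q -> forall v, exists w,
  f (Core q p b true v) = Core q p b true w.
Proof.
move=> Df q1 v; have [t ->] := expi_surj v; rewrite -kappa_pt0.
have [[w ->]|[y Ey]] := seifert_cover cop_qp q_gt0 false (f (kappa true (pt 0 t))).
  by exists w.
exfalso.
have [g [N [gx /near_normP[d1 d10 Eg] dg detN]]] := kappa_local_expr Df (esym Ey).
have fpf : fiber_preserving f by case: Df.
have same z z' L : `|z - pt 0 t| < d1 -> `|z' - pt 0 t| < d1 -> fiber L ->
    L (kappa true z) -> L (kappa true z') -> xi (g z) = xi (g z').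
  move=> zd z'd fL Lz Lz'.
  have [u [s Es]] := ptP (g z); have [u' [s' Es']] := ptP (g z').
  have [k] : exists k : int, u' = u *m rotmx (k%:~R * (pi *+ 2) / (mer q p b false)%:~R).
    have H1 : (f @` L) (kappa false (pt u s)).
      exact: (ex_intro2 _ _ _ Lz (etrans (esym (Eg z zd)) (congr1 _ Es))).
    have H2 : (f @` L) (kappa false (pt u' s')).
      exact: (ex_intro2 _ _ _ Lz' (etrans (esym (Eg z' z'd)) (congr1 _ Es'))).
    exact: (fiber_kappa_inv cop_qp q_gt0 (fpf _ fL) H1 H2).
  by rewrite /mer /= divr1 -[_ * _]add0r rotmx_period rotmx0 mulmx1 Es Es' !xi_pt.
pose NX : 'M[R]_(3, 2) := \matrix_(i, j) (if j == 0 then N i 0 else N i 1).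
have xi_mul (u : 'rV[R]_3) : xi (u *m N) = u *m NX.
  apply/rowP; apply: ord2P; rewrite !mxE /=; apply: eq_bigr => i _; rewrite mxE//=.
(* The differential of [xi \o g] vanishes on the differences of directions along which [xi \o g]
   takes the same values. *)
have zero (u u' : 'rV[R]_3) : (forall c : R, 0 < c -> `|c *: u| < d1 -> `|c *: u'| < d1 ->
    xi (g (pt 0 t + c *: u)) = xi (g (pt 0 t + c *: u'))) -> (u - u') *m NX = 0.
  move=> H; apply/eqP; rewrite -normr_le0; apply/ler_addgt0Pr => e e0; rewrite add0r.
  pose s := `|u| + `|u'| + 1; have s0 : 0 < s by rewrite ltr_wpDl// addr_ge0.
  have [d2 d20 Hd] := dg (e / s) (divr_gt0 e0 s0).
  pose c := Num.min d1 d2 / s.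
  have m0 : 0 < Num.min d1 d2 by rewrite lt_min d10.
  have c0 : 0 < c by rewrite divr_gt0.
  have cs (w : 'rV[R]_3) : `|w| < s -> `|c *: w| < d1 /\ `|c *: w| < d2.
    move=> ws; apply/andP; rewrite -lt_min normrZ gtr0_norm// /c mulrAC.
    by rewrite ltr_pdivrMr// ltr_pM2l.
  clearbody c; have us : `|u| < s by rewrite /s -addrA ltrDl ltr_wpDl.
  have u's : `|u'| < s by rewrite /s addrAC ltrDr ltr_wpDl.
  have [cu1 cu2] := cs _ us; have [cu'1 cu'2] := cs _ u's.
  have := Hd (pt 0 t + c *: u) (pt 0 t + c *: u').
  rewrite ![pt 0 t + _]addrC !addrK => /(_ cu2 cu'2).
  rewrite opprD addrACA subrr addr0 -scalerBr => Hle.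
  have {Hle} := le_trans (xi_norm _) Hle.
  rewrite !xiB xi_mul ![_ + pt 0 t]addrC (H _ c0 cu1 cu'1) subrr sub0r normrN.
  rewrite -scalemxAl !normrZ gtr0_norm// [leRHS]mulrCA ler_pM2l// => /le_trans; apply.
  rewrite -mulrA ler_piMr ?(ltW e0)// mulrC ler_pdivrMr// mul1r.
  by rewrite (le_trans (ler_normB _ _))// lerDl.
have ptZ c (u : 'rV[R]_2) s : pt 0 t + c *: pt u s = pt (c *: u) (t + c * s).
  by rewrite scale_pt ptD add0r.
have core0 : pt 0 1 *m NX = 0.
  rewrite -[pt 0 1]subr0; apply: zero => c c0 cd _.
  have [L fL HL] := @fiber_kappa R q p b cop_qp q_gt0 true (0 : 'rV[R]_2).
  apply: (same _ _ L) => //.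
  - by rewrite addrAC subrr add0r.
  - by rewrite scaler0 addr0 subrr normr0.
  - by rewrite ptZ scaler0; have := HL 0 (t + c * 1); rewrite mul0mx.
  - by rewrite scaler0 addr0; have := HL 0 t; rewrite mul0mx.
(* The rotation [rq] of the source preserves each fiber, hence [xi \o g], and [rq - 1] is
   invertible. *)
pose rq : 'M[R]_2 := rotmx (1%:~R * (pi *+ 2) / q%:~R).
have rot0 (u : 'rV[R]_2) : pt (u *m rq - u) 0 *m NX = 0.
  have -> : pt (u *m rq - u) 0 = pt (u *m rq) 0 - pt u 0 by rewrite ptB subrr.
  apply: zero => c c0 cd1 cd2.
  have [L fL HL] := @fiber_kappa R q p b cop_qp q_gt0 true (c *: u).
  apply: (same _ _ L) => //.
  - by rewrite addrAC subrr add0r.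
  - by rewrite addrAC subrr add0r.
  - by rewrite ptZ scalemxAl; exact: (HL 1).
  - rewrite ptZ; have := HL 0 (t + c * 0); rewrite !mul0r rotmx0 mulmx1.
    exact.
have unit : rq - 1%:M \in unitmx.
  rewrite unitmxE unitfE det2 !mxE /=.
  set th := 1%:~R * (pi *+ 2) / q%:~R : R.
  have -> : (cos th - 1%:R) * (cos th - 1%:R) - (sin th - 0%:R) * (- sin th - 0%:R)
    = (cos th ^+ 2 + sin th ^+ 2) + 1 - 2 * cos th by ring.
  rewrite cos2Dsin2; apply/eqP => E.
  have [k Ek] : exists k : int, th = k%:~R * (pi *+ 2) by apply: cos_eq1; lra.
  have pi0 : pi *+ 2 != 0 :> R by rewrite mulrn_eq0 negb_or /= gt_eqF ?pi_gt0.
  have q0 : q%:~R != 0 :> R by rewrite intr_eq0 gt_eqF.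
  have : (1%:~R : R) = (k * q)%:~R.
    rewrite intrM; apply: (mulIf pi0); rewrite -mulrA [q%:~R * _]mulrC mulrA -Ek.
    by rewrite /th divfK.
  move/eqP; rewrite eqr_int => /eqP Ekq; clear - Ekq q1.
  by case: (lerP k 0) => k0; nia.
have all0 (u : 'rV[R]_2) (s : R) : pt u s *m NX = 0.
  have -> : pt u s = pt (u *m invmx (rq - 1%:M) *m rq - u *m invmx (rq - 1%:M)) 0 + s *: pt 0 1.
    rewrite scale_pt ptD scaler0 addr0 add0r mulr1.
    by rewrite -[X in _ - X]mulmx1 -mulmxBr mulmxKV.
  by rewrite mulmxDl rot0 -scalemxAl core0 scaler0 addr0.
suff : \det N = 0 by move=> E; rewrite E ltxx in detN.
have NX0 : NX = 0.
  apply/row_matrixP => i; rewrite row0 rowE.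
  by have [u [s ->]] := ptP (delta_mx 0 i : 'rV[R]_3); rewrite all0.
have N0 i : N i 0 = 0 by have := congr1 (fun A : 'M[R]_(3, 2) => A i 0) NX0; rewrite !mxE.
have N1 i : N i 1 = 0 by have := congr1 (fun A : 'M[R]_(3, 2) => A i 1) NX0; rewrite !mxE.
by rewrite det3 !N0 !N1; ring.
Qed.

End LocalExpressions.

(** * Functions of a real variable *)

Section RealLine.
Variable R : realType.
Implicit Types (f F : R -> R) (t c : R).

Lemma is_derive_epsilon f t c :
  (forall e : R, 0 < e -> exists2 d : R, 0 < d & forall s, `|s - t| < d ->
     `|f s - f t - (s - t) * c| <= e * `|s - t|) ->
  is_derive t (1 : R) f c.
Proof.
move=> H; suff C : h^-1 *: (f (h *: 1 + t) - f t) @[h --> 0^'] --> c.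
  by apply: DeriveDef; [apply/cvg_ex; exists c; exact: C|exact: (cvg_lim _ C)].
apply/cvgrPdist_le => e e0; have [d d0 Hd] := H e e0.
near=> h; have h0 : h != 0 by near: h; exact: nbhs_dnbhs_neq.
have hd : `|h| < d by near: h; exact: dnbhs0_lt.
have := Hd (h + t); rewrite addrK => /(_ hd).
rewrite -(ler_pM2l (x := `|h|^-1)) ?invr_gt0 ?normr_gt0// -normfV -normrM.
rewrite mulrCA normfV mulVf ?normr_eq0// mulr1 distrC.
have E (x y : R) : x *: y = x * y by [].
by congr (`|_| <= _); rewrite !E mulr1; field.
Unshelve. all: by end_near. Qed.

Lemma derive0_cst_itv F (a c : R) : a <= c ->
  (forall t, a <= t <= c -> is_derive t (1 : R) F 0) -> F a = F c.
Proof.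
move=> ac H; have dF t : t \in `]a, c[ -> is_derive t (1 : R) F (cst 0 t).
  by move=> /subset_itv_oo_cc; rewrite in_itv/=; exact: H.
have cF : {within `[a, c], continuous F}.
  apply: derivable_within_continuous => t; rewrite in_itv/= => /H D.
  exact: ex_derive.
have [? _] := MVT_segment ac dF cF.
by rewrite mul0r => /eqP; rewrite subr_eq0 => /eqP.
Qed.

Lemma locally_cst F : (forall t, exists2 d : R, 0 < d & forall s, `|s - t| < d -> F s = F t) ->
  forall t s, F t = F s.
Proof.
move=> H t s; apply: is_derive_0_is_cst => {t s} t.
apply: is_derive_epsilon => e e0; have [d d0 Hd] := H t; exists d => // s /Hd ->.
by rewrite subrr mulr0 subr0 normr0 mulr_ge0// ltW.
Qed.

Lemma primitive_itv f (n : nat) : continuous f ->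
  exists2 F, F 0 = 0 & forall t, `|t| < n.+1%:R -> is_derive t (1 : R) F (f t).
Proof.
move=> cf; pose a : R := - n.+1%:R; pose u : R := n.+1%:R.
pose F0 y := (\int[lebesgue_measure]_(t in `[a, y]) f t)%R.
exists (fun y => F0 y - F0 0); first by rewrite subrr.
move=> t; rewrite ltr_norml => /andP[at_ tu].
have intf : lebesgue_measure.-integrable `[a, u] (EFin \o f).
  apply: continuous_compact_integrable; first exact: segment_compact.
  exact: continuous_subspaceT.
have [|D1 D2] := @continuous_FTC1 _ f (BLeft a) t u tu intf _ (cf t).
  exact: at_.
have DF : is_derive t (1 : R) F0 (f t).
  by rewrite derive1E in D2; exact: (DeriveDef D1 D2).
have := is_deriveB DF (is_derive_cst (F0 0) t 1); rewrite subr0.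
by [].
Qed.

Lemma primitive f : continuous f ->
  exists2 F, F 0 = 0 & forall t, is_derive t (1 : R) F (f t).
Proof.
move=> cf; have H n := primitive_itv n cf.
have [G G0] : exists G : nat -> R -> R, forall n, G n 0 = 0 /\
    forall t, `|t| < n.+1%:R -> is_derive t (1 : R) (G n) (f t).
  have [G HG] := choice (fun n => (exists2P _ _).1 (H n)); exists G => n.
  exact: HG.
pose N (t : R) := Num.truncn `|t|.
have NP t : `|t| < (N t).+1%:R by exact: truncnS_gt.
have eqG n m t : `|t| < n.+1%:R -> `|t| < m.+1%:R -> G n t = G m t.
  move=> tn tm; pose D x := G n x - G m x.
  have DD x : `|x| <= `|t| -> is_derive x (1 : R) D 0.
    move=> xt; have Dn := (G0 n).2 x (le_lt_trans xt tn).
    have Dm := (G0 m).2 x (le_lt_trans xt tm).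
    by have := is_deriveB Dn Dm; rewrite subrr.
  suff : D 0 = D t.
    by rewrite /D !(G0 _).1 subrr => /esym/eqP; rewrite subr_eq0 => /eqP.
  have [t0|t0] := leP 0 t.
    apply: derive0_cst_itv => // x /andP[x0 xt]; apply: DD.
    by rewrite !ger0_norm// (le_trans x0).
  apply/esym/derive0_cst_itv => [|x /andP[xt x0]]; first exact: ltW.
  by apply: DD; rewrite !ler0_norm ?lerN2// ltW.
exists (fun t => G (N t) t) => [|t]; first exact: (G0 _).1.
have := (G0 (N t)).2 t (NP t); apply: near_eq_is_derive.
near=> s; apply: eqG; last exact: NP.
near: s; apply/nbhs_ballP; exists ((N t).+1%:R - `|t|) => /=; first by rewrite subr_gt0.
move=> s; rewrite /ball /= ltrBrDl distrC => Hs.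
by rewrite -[s](subrK t) addrC (le_lt_trans (ler_normD _ _)).
Unshelve. all: by end_near. Qed.

End RealLine.

(** * Local expressions along the critical fiber *)

Section Lifts.
Variables (R : realType) (q p b : int).
Hypotheses (cop_qp : coprimez q p) (q_gt1 : 1 < q).
Let q_gt0 : 0 < q. Proof. exact: lt_trans q_gt1. Qed.
Local Notation M := (seifert R q p b).
Local Notation K := (@kappa R q p b true).
Local Notation Diff := (@Diff_plus_fp R q p b).
Local Notation sl := (@slope R q p b true).
Local Notation tau := (pi *+ 2 : R).
Opaque kappa.

Definition zeta (k : int) : 'M[R]_2 := rotmx (k%:~R * tau * sl).

Definition deck (k : int) (x : 'rV[R]_3) : 'rV[R]_3 :=
  x *m blk (zeta k) 0 1 + pt 0 (k%:~R * tau).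

Let tau_gt0 : 0 < tau.
Proof. by rewrite mulrn_wgt0// pi_gt0. Qed.

Lemma deck_pt k v t : deck k (pt v t) = pt (v *m zeta k) (t + k%:~R * tau).
Proof. by rewrite /deck mul_pt_blk mulmx0 mxE add0r mulr1 ptD addr0. Qed.

Lemma kappa_deckE k x : K (deck k x) = K x.
Proof. by have [v [t ->]] := ptP x; rewrite deck_pt kappa_deck. Qed.

Lemma sdiff_deck k x : sdiff (deck k) x (blk (zeta k) 0 1).
Proof. exact: sdiff_linear. Qed.

Lemma zeta0 : zeta 0 = 1%:M.
Proof. by rewrite /zeta !mul0r rotmx0. Qed.

Lemma zetaD k l : zeta (k + l) = zeta k *m zeta l.
Proof. by rewrite /zeta -rotmxD intrD !mulrDl. Qed.

Lemma det_zeta k : \det (zeta k) = 1.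
Proof. exact: det_rotmx. Qed.

(** Epsilon-delta continuity, which is what [sdiff_cvg] provides. *)
Definition cont (g : 'rV[R]_3 -> 'rV[R]_3) x : Prop :=
  forall e : R, 0 < e -> exists2 d : R, 0 < d &
  forall z : 'rV[R]_3, `|z - x| < d -> `|g z - g x| < e.

Lemma sdiff_cont g x N : sdiff g x N ->
  exists2 d : R, 0 < d & forall y, `|y - x| < d -> cont g y.
Proof.
move=> /sdiff_lipschitz[c c0 [d d0 L]]; exists d => // y yx e e0.
exists (Num.min (d - `|y - x|) (e / c)) => [|z].
  by rewrite lt_min subr_gt0 yx divr_gt0.
rewrite lt_min => /andP[zd ze]; apply: le_lt_trans (L _ _ _ yx) _.
  by rewrite -[z](subrK y) -addrA (le_lt_trans (ler_normD _ _))// -ltrBrDr.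
by rewrite mulrC -ltr_pdivlMr.
Qed.

(** Near a point, continuous local expressions of the same map are lifts of it through the covering
[kappa true], so they differ by the same deck transformation as at the point. *)
Lemma local_expr_deck (f : M -> M) g g' x k :
  (\forall z \near x, K (g z) = f (K z)) ->
  (\forall z \near x, K (g' z) = f (K z)) ->
  cont g x -> cont g' x -> g' x = deck k (g x) ->
  \forall z \near x, g' z = deck k (g z).
Proof.
move=> /near_normP[d1 d10 Eg] /near_normP[d2 d20 Eg'] cg cg' Ex.
have half0 : 0 < 1 / 2 :> R by rewrite divr_gt0.
have [d3 d30 Hd] := cg' _ half0.
have [e e0 He] := sdiff_cvg (sdiff_deck k (g x)) half0.
have [d4 d40 Hd'] := cg _ e0.
apply/near_normP; exists (Num.min (Num.min d1 d2) (Num.min d3 d4)).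
  by rewrite !lt_min d10 d20 d30.
move=> z; rewrite !lt_min => /andP[/andP[/Eg Kg /Eg' Kg'] /andP[/Hd h1 /Hd'/He h2]].
apply: (@kappa_loc_inj3 R q p b cop_qp q_gt0 true).
  by rewrite kappa_deckE Kg.
move: h1 h2; rewrite Ex /=.
set a := g' z; set a0 := deck k (g x); set a1 := deck k (g z) => h1 h2.
have -> : a - a1 = (a - a0) - (a1 - a0) by rewrite opprB addrA subrK.
by rewrite (le_lt_trans (ler_normB _ _))// [X in _ < X]splitr ltrD.
Qed.

Lemma kappa_pt0_eq t t' : K (pt 0 t) = K (pt 0 t') ->
  exists k : int, t' = t + k%:~R * tau.
Proof. by move=> /(kappa_inj cop_qp q_gt0)[k [-> _]]; exists k. Qed.

Lemma kappa_pt0_deck k t : K (pt 0 (t + k%:~R * tau)) = K (pt 0 t).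
Proof. by have := kappa_deckE k (pt 0 t); rewrite deck_pt mul0mx. Qed.

Lemma core_image f t : Diff f -> exists s, f (K (pt 0 t)) = K (pt 0 s).
Proof.
move=> Df; rewrite kappa_pt0; have [w ->] := Core_preserved cop_qp q_gt0 Df q_gt1 (expi t).
by have [s ->] := expi_surj w; exists s; rewrite kappa_pt0.
Qed.

(** A local expression near a point of the critical fiber; since this fiber is preserved, the
differential is block triangular. The blocks [A] and [c] are its parts in the normal directions and
along the fiber, and their signs agree because the orientation of [M] is preserved. *)
Definition core_expr (f : M -> M) t s (g : 'rV[R]_3 -> 'rV[R]_3) A u c : Prop :=
  [/\ g (pt 0 t) = pt 0 s, \forall z \near pt 0 t, K (g z) = f (K z),
    sdiff g (pt 0 t) (blk A u c),
    exists2 d : R, 0 < d & forall r, `|r - t| < d -> g (pt 0 r) = pt 0 (g (pt 0 r) 0 2)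
    & 0 < \det A * c].

Lemma pt0_norm (t : R) : `|pt 0 t : 'rV[R]_3| = `|t|.
Proof. by rewrite pt_norm normr0; apply/max_idPr/normr_ge0. Qed.

Lemma core_expr_exists f t s : Diff f -> f (K (pt 0 t)) = K (pt 0 s) ->
  exists g A u c, core_expr f t s g A u c.
Proof.
move=> Df Ef; have [g [N [gx Eg dg detN]]] := kappa_local_expr Df (esym Ef).
have [d d0 Hd] : exists2 d : R, 0 < d &
    forall r, `|r - t| < d -> g (pt 0 r) = pt 0 (g (pt 0 r) 0 2).
  have /near_normP[d d0 Hd] := Eg; exists d => // r rt.
  have [v [r' E]] := ptP (g (pt 0 r)).
  have : K (g (pt 0 r)) = f (K (pt 0 r)) by apply: Hd; rewrite pt_core_norm.
  have [r'' ->] := core_image r Df; rewrite E kappa_pt0 => /(kappa_Core cop_qp q_gt0)[-> _].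
  by rewrite pt2.
pose c := (pt 0 1 *m N) 0 2.
have [A [u EN]] : exists A u, N = blk A u c.
  apply: blkP; have [v [r E]] := ptP (pt 0 1 *m N).
  rewrite /c E pt2; congr pt; apply/eqP; rewrite -normr_le0.
  apply/ler_addgt0Pr => e e0; rewrite add0r.
  have [d' d'0 Hd'] := dg e e0.
  pose h := Num.min d d' / 2.
  have m0 : 0 < Num.min d d' by rewrite lt_min d0.
  have h0 : 0 < h by rewrite divr_gt0.
  have /andP[hd hd'] : (h < d) && (h < d').
    by rewrite -lt_min ltr_pdivrMr// ltr_pMr// (ltr_nat _ 1 2).
  have := Hd' (pt 0 (t + h)) (pt 0 t).
  rewrite subrr normr0 pt_core_norm addrAC subrr add0r gtr0_norm// => /(_ hd' d'0).
  have -> : pt 0 (t + h) - pt 0 t = h *: pt 0 1.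
    by rewrite ptB subrr addrAC subrr add0r scale_pt scaler0 mulr1.
  rewrite gx Hd; last first.
    by rewrite addrAC subrr add0r gtr0_norm.
  rewrite -scalemxAl E scale_pt !ptB subrr sub0r.
  move=> H; have := le_trans _ H; move=> /(_ (`|- (h *: v)|)).
  rewrite pt_norm le_max lexx /= => /(_ isT).
  by rewrite normrN normrZ gtr0_norm// mulrC ler_pM2r.
exists g, A, u, c; split => //; first by rewrite -EN.
  by exists d.
by rewrite -(det_blk A u c) -EN.
Qed.

Lemma core_expr_uniq f t s s' g A u c g' A' u' c' k :
  core_expr f t s g A u c -> core_expr f t s' g' A' u' c' ->
  s' = s + k%:~R * tau -> A' = A *m zeta k /\ c' = c.
Proof.
move=> [gx Eg dg _ _] [gx' Eg' dg' _ _] Es.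
have : g' (pt 0 t) = deck k (g (pt 0 t)) by rewrite gx gx' deck_pt mul0mx Es.
move=> /(local_expr_deck Eg Eg' (sdiff_cvg dg) (sdiff_cvg dg')) E.
have D := sdiff_comp dg (sdiff_deck k _).
have D' := sdiff_near E dg'.
have := sdiff_uniq D D'.
by rewrite blkM mulr1 => /blk_inj[-> _ ->].
Qed.

(** At points close to [pt 0 t], both [g] and [g'] are continuous local expressions of [f], so
[local_expr_deck] compares them. *)
Lemma core_expr_move f t s g A u c : Diff f -> core_expr f t s g A u c ->
  exists2 d : R, 0 < d & forall t', `|t' - t| < d ->
  forall s' g' A' u' c', core_expr f t' s' g' A' u' c' ->
  exists (k : int) u'', [/\ g (pt 0 t') 0 2 = s' + k%:~R * tau &
    sdiff g (pt 0 t') (blk (A' *m zeta k) u'' c')].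
Proof.
move=> Df [gx /near_normP[d1 d10 Eg] dg [d2 d20 cg] detA].
have [d3 d30 Cg] := sdiff_cont dg.
exists (Num.min (Num.min d1 d2) d3) => [|t']; first by rewrite !lt_min d10 d20.
rewrite !lt_min => /andP[/andP[t1 t2] t3] s' g' A' u' c' [gx' Eg' dg' _ _].
have Ek := cg t' t2; have Kt := Eg (pt 0 t'); rewrite pt_core_norm in Kt.
have {}Kt := Kt t1.
have [k Ek'] : exists k : int, g (pt 0 t') 0 2 = s' + k%:~R * tau.
  by apply: kappa_pt0_eq; rewrite -Ek Kt -(nbhs_singleton Eg') gx'.
have dg'' := sdiff_comp dg' (sdiff_deck k _); rewrite blkM mulr1 in dg''.
exists k; eexists; split; first exact: Ek'.
apply: sdiff_near dg''.
have Egt : \forall z \near pt 0 t', K (g z) = f (K z).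
  apply/near_normP; exists (d1 - `|t' - t|) => [|z zt]; first by rewrite subr_gt0.
  apply: Eg; rewrite -[z](subrK (pt 0 t')) -addrA (le_lt_trans (ler_normD _ _))//.
  by rewrite pt_core_norm -ltrBrDr.
have Cgt : cont g (pt 0 t') by apply: Cg; rewrite pt_core_norm.
have Ex : g (pt 0 t') = deck k (g' (pt 0 t')).
  by rewrite Ek Ek' gx' deck_pt mul0mx.
by apply: filterS (local_expr_deck Eg' Egt (sdiff_cvg dg') Cgt Ex) => z ->.
Qed.

(** Linearity propagates an estimate from small vectors to all vectors. *)
Lemma small_mulmx0 m n (N : 'M[R]_(m, n)) :
  (forall e : R, 0 < e -> exists2 d : R, 0 < d & forall v : 'rV[R]_m,
     `|v| < d -> `|v *m N| <= e * `|v|) -> N = 0.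
Proof.
move=> H; apply: mulmx_small0 => e e0 v; have [d d0 Hd] := H e e0.
have v1 : 0 < `|v| + 1 by rewrite ltr_wpDl.
pose c := d / (`|v| + 1); have c0 : 0 < c by rewrite divr_gt0.
have cv : `|c *: v| < d.
  by rewrite normrZ gtr0_norm// /c mulrAC ltr_pdivrMr// ltr_pM2l// ltrDl.
have := Hd _ cv; clearbody c.
by rewrite -scalemxAl !normrZ gtr0_norm// [leRHS]mulrCA ler_pM2l.
Qed.

(** There are only finitely many rotations by multiples of [2 pi / q], so those other than the
identity are far from it. *)
Lemma root_gap : exists2 mu : R, 0 < mu & forall (k : int) (w : 'rV[R]_2),
  `|w - w *m rotmx (k%:~R * tau / q%:~R)| < mu * `|w| ->
  w *m rotmx (k%:~R * tau / q%:~R) = w.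
Proof.
have gap a : exists2 mu : R, 0 < mu & forall w : 'rV[R]_2,
    `|w - w *m rotmx a| < mu * `|w| -> w *m rotmx a = w.
  have [c1|c1] := eqVneq (cos a) 1.
    have s1 : sin a = 0 by have := cos2Dsin2 a; rewrite c1 => H; apply/eqP; rewrite -sqrf_eq0; apply/eqP; lra.
    exists 1 => // w _; rewrite (_ : rotmx a = 1%:M) ?mulmx1//.
    by apply/matrixP; apply: ord2P; apply: ord2P; rewrite !mxE /= ?c1 ?s1 ?oppr0.
  have un : 1%:M - rotmx a \in unitmx.
    rewrite unitmxE unitfE det2 !mxE /=.
    have -> : (1 - cos a) * (1 - cos a) - (0 - sin a) * (0 - - sin a)
      = (cos a ^+ 2 + sin a ^+ 2) + 1 - 2 * cos a by ring.
    rewrite cos2Dsin2; apply: contraNneq c1 => E; apply/eqP; lra.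
  have [c c0 Hc] := mulmx_bounded (invmx (1%:M - rotmx a)).
  exists c^-1 => [|w]; first by rewrite invr_gt0.
  rewrite mulrC ltr_pdivlMr// mulrC => H.
  have E : w - w *m rotmx a = w *m (1%:M - rotmx a) by rewrite mulmxBr mulmx1.
  by have := Hc (w - w *m rotmx a); rewrite {1}E mulmxK// leNgt H.
have [mu Hmu] := choice (fun k : nat => (exists2P _ _).1 (gap (k%:R * tau / q%:~R))).
pose n := `|q|%N.
have [m m0 Hm] : exists2 m : R, 0 < m & forall k, (k < n)%N -> m <= mu k.
  elim: n => [|n [m m0 Hm]]; first by exists 1.
  exists (Num.min m (mu n)); first by rewrite lt_min m0 (Hmu n).1.
  move=> k; rewrite ltnS leq_eqVlt => /predU1P[->|/Hm]; first by rewrite ge_min lexx orbT.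
  by rewrite ge_min => ->.
exists m => // k w.
have q0 : q != 0 by rewrite gt_eqF.
have Ek := divz_eq k q.
have [j Ej] : exists j : nat, (k %% q)%Z = j by exists `|(k %% q)%Z|%N; rewrite gez0_abs// modz_ge0.
have jn : (j < n)%N by have := ltz_mod k q0; rewrite Ej; rewrite /n; lia.
have -> : rotmx (k%:~R * tau / q%:~R) = rotmx (j%:R * tau / q%:~R).
  rewrite -(rotmx_period (j%:R * tau / q%:~R) (k %/ q)%Z); congr rotmx; rewrite {1}Ek Ej intrD intrM.
  rewrite -[(Posz j)%:~R]/(j%:R).
  have : q%:~R != 0 :> R by rewrite intr_eq0.
  by move: (q%:~R : R) => m' m'0; field.
move=> H; apply: (Hmu j).2; apply: lt_le_trans H _.
by rewrite ler_wpM2r// Hm.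
Qed.

(** A fiber-preserving map is locally a product: in the [kappa] charts the fibers near the
critical one meet a transversal disc in orbits of rotations by multiples of [2 pi / q], and a
root of unity depending continuously on the point is constant. *)
Lemma local_product f t s g A u c : Diff f -> core_expr f t s g A u c ->
  exists2 d : R, 0 < d & forall v r, `|v| < d -> `|r - t| < d ->
  xi (g (pt v r)) = xi (g (pt v t)).
Proof.
move=> Df [gx /near_normP[d1 d10 Eg] dg [d2 d20 cg] detA].
have fpf : fiber_preserving f by case: Df.
have unA : A \in unitmx.
  by rewrite unitmxE unitfE; apply: contraTneq detA => ->; rewrite mul0r ltxx.
have [C C0 HC] := mulmx_bounded (invmx A).
have [mu mu0 Hmu] := root_gap.
(* [e] is so small that [xi (g (pt v r))] and [xi (g (pt v t))], both [e * `|v|]-close to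
   [v *m A], are closer than the gap [mu] of [root_gap] allows. *)
pose e := Num.min (C^-1 / 2) (mu * C^-1 / 8).
have e0 : 0 < e by rewrite lt_min !divr_gt0// ?mulr_gt0 ?invr_gt0.
have [d3 d30 Hd] := dg e e0.
exists (Num.min (Num.min d1 d2) d3) => [|v r]; first by rewrite !lt_min d10 d20.
rewrite !lt_min => /andP[/andP[v1 v2] v3] /andP[/andP[r1 r2] r3].
have [->|vn0] := eqVneq v 0; first by rewrite (cg r r2) xi_pt (cg t) ?xi_pt// subrr normr0.
have vp : 0 < `|v| by rewrite normr_gt0.
have close r' : `|r' - t| < d2 -> `|r' - t| < d3 -> `|xi (g (pt v r')) - v *m A| <= e * `|v|.
  move=> r'2 r'3; have := Hd (pt v r') (pt 0 r').
  have -> : pt v r' - pt 0 r' = pt v 0 by rewrite ptB subr0 subrr.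
  rewrite pt_core_norm ptB subr0 !pt_norm normr0 gt_max v3 r'3 => /(_ isT isT).
  rewrite (max_idPl (normr_ge0 v)) mul_pt_blk cg// => H.
  by have := le_trans (xi_norm _) H; rewrite !xiB !xi_pt subr0.
have c1 := close r r2 r3; have := close t; rewrite subrr normr0 => /(_ d20 d30) c2.
have [k Ek] : exists k : int, xi (g (pt v r)) = xi (g (pt v t)) *m rotmx (k%:~R * tau / q%:~R).
  have [L fL HL] := @fiber_kappa R q p b cop_qp q_gt0 true v.
  have HL0 r' : L (K (pt v r')) by have := HL 0 r'; rewrite !mul0r rotmx0 mulmx1.
  have [w [a Ew]] := ptP (g (pt v r)); have [w' [a' Ew']] := ptP (g (pt v t)).
  rewrite Ew Ew' !xi_pt.
  apply: (@fiber_kappa_inv R q p b cop_qp q_gt0 true (f @` L) w' a' w a (fpf _ fL)).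
    exists (K (pt v t)); first exact: HL0.
    by rewrite -Ew' Eg// ptB subr0 subrr pt_norm normr0 gt_max v1 d10.
  exists (K (pt v r)); first exact: HL0.
  by rewrite -Ew Eg// ptB subr0 pt_norm gt_max v1 r1.
rewrite Ek; apply: Hmu.
set w := xi (g (pt v t)) in c2 Ek *; rewrite -Ek.
have wR : `|w - xi (g (pt v r))| <= 2 * e * `|v|.
  have -> : w - xi (g (pt v r)) = (w - v *m A) - (xi (g (pt v r)) - v *m A).
    by rewrite opprB addrA subrK.
  by rewrite (le_trans (ler_normB _ _))// -mulrA mulr2n mulrDl mul1r lerD.
have vA : C^-1 * `|v| <= `|v *m A|.
  by rewrite mulrC ler_pdivrMr// mulrC -{1}[v](mulmxK unA) HC.
have wv : C^-1 / 2 * `|v| <= `|w|.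
  have : `|v *m A| <= `|w| + e * `|v|.
    have -> : v *m A = w - (w - v *m A) by rewrite opprB addrC subrK.
    by rewrite (le_trans (ler_normB _ _))// lerD2l.
  have : e * `|v| <= C^-1 / 2 * `|v| by rewrite ler_wpM2r// ge_min lexx.
  lra.
apply: le_lt_trans wR _; apply: lt_le_trans (ler_wpM2l (ltW mu0) wv).
rewrite mulrA ltr_pM2r//; have : e <= mu * C^-1 / 8 by rewrite ge_min lexx orbT.
have : 0 < mu * C^-1 by rewrite mulr_gt0// invr_gt0.
by rewrite mulrA; lra.
Qed.

End Lifts.

(** * Lifts *)

Section LiftTheory.
Variables (R : realType) (q p b : int).
Hypotheses (cop_qp : coprimez q p) (q_gt1 : 1 < q).
Let q_gt0 : 0 < q. Proof. exact: lt_trans q_gt1. Qed.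
Local Notation M := (seifert R q p b).
Local Notation K := (@kappa R q p b true).
Local Notation Diff := (@Diff_plus_fp R q p b).
Local Notation tau := (pi *+ 2 : R).
Local Notation zeta := (zeta R q p b).
Local Notation deck := (@deck R q p b).
Local Notation core_expr := (@core_expr R q p b).
Opaque kappa pt.

Let tau_gt0 : 0 < tau.
Proof. by rewrite mulrn_wgt0// pi_gt0. Qed.

Lemma core_expr_derive f t s g A u c : core_expr f t s g A u c ->
  is_derive t (1 : R) (fun r => g (pt 0 r) 0 2) c.
Proof.
move=> [_ _ dg _ _]; apply: is_derive_epsilon => e e0.
have [d d0 Hd] := dg e e0; exists d => // r rt.
have := Hd (pt 0 r) (pt 0 t); rewrite subrr normr0 pt_core_norm => /(_ rt d0).
move=> /(le_trans (entry_norm_le _ 0 2)).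
have -> : (pt 0 r - pt 0 t) *m blk A u c = pt 0 ((r - t) * c).
  by rewrite ptB subrr mul_pt_blk !mul0mx [X in X + _]mxE add0r.
have H3 (x y z : 'rV[R]_3) : (x - y - z) 0 2 = x 0 2 - y 0 2 - z 0 2 by rewrite !mxE.
by rewrite H3 pt2.
Qed.

(** [phi] lifts the action of [f] on the critical fiber to its universal cover, and [A] is
the differential of [f] in the directions normal to the critical fiber; it is the same at all
points, since in the [kappa] charts the fibers are straight and preserved. *)
Definition lift (f : M -> M) (phi : R -> R) (A : 'M[R]_2) : Prop :=
  forall t, exists g u c, core_expr f t (phi t) g A u c /\
  exists2 d : R, 0 < d & forall r, `|r - t| < d -> g (pt 0 r) = pt 0 (phi r).

(** The derivative along the critical fiber, read in any local expression, is a continuous function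
[dphi]; its primitive [phi] is the lift. That [phi] lifts [f] holds because the cosine of the
difference with an arbitrary pointwise lift [eta] has derivative [0] everywhere, although [eta] may
be discontinuous. *)
Lemma core_lift f : Diff f -> exists2 phi : R -> R,
  (forall t, f (K (pt 0 t)) = K (pt 0 (phi t))) &
  forall t g A u c, core_expr f t (phi t) g A u c -> is_derive t (1 : R) phi c.
Proof.
move=> Df.
have [eta Heta] := choice (fun t => core_image cop_qp q_gt1 t Df).
have Hce t : exists c, exists g A u, core_expr f t (eta t) g A u c.
  have [g [A [u [c H]]]] := core_expr_exists cop_qp q_gt1 Df (Heta t).
  by exists c, g, A, u.
have [dphi Hd] := choice Hce.
have d_uniq t s g A u c : core_expr f t s g A u c -> c = dphi t.
  move=> H; have [g' [A' [u' H']]] := Hd t.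
  have [k Ek] : exists k : int, s = eta t + k%:~R * tau.
    apply: (kappa_pt0_eq cop_qp q_gt1 (b := b)); rewrite -(Heta t).
    by case: H => gx Eg _ _ _; rewrite -gx (nbhs_singleton Eg).
  by have [_ ->] := core_expr_uniq cop_qp q_gt1 H' H Ek.
have cd : continuous dphi.
  move=> t; apply/cvgrPdist_le => e e0.
  have [g [A [u H]]] := Hd t; have dg : sdiff g (pt 0 t) (blk A u (dphi t)) by case: H.
  have [d1 d10 H1] := core_expr_move cop_qp q_gt1 Df H.
  have [d2 d20 H2] := sdiff_deriv_continuous dg e0.
  apply/nbhs_ballP; exists (Num.min d1 d2) => [|r] /=; first by rewrite lt_min d10.
  rewrite /ball /= lt_min distrC => /andP[r1 r2].
  have [g' [A' [u' H']]] := Hd r.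
  have [k [u'' [_ dr]]] := H1 r r1 _ _ _ _ _ H'.
  have := H2 (pt 0 r) _ _ dr (pt 0 1); rewrite pt_core_norm => /(_ r2).
  rewrite mulmxBr !mul_pt_blk !mul0mx mxE !add0r !mul1r ptB subrr !pt0_norm.
  by rewrite normr1 mulr1 distrC.
have [F F0 DF] := primitive cd.
pose phi t := F t + eta 0.
have Dphi t : is_derive t (1 : R) phi (dphi t).
  by have := is_deriveD (DF t) (is_derive_cst (eta 0) t 1); rewrite addr0.
have Kphi t : exists k : int, phi t = eta t + k%:~R * tau.
  have C1 : cos (phi t - eta t) = 1.
    rewrite -[RHS](_ : cos (phi 0 - eta 0) = 1); last by rewrite /phi F0 add0r subrr cos0.
    pose C r := cos (phi r - eta r); rewrite -!/(C _).
    apply: is_derive_0_is_cst => {}t.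
    have [g [A [u H]]] := Hd t.
    pose psi r := g (pt 0 r) 0 2.
    have Dpsi : is_derive t (1 : R) psi (dphi t) := core_expr_derive H.
    have DC : is_derive t (1 : R) (fun r => cos (phi r - psi r)) 0.
      have D1 := is_deriveB (Dphi t) Dpsi.
      have := @is_derive1_comp R (@cos R) (phi - psi) t _ _ (is_derive_cos _) D1.
      by rewrite subrr mulr0; apply.
    apply: near_eq_is_derive DC; case: H => gx /near_normP[d1 d10 Eg] _ [d2 d20 cg] _.
    apply/nbhs_ballP; exists (Num.min d1 d2) => [|r] /=; first by rewrite lt_min d10.
    rewrite /ball /= lt_min distrC => /andP[r1 r2].
    have [k Ek] : exists k : int, eta r = psi r + k%:~R * tau.
      have E1 := Eg (pt 0 r); rewrite pt_core_norm (cg r r2) in E1.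
      exact: (kappa_pt0_eq cop_qp q_gt1 (etrans (E1 r1) (Heta r))).
    rewrite /C Ek opprD addrA.
    have := cis_period (phi r - psi r) (- k); rewrite /cis => -[<- _].
    by rewrite intrN mulNr.
  by have [k Ek] := cos_eq1 C1; exists k; rewrite -Ek addrC subrK.
have Kp t : f (K (pt 0 t)) = K (pt 0 (phi t)).
  have [k ->] := Kphi t; rewrite Heta.
  exact: esym (@kappa_pt0_deck R q p b cop_qp q_gt1 k (eta t)).
exists phi => // t g A u c H; by rewrite (d_uniq _ _ _ _ _ _ H).
Qed.

Lemma derive_cont (phi : R -> R) t c : is_derive t (1 : R) phi c ->
  forall e : R, 0 < e -> exists2 d : R, 0 < d & forall s, `|s - t| < d -> `|phi s - phi t| < e.
Proof.
move=> D e e0; have : phi s @[s --> t] --> phi t.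
  by apply: differentiable_continuous; apply/derivable1_diffP; exact: ex_derive.
move=> /cvgrPdist_lt/(_ e e0)/nbhs_ballP[d /= d0 Hd]; exists d => // s st.
by rewrite distrC; apply: Hd; rewrite /ball /= distrC.
Qed.

(** The normal differential [B] is locally constant: by [local_product] the local expression is a
product, so its normal part is the same at all close points of the critical fiber. *)
Lemma lift_exists f : Diff f -> exists phi A, lift f phi A.
Proof.
move=> Df; have [phi Kphi Dphi] := core_lift Df.
have Hce t : exists A, exists g u c, core_expr f t (phi t) g A u c.
  have [g [A [u [c H]]]] := core_expr_exists cop_qp q_gt1 Df (Kphi t).
  by exists A, g, u, c.
have [B HB] := choice Hce.
have cphi t : forall e : R, 0 < e -> exists2 d : R, 0 < d &
    forall s, `|s - t| < d -> `|phi s - phi t| < e.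
  have [g [u [c H]]] := HB t; exact: derive_cont (Dphi _ _ _ _ _ H).
have near_phi t g A u c : core_expr f t (phi t) g A u c ->
  exists2 d : R, 0 < d & forall r, `|r - t| < d -> g (pt 0 r) = pt 0 (phi r).
  move=> H; have Dpsi := core_expr_derive H.
  have t20 : 0 < tau / 2 by rewrite divr_gt0.
  have [d1 d10 H1] := cphi t _ t20; have [d2 d20 H2] := derive_cont Dpsi t20.
  case: H => gx /near_normP[d3 d30 Eg] _ [d4 d40 cg] _.
  exists (Num.min (Num.min d1 d2) (Num.min d3 d4)); first by rewrite !lt_min d10 d20 d30.
  move=> r; rewrite !lt_min => /andP[/andP[/H1 h1 /H2 h2] /andP[h3 h4]].
  rewrite cg//; congr pt.
  have E1 := Eg (pt 0 r); rewrite pt_core_norm (cg r h4) in E1.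
  have E := etrans (E1 h3) (Kphi r).
  suff H : `|g (pt 0 r) 0 2 - phi r| < tau by have [_] := kappa_loc_inj cop_qp q_gt0 E H.
  move: h2; rewrite gx pt2 => h2.
  have -> : g (pt 0 r) 0 2 - phi r = (g (pt 0 r) 0 2 - phi t) - (phi r - phi t).
    by rewrite opprB addrA subrK.
  have h12 := ltrD h2 h1; rewrite -splitr in h12.
  exact: le_lt_trans (ler_normB _ _) h12.
have B_loc t : exists2 d : R, 0 < d & forall s, `|s - t| < d -> B s = B t.
  have [g [u [c H]]] := HB t.
  have [d1 d10 H1] := core_expr_move cop_qp q_gt1 Df H.
  have [d2 d20 H2] := near_phi _ _ _ _ _ H.
  have [d3 d30 H3] := local_product cop_qp q_gt1 Df H.
  exists (Num.min (Num.min d1 d2) d3) => [|s]; first by rewrite !lt_min d10 d20.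
  rewrite !lt_min => /andP[/andP[s1 s2] s3].
  have [g' [u' [c' H']]] := HB s.
  have [k [u'' [Ek ds]]] := H1 s s1 _ _ _ _ _ H'.
  have k0 : k = 0.
    move: Ek; rewrite H2// pt2 => /eqP; rewrite eq_sym -subr_eq0 addrAC subrr add0r.
    by rewrite mulf_eq0 (gt_eqF tau_gt0) orbF intr_eq0 => /eqP.
  rewrite k0 zeta0 mulmx1 in ds.
  have dt : sdiff g (pt 0 t) (blk (B t) u c) by case: H.
  apply/eqP; rewrite -subr_eq0; apply/eqP/small_mulmx0 => e e0.
  have e20 : 0 < e / 2 by rewrite divr_gt0.
  have [d4 d40 H4] := ds _ e20; have [d5 d50 H5] := dt _ e20.
  exists (Num.min (Num.min d4 d5) d3) => [|v]; first by rewrite !lt_min d40 d50.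
  rewrite !lt_min => /andP[/andP[v4 v5] v3].
  have close r d A w c0 : (forall a b : 'rV_3, `|a - pt 0 r| < d -> `|b - pt 0 r| < d ->
      `|g a - g b - (a - b) *m blk A w c0| <= e / 2 * `|a - b|) -> 0 < d -> `|v| < d ->
      xi (g (pt 0 r)) = 0 -> `|xi (g (pt v r)) - v *m A| <= e / 2 * `|v|.
    move=> Hr d0 vd g0; have := Hr (pt v r) (pt 0 r).
    have -> : pt v r - pt 0 r = pt v 0 by rewrite ptB subr0 subrr.
    rewrite subrr !normr0 !pt_norm normr0 gt_max vd d0 (max_idPl (normr_ge0 v)).
    rewrite mul_pt_blk => /(_ isT isT); move/(le_trans (xi_norm _)).
    by rewrite !xiB xi_pt g0 subr0.
  have c4 := close s d4 _ _ _ H4 d40 v4; have c5 := close t d5 _ _ _ H5 d50 v5.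
  rewrite H2 // xi_pt in c4; rewrite H2 ?subrr ?normr0// xi_pt in c5.
  have {}c4 := c4 erefl; have {}c5 := c5 erefl.
  rewrite (H3 v s v3 s3) in c4.
  have -> : v *m (B s - B t) =
    (xi (g (pt v t)) - v *m B t) - (xi (g (pt v t)) - v *m B s).
    by rewrite mulmxBr opprB [RHS]addrC addrA subrK.
  by rewrite (le_trans (ler_normB _ _))// [e in e * _]splitr mulrDl lerD.
have Bc t s : B t = B s.
  apply/matrixP => i j; apply: (@locally_cst R (fun t => B t i j)) => {}t.
  by have [d d0 H] := B_loc t; exists d => // r /H ->.
exists phi, (B 0) => t; have [g [u [c H]]] := HB t.
exists g, u, c; rewrite (Bc 0 t); split=> //; exact: near_phi H.
Qed.

Lemma lift_derive f phi A t : lift f phi A -> exists2 c,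
  is_derive t (1 : R) phi c & 0 < \det A * c.
Proof.
move=> /(_ t)[g [u [c [H [d d0 Hd]]]]]; exists c; last by case: H.
apply: near_eq_is_derive (core_expr_derive H).
apply/nbhs_ballP; exists d => // r; rewrite /ball /= distrC => rt.
by rewrite Hd// pt2.
Qed.

Lemma lift_comp f1 f2 phi1 phi2 A1 A2 : lift f1 phi1 A1 -> lift f2 phi2 A2 ->
  lift (f2 \o f1) (phi2 \o phi1) (A1 *m A2).
Proof.
move=> L1 L2 t; have [c0 D1 _] := lift_derive t L1.
have [g1 [u1 [c1 [[gx1 Eg1 dg1 _ p1] [d1 d10 H1]]]]] := L1 t.
have [g2 [u2 [c2 [[gx2 Eg2 dg2 _ p2] [d2 d20 H2]]]]] := L2 (phi1 t).
rewrite -gx1 in dg2 Eg2.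
have [d3 d30 H3] := derive_cont D1 d20.
have H r : `|r - t| < Num.min d1 d3 -> (g2 \o g1) (pt 0 r) = pt 0 ((phi2 \o phi1) r).
  by rewrite lt_min => /andP[/H1 /= -> /H3/H2 ->].
have d130 : 0 < Num.min d1 d3 by rewrite lt_min d10.
exists (g2 \o g1); do 2 eexists; split; last by exists (Num.min d1 d3).
split.
- by rewrite /= gx1.
- have := near_sdiff dg1 Eg2; move=> H4; apply: filterS2 Eg1 H4 => z /= E1 ->.
  by rewrite E1.
- by have := sdiff_comp dg1 dg2; rewrite blkM; exact.
- by exists (Num.min d1 d3) => // r rt; rewrite H// pt2.
by rewrite det_mulmx mulrACA mulr_gt0.
Qed.

Lemma lift_deck f (k : int) : (forall x, f x = x) -> lift f (fun t => t + k%:~R * tau) (zeta k).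
Proof.
move=> fid t; have D r : deck k (pt 0 r) = pt 0 (r + k%:~R * tau) by rewrite deck_pt mul0mx.
exists (deck k), 0, 1; split; last by exists 1.
split; [exact: D| |exact: sdiff_deck|by exists 1 => // r _; rewrite D pt2|].
  apply/near_normP; exists 1; [exact: ltr01|move=> z _].
  by rewrite fid; exact: kappa_deckE.
by rewrite det_zeta mulr1.
Qed.

Lemma lift_uniq f phi phi' A A' : lift f phi A -> lift f phi' A' ->
  exists k : int, (forall t, phi' t = phi t + k%:~R * tau) /\ A' = A *m zeta k.
Proof.
move=> L L'.
have Hk t : exists k : int, [/\ phi' t = phi t + k%:~R * tau, A' = A *m zeta k &
    is_derive t (1 : R) (phi' - phi) 0].
  have [g [u [c [H [d d0 Hd]]]]] := L t; have [g' [u' [c' [H' [d' d'0 Hd']]]]] := L' t.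
  have [k Ek] : exists k : int, phi' t = phi t + k%:~R * tau.
    apply: (kappa_pt0_eq cop_qp q_gt1 (b := b)).
    case: H => gx Eg _ _ _; case: H' => gx' Eg' _ _ _.
    by rewrite -gx -gx' (nbhs_singleton Eg) (nbhs_singleton Eg').
  have [EA Ec] := core_expr_uniq cop_qp q_gt1 H H' Ek.
  exists k; split=> //.
  have D r1 g0 A0 u0 c0 (phi0 : R -> R) : core_expr f t r1 g0 A0 u0 c0 ->
     (exists2 d : R, 0 < d & forall r, `|r - t| < d -> g0 (pt 0 r) = pt 0 (phi0 r)) ->
     is_derive t (1 : R) phi0 c0.
    move=> H0 [d1 d10 Hd1]; apply: near_eq_is_derive (core_expr_derive H0).
    apply/nbhs_ballP; exists d1 => // r; rewrite /ball /= distrC => rt.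
    by rewrite Hd1// pt2.
  have D1 := D _ _ _ _ _ phi H (ex_intro2 _ _ d d0 Hd).
  have D2 := D _ _ _ _ _ phi' H' (ex_intro2 _ _ d' d'0 Hd').
  by have := is_deriveB D2 D1; rewrite Ec subrr.
have [k [E0 EA _]] := Hk 0; exists k; split=> // t.
have -> : phi' t = (phi' - phi) t + phi t by rewrite !fctE subrK.
have -> : (phi' - phi) t = (phi' - phi) 0.
  by apply: is_derive_0_is_cst => r; have [? []] := Hk r.
by rewrite !fctE E0 [phi 0 + _]addrC addrK addrC.
Qed.

Lemma lift_increasing f phi A : lift f phi A -> 0 < \det A ->
  forall t s, t < s -> phi t < phi s.
Proof.
move=> L dA t s ts.
have [c Hc] := choice (fun t => (exists2P _ _).1 (lift_derive t L)).
have cphi : {within `[t, s], continuous phi}.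
  apply: derivable_within_continuous => r _; exact: (@ex_derive _ _ _ _ _ _ _ (Hc r).1).
have [r _ E] := MVT ts (fun r _ => (Hc r).1) cphi.
by rewrite -subr_gt0 E mulr_gt0 ?subr_gt0// -(pmulr_rgt0 _ dA) (Hc r).2.
Qed.

Lemma lift_decreasing f phi A : lift f phi A -> \det A < 0 ->
  forall t s, t < s -> phi s < phi t.
Proof.
move=> L dA t s ts.
have [c Hc] := choice (fun t => (exists2P _ _).1 (lift_derive t L)).
have cphi : {within `[t, s], continuous phi}.
  apply: derivable_within_continuous => r _; exact: (@ex_derive _ _ _ _ _ _ _ (Hc r).1).
have [r _ E] := MVT ts (fun r _ => (Hc r).1) cphi.
by rewrite -subr_lt0 E nmulr_rlt0 ?subr_gt0// -(nmulr_rgt0 _ dA) (Hc r).2.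
Qed.

Lemma lift_det f phi A : lift f phi A -> \det A != 0.
Proof.
by move=> /lift_derive-/(_ 0)[c _]; apply: contraTneq => ->; rewrite mul0r ltxx.
Qed.

(** A decreasing map of the line crosses the diagonal. *)
Lemma lift_fixpoint f phi A : lift f phi A -> \det A < 0 -> exists t, phi t = t.
Proof.
move=> L dA; have dec := lift_decreasing L dA.
have cphi : continuous phi.
  move=> t; have [c D _] := lift_derive t L.
  by apply: differentiable_continuous; apply/derivable1_diffP; exact: ex_derive.
pose h t := phi t - t.
have ch (x y : R) : {within `[x, y], continuous h}.
  apply: continuous_subspaceT => t; apply: continuousB; [exact: cphi|exact: cvg_id].
have [z0|z0] := leP 0 (phi 0).
  have hz : h (phi 0) <= 0.
    rewrite subr_le0; have [E|n0] := eqVneq (phi 0) 0; first by rewrite !E.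
    by rewrite ltW// dec// lt_neqAle eq_sym n0.
  have [|t _ /eqP] := @IVT R h 0 (phi 0) 0 z0 (ch _ _).
    by rewrite ge_min le_max hz /h subr0 z0 orbT.
  by rewrite subr_eq0 => /eqP; exists t.
have [|t _ /eqP] := @IVT R h (phi 0) 0 0 (ltW z0) (ch _ _).
  rewrite ge_min le_max /h subr0 (ltW z0) orbT /=.
  by rewrite subr_ge0 ltW// dec.
by rewrite subr_eq0 => /eqP; exists t.
Qed.

End LiftTheory.

(** * Rigidity of maps of finite order *)

Section Rigidity.
Variables (R : realType) (q p b : int).
Hypotheses (cop_qp : coprimez q p) (q_gt1 : 1 < q).
Let q_gt0 : 0 < q. Proof. exact: lt_trans q_gt1. Qed.
Local Notation M := (seifert R q p b).
Opaque kappa pt.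
Local Notation kappa := (@kappa R q p b).
Local Notation K := (kappa true).
Local Notation Diff := (@Diff_plus_fp R q p b).
Local Notation tau := (pi *+ 2 : R).
Local Notation zeta := (zeta R q p b).
Local Notation deck := (@deck R q p b).
Local Notation core_expr := (@core_expr R q p b).
Local Notation lift := (@lift R q p b).

Let tau_gt0 : 0 < tau.
Proof. by rewrite mulrn_wgt0// pi_gt0. Qed.

Lemma iter_local_expr (f : M -> M) g (x : 'rV[R]_3) (N : 'M[R]_3) k : g x = x -> sdiff g x N ->
  (\forall z \near x, K (g z) = f (K z)) ->
  sdiff (iter k g) x (iter k (mulmx N) 1%:M) /\
  \forall z \near x, K (iter k g z) = iter k f (K z).
Proof.
move=> gx dg Eg; elim: k => [|k [IHd IHE]].
  by split; [exact: sdiff_id|apply/near_normP; exists 1].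
have gk : iter k g x = x by elim: k {IHd IHE} => //= k ->.
split.
  apply: (@sdiff_near _ _ _ (iter k g \o g)).
    by apply/near_normP; exists 1 => // z _; rewrite /= -iterSr.
  rewrite -(gx) in IHd; exact: sdiff_comp dg IHd.
have := near_sdiff dg; rewrite gx => /(_ _ IHE) H.
by apply: filterS2 H Eg => z H E; rewrite iterSr [RHS]iterSr H E.
Qed.

(** A map of finite order which is tangent to the identity at a fixed point is the identity
nearby: the displacements along an orbit are almost equal, and sum to zero. *)
Lemma germ_rigid (f : M -> M) g (x : 'rV[R]_3) n : (0 < n)%N -> (forall P, iter n f P = P) ->
  g x = x -> (\forall z \near x, K (g z) = f (K z)) -> sdiff g x 1%:M ->
  \forall z \near x, f (K z) = K z.
Proof.
move=> n0 fn gx Eg dg.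
have [_ /near_normP[d1 d10 En]] := iter_local_expr n gx dg Eg.
have /near_normP[d2 d20 Eg2] := Eg.
pose T : R := 2 ^+ n; have T0 : 0 < T by rewrite exprn_gt0.
(* In [n] steps the displacement [h] of [z] is repeated with a total error of at most
   [e * 2 ^+ n * `|h|], half of [`|h|]; but the displacements sum to zero, so [h] is zero. *)
pose e := (2 * T)^-1; have e0 : 0 < e by rewrite invr_gt0 mulr_gt0.
have e1 : e <= 1.
  have T1 : 1 <= T by rewrite exprn_ege1// ler1n.
  by rewrite invf_le1 ?mulr_gt0//; lra.
have [d3 d30 Hd] := dg e e0.
pose d := Num.min (Num.min d1 d2) (Num.min d3 2^-1).
have d0 : 0 < d by rewrite !lt_min d10 d20 d30 invr_gt0 ltr0n.
apply/near_normP; exists (d / T) => [|z zx]; first by rewrite divr_gt0.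
have lip a : `|a - x| < d3 -> `|g a - x| <= 2 * `|a - x|.
  move=> ad; have := Hd a x ad; rewrite subrr normr0 gx mulmx1 => /(_ d30) H.
  have -> : g a - x = (g a - x - (a - x)) + (a - x) by rewrite subrK.
  rewrite (le_trans (ler_normD _ _))// mulr2n mulrDl mul1r lerD2r (le_trans H)//.
  by rewrite ler_piMl.
have near k : (k <= n)%N -> `|iter k g z - x| <= 2 ^+ k * `|z - x|.
  elim: k => [|k IH] kn /=; first by rewrite expr0 mul1r.
  have {}IH := IH (ltnW kn).
  rewrite exprS -mulrA (le_trans (lip _ _))//; last by rewrite ler_pM2l.
  apply: le_lt_trans IH _; apply: (@lt_le_trans _ _ d); last by rewrite !ge_min lexx ?orbT.
  rewrite mulrC -ltr_pdivlMr ?exprn_gt0//; apply: lt_le_trans zx _.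
  by rewrite ler_pM2l// lef_pV2 ?posrE ?exprn_gt0// ler_eXn2l ?ltr1n// ltnW.
have neard k : (k <= n)%N -> `|iter k g z - x| < d.
  move=> kn; apply: le_lt_trans (near k kn) _.
  rewrite mulrC -ltr_pdivlMr ?exprn_gt0//; apply: lt_le_trans zx _.
  by rewrite ler_pM2l// lef_pV2 ?posrE ?exprn_gt0// ler_eXn2l ?ltr1n.
have zd : `|z - x| < d by exact: (neard 0).
have gn : iter n g z = z.
  apply: (@kappa_loc_inj3 R q p b cop_qp q_gt0 true).
    by rewrite En ?fn//; move: zd; rewrite !lt_min => /andP[/andP[]].
  have -> : iter n g z - z = (iter n g z - x) - (z - x) by rewrite opprB addrA subrK.
  apply: le_lt_trans (ler_normB _ _) _.
  have h : d <= 2^-1 by rewrite !ge_min lexx !orbT.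
  have := neard n (leqnn n); lra.
pose h := g z - z.
have step k : (k <= n)%N -> `|iter k g z - z| + `|h| <= 2 ^+ k * `|h| /\
    `|iter k g z - z - h *+ k| <= e * 2 ^+ k * `|h|.
  elim: k => [|k IH] kn.
    rewrite /= subrr mulr0n subr0 !normr0 add0r expr0 mul1r lexx.
    by rewrite !mulr_ge0// ltW.
  have [IH1 IH2] := IH (ltnW kn).
  pose r := g (iter k g z) - g z - (iter k g z - z).
  have Hr : `|r| <= e * `|iter k g z - z|.
    have := Hd (iter k g z) z; rewrite mulmx1; apply.
      by apply: lt_le_trans (neard k (ltnW kn)) _; rewrite !ge_min lexx ?orbT.
    by apply: lt_le_trans zd _; rewrite !ge_min lexx ?orbT.
  have IH3 : `|iter k g z - z| <= 2 ^+ k * `|h|.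
    by apply: le_trans IH1; rewrite lerDl.
  have Hr2 : `|r| <= e * 2 ^+ k * `|h|.
    by rewrite (le_trans Hr)// -mulrA ler_pM2l.
  have E1 : iter k.+1 g z - z = r + (iter k g z - z) + h.
    by rewrite /r subrK /h addrA subrK.
  have E2 : iter k.+1 g z - z - h *+ k.+1 = r + (iter k g z - z - h *+ k).
    by rewrite E1 mulrSr [h *+ k + h]addrC opprD addrA addrK [RHS]addrA.
  split; last first.
    have -> : e * 2 ^+ k.+1 * `|h| = e * 2 ^+ k * `|h| + e * 2 ^+ k * `|h|.
      by rewrite exprS; ring.
    by rewrite E2 (le_trans (ler_normD _ _))// lerD.
  have Hr3 : `|r| <= `|iter k g z - z|.
    by apply: le_trans Hr _; rewrite ler_piMl.
  have := ler_normD (r + (iter k g z - z)) h; have := ler_normD r (iter k g z - z).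
  rewrite -E1 exprS -mulrA; lra.
have [_] := step n (leqnn n); rewrite gn subrr sub0r normrN normrMn => Hn.
have eT : e * 2 ^+ n = 2^-1.
  by rewrite /e -/T invfM -mulrA mulVf ?gt_eqF// mulr1.
rewrite eT in Hn; have h0 : h = 0.
  apply/eqP; rewrite -normr_le0.
  have : `|h| <= `|h| *+ n by rewrite -[n in leRHS](prednK n0) mulrS lerDl mulrn_wge0.
  lra.
have zd2 : `|z - x| < d2.
  by apply: lt_le_trans zd _; rewrite !ge_min lexx ?orbT.
have gz : g z = z by apply/eqP; rewrite -subr_eq0 -/h h0.
by rewrite -(Eg2 z zd2) gz.
Qed.

(** A limit of fixed points is fixed because [M] is separated: near [x], the lifts of [f] at the
fixed points are all given by the same deck transformation. *)
Lemma fixed_limit (f : M -> M) e (x y : 'rV[R]_3) : Diff f ->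
  f (kappa e x) = kappa e y ->
  (forall d : R, 0 < d -> exists2 z, `|z - x| < d & f (kappa e z) = kappa e z) ->
  f (kappa e x) = kappa e x.
Proof.
move=> Df Exy lim; rewrite Exy.
have [g [N [gx /near_normP[d1 d10 Eg] dg _]]] := kappa_local_expr Df (esym Exy).
pose D k (z : 'rV[R]_3) := z *m blk (rotmx (k%:~R * tau * slope R q p b e)) 0 1 + pt 0 (k%:~R * tau).
have DE k v t : D k (pt v t) = pt (v *m rotmx (k%:~R * tau * slope R q p b e)) (t + k%:~R * tau).
  by rewrite /D mul_pt_blk mulmx0 mxE add0r mulr1 ptD addr0.
have Dk k z : kappa e (D k z) = kappa e z.
  by have [v [t ->]] := ptP z; rewrite DE; exact: kappa_deck.
have gD z : `|z - x| < d1 -> f (kappa e z) = kappa e z -> exists k : int, g z = D k z.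
  move=> zx fz; have := Eg z zx; rewrite fz => /esym.
  have [v [t Ez]] := ptP z; have [v' [t' Ez']] := ptP (g z); rewrite Ez' Ez.
  by move=> /(kappa_inj cop_qp q_gt0)[k [-> ->]]; exists k; rewrite DE.
have [d2 d20 H2] := sdiff_cvg dg (@ltr01 R).
pose d := Num.min (Num.min d1 d2) 1.
have d0 : 0 < d by rewrite !lt_min d10 d20 /=.
have coord2 (u w : 'rV[R]_3) r : `|u - w| < r -> `|u 0 2 - w 0 2| < r.
  by apply: le_lt_trans; have := entry_norm_le (u - w) 0 2; rewrite !mxE.
have D2 k z : D k z 0 2 = z 0 2 + k%:~R * tau.
  by have [v [t ->]] := ptP z; rewrite DE !pt2.
have [z0 z0x fz0] := lim d d0.
have near_k z : `|z - x| < d -> f (kappa e z) = kappa e z ->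
    exists2 k : int, g z = D k z & `|k%:~R * tau - (y 0 2 - x 0 2)| < 2.
  rewrite !lt_min => /andP[/andP[zx1 zx2] zx3] fz; have [k Ek] := gD z zx1 fz.
  exists k => //; have := coord2 _ _ _ (H2 _ zx2); have := coord2 _ _ _ zx3.
  rewrite gx Ek D2; set a := z 0 2; set b' := x 0 2; set c := y 0 2 => h1 h2.
  have -> : k%:~R * tau - (c - b') = (a + k%:~R * tau - c) - (a - b') by ring.
  by apply: le_lt_trans (ler_normB _ _) _; rewrite -[2]/(1 + 1)%R ltrD.
have [k Ek kn] := near_k z0 z0x fz0.
have same z : `|z - x| < d -> f (kappa e z) = kappa e z -> g z = D k z.
  move=> zx fz; have [k' Ek' kn'] := near_k z zx fz; rewrite Ek'; congr D.
  suff H : `|(k' - k)%:~R * tau| < tau.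
    by apply/eqP; rewrite -subr_eq0; apply/eqP; exact: (int_tau_small H).
  have -> : (k' - k)%:~R * tau =
      (k'%:~R * tau - (y 0 2 - x 0 2)) - (k%:~R * tau - (y 0 2 - x 0 2)).
    by rewrite intrB; ring.
  apply: le_lt_trans (ler_normB _ _) _; apply: lt_le_trans (ltrD kn' kn) _.
  by rewrite mulr2n lerD// pi_ge2.
clearbody d; suff Ey : y = D k x by exact: (etrans (congr1 (kappa e) Ey) (Dk k x)).
apply/eqP; rewrite -subr_eq0 -normr_le0; apply/ler_addgt0Pr => r r0; rewrite add0r.
have r20 : 0 < r / 2 by rewrite divr_gt0.
have [d3 d30 H3] := sdiff_cvg dg r20.
have [d4 d40 H4] := sdiff_cvg (sdiff_linear (blk (rotmx (k%:~R * tau * slope R q p b e)) 0 1)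
  (pt 0 (k%:~R * tau)) x) r20.
have [|z zx fz] := lim (Num.min d (Num.min d3 d4)); first by rewrite !lt_min d0 d30.
move: zx; rewrite (lt_min _ d) lt_min => /andP[zd /andP[z3 z4]].
have h3 := H3 _ z3; have h4 := H4 _ z4; rewrite gx (same z zd fz) in h3.
have -> : y - D k x = (D k z - D k x) - (D k z - y) by rewrite opprB [RHS]addrC addrA subrK.
by rewrite (le_trans (ler_normB _ _))// [r]splitr lerD// ltW.
Qed.

Lemma pol_norm rho a : expR rho / 2 <= `|pol rho a| :> R.
Proof.
have er := expR_gt0 rho; have [c2|c2] := leP (1 / 2) `|cos a|.
  apply: le_trans (entry_norm_le _ 0 0); rewrite mxE /= normrM gtr0_norm//.
  by rewrite ler_pM2l// -[2^-1]mul1r.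
apply: le_trans (entry_norm_le _ 0 1); rewrite mxE /= normrM gtr0_norm//.
rewrite ler_pM2l// leNgt; apply/negP => s2.
have := cos2Dsin2 a; rewrite -[cos a ^+ 2]real_normK ?num_real//.
rewrite -[sin a ^+ 2]real_normK ?num_real//.
have := normr_ge0 (cos a); have := normr_ge0 (sin a); nra.
Qed.

(** Points close to one core are far from the other one. *)
Lemma kappa_far v r w s : kappa false (pt v r) = kappa true (pt w s) ->
  1 <= `|v| * `|w|.
Proof.
case: (polP v) => [->|[rho [a ->]]]; case: (polP w) => [->|[rho' [a' ->]]];
  rewrite ?kappa_pt0 ?kappa_pol; try by [].
move=> /Reg_inj[/= E _ _].
have e2 : 2 <= expR 1 :> R by have := expR_ge1Dx (1 : R); rewrite -[2]/(1 + 1).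
have E2 : expR rho * expR rho' = expR 1 * expR 1 :> R.
  by rewrite -!expRD; congr expR; lra.
have h := pol_norm rho a; have h' := pol_norm rho' a'.
apply: le_trans (ler_pM _ _ h h'); rewrite ?divr_ge0 ?expR_ge0//.
by rewrite mulrACA E2; nra.
Qed.

(** At a limit point of the interior of the fixed point set the differential is the identity, by
continuity, so [germ_rigid] applies. *)
Lemma fixed_closed (f : M -> M) n (x : 'rV[R]_3) : Diff f -> (0 < n)%N ->
  (forall P, iter n f P = P) ->
  (forall d : R, 0 < d -> exists2 z, `|z - x| < d & \forall y \near z, f (K y) = K y) ->
  \forall y \near x, f (K y) = K y.
Proof.
move=> Df n0 fn lim.
have lim' d : 0 < d -> exists2 z, `|z - x| < d & f (K z) = K z.
  by move=> /lim[z zx /nbhs_singleton]; exists z.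
have [y Ey] : exists y, f (K x) = K y.
  have [[w Ew]|//] := seifert_cover cop_qp q_gt0 true (f (K x)).
  exfalso; have [t Et] := expi_surj w.
  have Exy : f (K x) = kappa false (pt 0 t) by rewrite Ew Et kappa_pt0.
  have [g [N [gx /near_normP[d1 d10 Eg] dg _]]] := kappa_local_expr Df (esym Exy).
  have s0 : 0 < (`|x| + 2)^-1 :> R by rewrite invr_gt0 ltr_wpDl.
  have [d2 d20 H2] := sdiff_cvg dg s0.
  have [|z zx fz] := lim' (Num.min (Num.min d1 d2) 1); first by rewrite !lt_min d10 d20 /=.
  move: zx; rewrite !lt_min => /andP[/andP[z1 z2] z3].
  have h2 := H2 _ z2; rewrite gx in h2; have := Eg _ z1; rewrite fz.
  move: h2; have [v [r ->]] := ptP (g z); rewrite ptB subr0 pt_norm gt_max => /andP[h2 _].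
  move: z3; have [u [s ->]] := ptP z; move=> z3 /kappa_far.
  have hu : `|u| < `|x| + 1.
    have : `|u| <= `|pt u s| by rewrite pt_norm le_max lexx.
    move/le_lt_trans; apply; rewrite -[pt u s](subrK x) (le_lt_trans (ler_normD _ _))//.
    by rewrite addrC ltrD2l.
  apply/negP; rewrite -ltNge.
  have [->|u0] := eqVneq u 0; first by rewrite normr0 mulr0.
  apply: lt_le_trans (_ : (`|x| + 2)^-1 * `|u| <= 1).
    by rewrite ltr_pM2r ?normr_gt0.
  by rewrite mulrC ler_pdivrMr ?ltr_wpDl// mul1r; lra.
have Ex := fixed_limit Df Ey lim'.
have [g [N [gx Eg dg _]]] := kappa_local_expr Df (esym Ex).
suff N1 : N = 1%:M by apply: (germ_rigid n0 fn gx Eg); rewrite -N1.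
apply/esym/eqP; rewrite -subr_eq0; apply/eqP/mulmx_small0 => e e0 v.
have [d1 d10 H1] := sdiff_deriv_continuous dg e0.
have /near_normP[d2 d20 Eg'] := Eg.
have [d3 d30 H3] := sdiff_cvg dg (divr_gt0 (@ltr01 R) (ltr0n R 2)).
pose d := Num.min (Num.min d1 d2) (Num.min d3 (1 / 2)).
have [|z zx Wz] := lim d; first by rewrite !lt_min d10 d20 d30 divr_gt0.
have zd : `|z - x| < d1 by apply: lt_le_trans zx _; rewrite !ge_min lexx ?orbT.
apply: (H1 z 1%:M zd); apply: sdiff_near (sdiff_id z).
have near_d : \forall y \near z, `|y - x| < d.
  apply/near_normP; exists (d - `|z - x|) => [|y' yz]; first by rewrite subr_gt0.
  rewrite -[y'](subrK z) -addrA (le_lt_trans (ler_normD _ _))//.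
  by rewrite -ltrBrDr.
apply: filterS2 Wz near_d => y' fy; rewrite !lt_min => /andP[/andP[y1 y2] /andP[y3 y4]].
apply/esym; apply: (@kappa_loc_inj3 R q p b cop_qp q_gt0 true _ _ (etrans (Eg' _ y2) fy)).
have h3 := H3 _ y3; rewrite gx in h3.
have -> : g y' - y' = (g y' - x) - (y' - x) by rewrite opprB addrA subrK.
by rewrite (le_lt_trans (ler_normB _ _))// [X in _ < X]splitr ltrD.
Qed.

(** Connectedness of the space, along the segments starting from [x0]. *)
Lemma open_closed_all (W : 'rV[R]_3 -> Prop) x0 : W x0 ->
  (forall x, W x -> \forall z \near x, W z) ->
  (forall x, (forall d : R, 0 < d -> exists2 z, `|z - x| < d & W z) -> W x) ->
  forall x, W x.
Proof.
move=> W0 Wo Wc x; pose l (s : R) := x0 + s *: (x - x0).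
pose chi (s : R) : R := if `[< W (l s) >] then 1 else 0.
have lB s t : l s - l t = (s - t) *: (x - x0).
  by rewrite /l opprD addrACA subrr add0r scalerBl.
have lip d t : 0 < d -> exists2 r : R, 0 < r & forall s, `|s - t| < r -> `|l s - l t| < d.
  move=> d0; have n0 : 0 < `|x - x0| + 1 by rewrite ltr_wpDl.
  exists (d / (`|x - x0| + 1)) => [|s]; first by rewrite divr_gt0.
  rewrite ltr_pdivlMr// lB normrZ; apply: le_lt_trans.
  by rewrite ler_wpM2l// lerDl.
have chi_cst t : exists2 d : R, 0 < d & forall s, `|s - t| < d -> chi s = chi t.
  rewrite /chi; have [Wt|nWt] := asboolP (W (l t)).
    have /near_normP[d d0 Hd] := Wo _ Wt; have [r r0 Hr] := lip d t d0.
    by exists r => // s /Hr/Hd Ws; rewrite asboolT.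
  have [d d0 Hd] : exists2 d : R, 0 < d & forall z, `|z - l t| < d -> ~ W z.
    apply: contrapT => H; apply: nWt; apply: Wc => d d0; apply: contrapT => H2.
    by apply: H; exists d => // z zt Wz; apply: H2; exists z.
  have [r r0 Hr] := lip d t d0.
  by exists r => // s /Hr/Hd Ws; rewrite asboolF.
have := locally_cst chi_cst 0 1; rewrite /chi.
have -> : l 0 = x0 by rewrite /l scale0r addr0.
have -> : l 1 = x by rewrite /l scale1r addrC subrK.
rewrite asboolT//; case: asboolP => // _ /eqP; by rewrite oner_eq0.
Qed.

Lemma near_near (x : 'rV[R]_3) (P : 'rV[R]_3 -> Prop) :
  (\forall z \near x, P z) -> \forall z \near x, \forall y \near z, P y.
Proof.
move=> /near_normP[d d0 H]; apply/near_normP; exists (d / 2) => [|z zx].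
  by rewrite divr_gt0.
apply/near_normP; exists (d / 2) => [|y yz]; first by rewrite divr_gt0.
apply: H; rewrite -[y](subrK z) -addrA (le_lt_trans (ler_normD _ _))//.
by rewrite [d]splitr ltrD.
Qed.

(** At a point of the critical fiber the differential is unipotent, hence trivial since its order
is finite. So the interior of the fixed point set is not empty by [germ_rigid], and it is open and
closed. The core missed by the chart [kappa true] is in the closure of the rest. *)
Lemma lift_rigid (f : M -> M) n : Diff f -> (0 < n)%N -> (forall P, iter n f P = P) ->
  lift f id 1%:M -> forall P, f P = P.
Proof.
move=> Df n0 fn L.
have [g [u [c [H [d d0 Hd]]]]] := L 0.
have c1 : c = 1.
  have Dg := core_expr_derive H.
  have D1 : is_derive (0 : R) (1 : R) (fun r => g (pt 0 r) 0 2) 1.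
    have D0 : is_derive (0 : R) (1 : R) (@id R) 1 by exact: is_derive_id.
    apply: near_eq_is_derive D0.
    apply/nbhs_ballP; exists d => // r; rewrite /ball /= distrC => rt.
    by rewrite Hd// pt2.
  by rewrite -(@derive_val _ _ _ _ _ _ _ Dg) (@derive_val _ _ _ _ _ _ _ D1).
case: H => gx Eg dg _ _; rewrite c1 in dg.
have [dn En] := iter_local_expr n gx dg Eg.
(* The differential is unipotent and of finite order. *)
have u0 : u = 0.
  have pow k : iter k (mulmx (blk 1%:M u 1)) 1%:M = blk 1%:M (u *+ k) 1.
    elim: k => [|k IH] /=; first by rewrite mulr0n blk1.
    by rewrite IH blkM !mul1mx scale1r mulr1 mulrS [u + _]addrC.
  rewrite pow in dn.
  have gn0 : iter n g (pt 0 0) = pt 0 0 by elim: (n) => //= k ->.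
  have idn : \forall z \near pt 0 0, K (id z) = id (K z).
    by apply/near_normP; exists 1; [exact: ltr01|].
  have En' : \forall z \near pt 0 0, K (iter n g z) = id (K z).
    by apply: filterS En => z ->; rewrite fn.
  have E0 : iter n g (pt 0 0) = deck 0 (id (pt 0 0)).
    by rewrite gn0 deck_pt zeta0 mulmx1 mul0r addr0.
  have := @local_expr_deck R q p b cop_qp q_gt1 id id _ _ 0 idn En' (sdiff_cvg (sdiff_id _)) (sdiff_cvg dn) E0.
  move=> En1; have dn1 : sdiff (iter n g) (pt 0 0) 1%:M.
    apply: sdiff_near (sdiff_id _); apply: filterS En1 => z ->.
    by have [v [t ->]] := ptP z; rewrite deck_pt zeta0 mulmx1 mul0r addr0.
  have := sdiff_uniq dn dn1; rewrite -blk1 => /blk_inj[_ un _].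
  apply/matrixP => i j; have := congr1 (fun A : 'M[R]_(2, 1) => A i j) un.
  have Z0 : (0 : 'M[R]_(2, 1)) i j = 0 by rewrite mxE.
  by rewrite mulmxnE Z0 => /eqP; rewrite mulrn_eq0 eqn0Ngt n0 /= => /eqP.
rewrite u0 blk1 in dg.
have fK x : f (K x) = K x.
  suff : \forall y \near x, f (K y) = K y by exact: nbhs_singleton.
  apply: (@open_closed_all (fun x => \forall y \near x, f (K y) = K y) (pt 0 0)).
  - exact: germ_rigid n0 fn gx Eg dg.
  - by move=> z; exact: (@near_near z (fun y => f (K y) = K y)).
  - by move=> {}x; exact: fixed_closed Df n0 fn.
have injf : injective f by case: Df => -[_ [f' _ [/can_inj]]].
move=> P; have [[w ->]|[x ->]] := seifert_cover cop_qp q_gt0 true P; last exact: fK.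
have [t ->] := expi_surj w; rewrite -kappa_pt0.
have [[w' Ew']|[y Ey]] := seifert_cover cop_qp q_gt0 true (f (kappa false (pt 0 t))); last first.
  have := fK y; rewrite -Ey => /injf; rewrite Ey kappa_pt0.
  exact.
have [t' Et'] := expi_surj w'.
have Ef : f (kappa false (pt 0 t)) = kappa false (pt 0 t') by rewrite Ew' Et' kappa_pt0.
apply: (fixed_limit Df Ef) => r r0.
exists (pt (pol (ln (r / 2)) 0) t).
  rewrite ptB subr0 subrr pt_norm normr0 gt_max r0 andbT.
  have H : `|pol (ln (r / 2)) 0| <= r / 2.
    apply: row_norm_le; first by rewrite divr_ge0// ltW.
    have r2 : 0 < r / 2 by rewrite divr_gt0.
    apply: ord2P; rewrite !mxE /= lnK ?posrE//.
      by rewrite cos0 mulr1 gtr0_norm.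
    by rewrite sin0 mulr0 normr0 ltW.
  by apply: le_lt_trans H _; rewrite ltr_pdivrMr// ltr_pMr// (ltr_nat _ 1 2).
rewrite (kappa_pol b cop_qp q_gt0).
have [v [s [_ ->]]] := Reg_kappa b cop_qp q_gt0 true ((end_sign false)%:~R * (1 - ln (r / 2)))
  (expi ((end_sign false)%:~R * ((mer q p b false)%:~R * 0)))
  (expi ((twi q p b false)%:~R * 0 - t / (mer q p b false)%:~R)).
exact: fK.
Qed.

End Rigidity.

(** * Recognition of subgroups of generalized dihedral groups *)

Section DihedralEmbedding.
Variables (R : realType) (gT : finGroupType) (G G0 : {group gT}).
Variable chi : bool -> gT -> R[i].
Hypotheses (sG0G : (G0 \subset G)%g)
  (chiM : forall i, {in G0 &, forall x y, chi i (x * y)%g = chi i x * chi i y})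
  (chi1 : forall i, chi i 1%g = 1)
  (chi_inj : forall x, x \in G0 -> (forall i, chi i x = 1) -> x = 1%g)
  (index2 : forall x y, x \in G -> x \notin G0 -> y \in G -> y \notin G0 -> (x * y)%g \in G0)
  (involutive : forall x, x \in G -> x \notin G0 -> (x * x = 1)%g).

(* Twice the order of [G], as ['Z_N] is the ring of integers modulo [N] only for [N] greater than [1]. *)
Local Notation N := (#|G| * 2)%N.
Local Notation tau := (pi *+ 2 : R).

Let N_gt1 : (1 < N)%N.
Proof. by rewrite muln2 -addnn (leq_add (cardG_gt0 G) (cardG_gt0 G)). Qed.

Lemma cis_primitive n : (0 < n)%N -> n.-primitive_root (cis (tau / n%:R)).
Proof.
move=> n0; have nN : n%:R != 0 :> R by rewrite pnatr_eq0 -lt0n.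
apply/andP; split=> //; apply/forallP => i; apply/eqP; rewrite unity_rootE -cisMn.
have -> : tau / n%:R *+ i.+1 = i.+1%:R * (tau / n%:R) by rewrite mulr_natl.
have t0 : 0 < tau by rewrite mulrn_wgt0// pi_gt0.
apply/eqP/eqP => [E|->]; last first.
  by rewrite mulrCA divff// mulr1 cis_pi2.
have [k Ek] : exists k : int, i.+1%:R * (tau / n%:R) = k%:~R * tau.
  have [|k ->] := @cis_eq R (i.+1%:R * (tau / n%:R)) 0; first by rewrite E cis0.
  by exists k; rewrite add0r.
have {}Ek : i.+1%:Z = k * n%:Z.
  apply/eqP; rewrite -(eqr_int R) intrM; apply/eqP.
  apply: (mulIf (lt0r_neq0 t0)); apply: (mulIf (invr_neq0 nN)).
  rewrite -[X in X = _]mulrA Ek; field; exact: nN.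
have k0 : 0 < k by rewrite -(pmulr_lgt0 (x := n%:Z)) -?Ek// ltz_nat.
have := ltn_ord i; have : n%:Z <= i.+1%:Z by rewrite Ek ler_peMl//; lia.
by rewrite lez_nat => h1 h2; apply/eqP; rewrite eqn_leq h1 h2.
Qed.

Lemma chiX i x n : x \in G0 -> chi i (x ^+ n)%g = chi i x ^+ n.
Proof.
by move=> Gx; elim: n => [|n IH]; rewrite ?chi1// expgS chiM ?groupX// IH exprS.
Qed.

Lemma chi_root i x : x \in G0 -> exists k : 'Z_N, chi i x = cis (tau / N%:R) ^+ k.
Proof.
move=> Gx; have N0 := ltnW N_gt1; have pN := cis_primitive N0.
have [|k ->] := @prim_rootP _ _ _ pN (chi i x).
  by rewrite exprM -chiX// (expg_cardG (fintype.subsetP sG0G _ Gx)) chi1 expr1n.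
by exists (inZp k); rewrite -(prim_expr_mod pN) /= Zp_cast// modn_mod.
Qed.

(** The discrete logarithm of a root of unity. *)
Definition chi_log i x : 'Z_N := xget 0 [set k : 'Z_N | chi i x = cis (tau / N%:R) ^+ k].

Lemma chi_logK i x : x \in G0 -> chi i x = cis (tau / N%:R) ^+ chi_log i x.
Proof. by move=> /(chi_root i)[k Hk]; rewrite /chi_log; case: xgetP => [_ _ //|/(_ k)]. Qed.

Lemma chi_logD i : {in G0 &, forall x y, chi_log i (x * y)%g = chi_log i x + chi_log i y}.
Proof.
move=> x y Gx Gy; apply/val_inj/eqP => /=; have pN := cis_primitive (ltnW N_gt1).
have := eqxx (chi i (x * y)%g); rewrite {1}chiM// !chi_logK ?groupM// -exprD.
rewrite eq_sym (eq_prim_root_expr pN) modn_small; last by rewrite -{2}(Zp_cast N_gt1).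
by move=> /eqP H; apply/eqP; rewrite H; exact: (congr1 (modn _) (esym (Zp_cast N_gt1))).
Qed.

Local Notation D := (Dih (ZpX_abelian N N)).
Local Notation act := (GroupAction (inversion_is_groupAction (ZpX_abelian N N))).

Definition chi_logs x : 'Z_N * 'Z_N := (chi_log true x, chi_log false x).

Lemma chi_logs_in x : chi_logs x \in ZpX N N.
Proof. by rewrite inE /= /Zp N_gt1 !inE. Qed.

Lemma chi_logsM : {in G0 &, forall x y, chi_logs (x * y) = chi_logs x * chi_logs y}%g.
Proof. by move=> x y Gx Gy; congr pair; rewrite chi_logD. Qed.

Lemma chi_logsV x : x \in G0 -> chi_logs x^-1%g = (chi_logs x)^-1%g.
Proof.
move=> Gx; apply/esym/eqP; rewrite eq_invg_mul -chi_logsM ?groupV//.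
rewrite mulgV; apply/eqP; apply: (mulgI (chi_logs 1)).
by rewrite -chi_logsM ?group1// !mulg1.
Qed.

Lemma chi_logs_inj x : x \in G0 -> chi_logs x = 1%g -> x = 1%g.
Proof.
move=> Gx [E1 E2]; apply: chi_inj => // i; rewrite chi_logK//.
by case: i; rewrite ?E1 ?E2.
Qed.

(** The characters have values in the [N]-th roots of unity, so [G0] embeds in ['Z_N * 'Z_N]. Outside
[G0] all products of two elements are in [G0] and all squares are trivial, so an
element [t] outside [G0] inverts [G0] by conjugation. *)
Lemma dihedral_embedding : exists H : {group D}, (G \isog H)%g.
Proof.
(* If [G = G0], then any [t] will do. *)
have [t Ht] : exists t, forall x, x \in G -> x \notin G0 -> t \in G /\ t \notin G0.
  have [[t tG]|H] := pselect (exists t, t \in G /\ t \notin G0); first by exists t.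
  by exists 1%g => x Gx nx; case: H; exists x.
have tt x : x \in G -> x \notin G0 -> (t * t = 1)%g.
  by move=> Gx nx; have [? ?] := Ht _ Gx nx; exact: involutive.
have xt x : x \in G -> x \notin G0 -> (x * t)%g \in G0.
  by move=> Gx nx; have [? ?] := Ht _ Gx nx; exact: index2.
have in_out x y : x \in G0 -> y \in G -> y \notin G0 -> (x * y)%g \notin G0.
  by move=> Gx Gy; apply: contra => H; rewrite -(groupMl _ Gx).
have out_in x y : x \in G -> x \notin G0 -> y \in G0 -> (x * y)%g \notin G0.
  by move=> Gx nx Gy; apply: contra nx => H; rewrite -(groupMr _ Gy).
pose X x : D := sdpair1 act (chi_logs x).
pose s : D := sdpair2 act (1%R : 'Z_2).
have XM x y : x \in G0 -> y \in G0 -> (X (x * y) = X x * X y)%g.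
  by move=> Gx Gy; rewrite /X chi_logsM// morphM// chi_logs_in.
have XV x : x \in G0 -> (X x^-1 = (X x)^-1)%g.
  by move=> Gx; rewrite /X chi_logsV// morphV// chi_logs_in.
have ss : (s * s = 1)%g.
  pose c : 'Z_2 := 1%R; have cc : (c * c = 1)%g by exact: val_inj.
  have := sdpair2_morphM act (finset.in_setT c) (finset.in_setT c).
  by rewrite cc -/s => <-; exact: (morph1 (sdpair2_morphism act)).
have sX x : x \in G0 -> (s * X x = X x^-1 * s)%g.
  move=> Gx; have sV : (s^-1 = s)%g by apply/eqP; rewrite eq_invg_mul ss.
  have := @sdpair_act _ _ _ _ act (chi_logs x) (1%R : 'Z_2) (chi_logs_in x) (finset.in_setT _).
  rewrite /= /inversion chi_logs_in /= -/s => E.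
  have {}E : (X x^-1 = X x ^ s)%g by rewrite /X chi_logsV// E.
  by rewrite E conjgE -[RHS]mulgA -mulgA ss mulg1 sV.
pose Psi x : D := if x \in G0 then X x else (X (x * t) * s)%g.
have PsiM : {in G &, {morph Psi : x y / (x * y)%g}}.
  move=> x y Gx Gy; rewrite /Psi.
  case: (boolP (x \in G0)) => x0; case: (boolP (y \in G0)) => y0.
  - by rewrite groupM// XM.
  - by rewrite (negbTE (in_out _ _ x0 Gy y0)) [RHS]mulgA -XM ?xt// mulgA.
  - rewrite (negbTE (out_in _ _ Gx x0 y0)) -[RHS]mulgA sX// mulgA -XM ?xt ?groupV//.
    have ty : (t * y * (t * y) = 1)%g.
      have [Gt t0] := Ht _ Gx x0; apply: involutive; first exact: groupM.
      exact: out_in.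
    congr (X _ * _)%g; rewrite -!mulgA; congr (x * _)%g.
    by apply: (mulgI t); rewrite [RHS]mulgA (tt x)// mul1g; apply: (mulIg y);
      rewrite mulVg -ty !mulgA.
  rewrite index2// -[RHS]mulgA [(s * _)%g]mulgA sX ?xt// -[(_ * s * s)%g]mulgA ss mulg1.
  rewrite -XM ?groupV ?xt//; congr X; rewrite invMg !mulgA -[(x * t * t^-1)%g]mulgA mulgV mulg1.
  by congr (_ * _)%g; apply/eqP; rewrite eq_sym eq_invg_mul involutive.
pose f := Morphism PsiM.
have injf : ('injm f)%g.
  apply/fintype.subsetP => x; rewrite inE => /andP[Gx]; rewrite !inE => /eqP/= E.
  move: E; rewrite /Psi; case: ifP => [x0|/negbT x0] E.
    apply/eqP/chi_logs_inj => //; apply/eqP.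
    have := (injmP (injm_sdpair1 act)) (chi_logs x) 1%g (chi_logs_in x) (group1 _).
    by move=> ->; rewrite // morph1.
  have : s \in (1%g : {set D}).
    rewrite -(im_sdpair_TI act) inE; apply/andP; split; last first.
      by apply: mem_morphim; exact: finset.in_setT.
    have -> : s = ((X (x * t))^-1)%g by apply/esym/eqP; rewrite eq_invg_mul E.
    by rewrite groupV; apply: mem_morphim; exact: chi_logs_in.
  move=> /set1P s1.
  have := (injmP (injm_sdpair2 act)) (1%R : 'Z_2) (1%g) (finset.in_setT _) (finset.in_setT _).
  by move=> /(_ (etrans s1 (esym (morph1 (sdpair2_morphism act))))).
by exists (f @* G)%G; exact: (sub_isog (fintype.subxx _) injf).
Qed.

End DihedralEmbedding.

(** * Plane linear maps preserving a quadratic form *)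

Section InvariantForm.
Variables (R : realType) (S : 'M[R]_2).
Hypotheses (S_sym : S 1 0 = S 0 1) (S00 : 0 < S 0 0) (S_det : 0 < \det S).

Definition preserves (A : 'M[R]_2) : Prop := A *m S *m A^T = S /\ \det A = 1.

(** The matrices which preserve [S] have a common eigenvector [(1, w)]^T, namely that of
[S *m J], where [J] is the rotation by a right angle, and the corresponding eigenvalue determines
the matrix. *)
Definition multiplier (A : 'M[R]_2) : R[i] :=
  ((A 0 0 + A 0 1 * S 0 1 / S 0 0) +i* (A 0 1 * Num.sqrt (\det S) / S 0 0))%C.

Let a0 : S 0 0 != 0. 
Proof. by rewrite gt_eqF. Qed.

Lemma mx2E m n (A : 'M[R]_(m, 2)) (B : 'M[R]_(2, n)) i j : (A *m B) i j = A i 0 * B 0 j + A i 1 * B 1 j :> R.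
Proof.
by rewrite mxE big_ord_recl big_ord1; congr (_ * _ + A i _ * B _ j); exact: val_inj.
Qed.

Lemma form_preserves A : A *m S *m A^T = S -> 0 < \det A -> preserves A.
Proof.
move=> E dA; split=> //; move: (congr1 determinant E); rewrite !det_mulmx det_tr => E1.
have {}E1 : \det A ^+ 2 = 1.
  by apply: (mulIf (lt0r_neq0 S_det)); rewrite mul1r -[RHS]E1; ring.
by apply/eqP; rewrite -(@eqrXn2 _ 2)// ?ltW// E1 expr1n.
Qed.

Lemma preservesE A : preserves A ->
  [/\ S 0 0 * A 0 0 ^+ 2 + 2 * S 0 1 * A 0 0 * A 0 1 + S 1 1 * A 0 1 ^+ 2 = S 0 0,
      A 1 0 = - S 1 1 * A 0 1 / S 0 0 & A 1 1 = A 0 0 + 2 * S 0 1 * A 0 1 / S 0 0].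
Proof.
move=> [E]; rewrite det2 => dA.
have E00 := congr1 (fun X : 'M[R]_2 => X 0 0) E.
have E01 := congr1 (fun X : 'M[R]_2 => X 0 1) E.
have {}E00 : S 0 0 * A 0 0 ^+ 2 + 2 * S 0 1 * A 0 0 * A 0 1 + S 1 1 * A 0 1 ^+ 2 = S 0 0.
  by rewrite -[RHS]E00 !mx2E !mxE S_sym; ring.
have {}E01 : S 0 0 * A 0 0 * A 1 0 + S 0 1 * (A 0 0 * A 1 1 + A 0 1 * A 1 0) +
    S 1 1 * A 0 1 * A 1 1 = S 0 1.
  by rewrite -[RHS]E01 !mx2E !mxE S_sym; ring.
split=> //; apply: (mulIf a0); rewrite ?[RHS]mulrDl !divfK//.
  have -> : A 1 0 * S 0 0 =
    A 1 0 * (S 0 0 * A 0 0 ^+ 2 + 2 * S 0 1 * A 0 0 * A 0 1 + S 1 1 * A 0 1 ^+ 2) by rewrite E00.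
  transitivity (A 0 0 * S 0 1 - (S 0 1 * A 0 0 + S 1 1 * A 0 1) *
     (A 0 0 * A 1 1 - A 0 1 * A 1 0)); last by rewrite dA; ring.
  by rewrite -[X in _ = A 0 0 * X - _]E01; ring.
have -> : A 1 1 * S 0 0 =
  A 1 1 * (S 0 0 * A 0 0 ^+ 2 + 2 * S 0 1 * A 0 0 * A 0 1 + S 1 1 * A 0 1 ^+ 2) by rewrite E00.
transitivity (A 0 1 * S 0 1 + (S 0 0 * A 0 0 + S 0 1 * A 0 1) *
     (A 0 0 * A 1 1 - A 0 1 * A 1 0)); last by rewrite dA; ring.
by rewrite -[X in _ = A 0 1 * X + _]E01; ring.
Qed.

Lemma multiplierM A B : preserves B -> multiplier (A *m B) = multiplier A * multiplier B.
Proof.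
move=> /preservesE[_ E10 E11]; rewrite /multiplier !mx2E E10 E11; simpc.
have s2 : Num.sqrt (\det S) * Num.sqrt (\det S) = S 0 0 * S 1 1 - S 0 1 ^+ 2.
  by rewrite -expr2 sqr_sqrtr ?ltW// det2 S_sym expr2.
move: (Num.sqrt _) s2 => s s2; congr (_ +i* _)%C; last by field.
transitivity (A 0 0 * (B 0 0 + B 0 1 * S 0 1 / S 0 0) + A 0 1 * S 0 1 / S 0 0 *
  (B 0 0 + B 0 1 * S 0 1 / S 0 0) - A 0 1 * B 0 1 * (s * s) / (S 0 0 * S 0 0)); last by field.
by rewrite s2; field.
Qed.

Lemma multiplier1 : multiplier 1%:M = 1.
Proof. by rewrite /multiplier !mxE /= !mul0r addr0. Qed.

Lemma norm_multiplier A : preserves A -> `|multiplier A| = 1.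
Proof.
move=> /preservesE[E _ _]; rewrite /multiplier normc_def /=.
have -> : (A 0 0 + A 0 1 * S 0 1 / S 0 0) ^+ 2 + (A 0 1 * Num.sqrt (\det S) / S 0 0) ^+ 2 = 1.
  rewrite !exprMn sqr_sqrtr ?ltW// det2 S_sym -[RHS](divff a0) -[X in _ = X / _]E.
  by field.
by rewrite sqrtr1.
Qed.

Lemma trace_multiplier A : preserves A -> \tr A = 2 * complex.Re (multiplier A).
Proof.
move=> /preservesE[_ _ E11]; rewrite /mxtrace big_ord_recl big_ord1 /=.
have -> : fintype.lift ord0 ord0 = 1 :> 'I_2 by exact: val_inj.
by rewrite E11; field.
Qed.

Lemma multiplier_inj A : preserves A -> multiplier A = 1 -> A = 1%:M.
Proof.
move=> /preservesE[_ E10 E11] [Re Im].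
have s0 : Num.sqrt (\det S) != 0 by rewrite gt_eqF// sqrtr_gt0.
have A01 : A 0 1 = 0.
  move: Im => /eqP; rewrite mulf_eq0 invr_eq0 (negbTE a0) orbF mulf_eq0 (negbTE s0) orbF.
  by move/eqP.
rewrite A01 !mul0r addr0 in Re; rewrite A01 !mulr0 !mul0r ?addr0 in E10 E11.
by apply/matrixP; apply: ord2P; apply: ord2P; rewrite ?E10 ?E11 ?A01 ?Re !mxE.
Qed.

(** The trace of [A ^+ 2] is [\tr A ^+ 2 + 2] by the theorem of Cayley and Hamilton, and it is the
double of the real part of a complex number of norm [1]. *)
Lemma orientation_reversing_square A : \det A = -1 -> preserves (A *m A) -> A *m A = 1%:M.
Proof.
move=> dA PA.
have t2 : \tr (A *m A) = (A 0 0 + A 1 1) ^+ 2 + 2.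
  rewrite /mxtrace big_ord_recl big_ord1 /=.
  have -> : fintype.lift ord0 ord0 = 1 :> 'I_2 by exact: val_inj.
  rewrite !mx2E; move: dA; rewrite det2 => dA.
  have -> : 2 = (- 2) * (A 0 0 * A 1 1 - A 0 1 * A 1 0) by rewrite dA mulrNN mulr1.
  have -> : ord0 = 0 :> 'I_2 by [].
  ring.
have t0 : A 0 0 + A 1 1 = 0.
  have := norm_multiplier PA; have := trace_multiplier PA; rewrite t2.
  case: (multiplier _) => x y /= Ex; rewrite normc_def /= => /complexI/(congr1 (fun u => u ^+ 2)).
  rewrite sqr_sqrtr ?addr_ge0 ?sqr_ge0// expr1n => E.
  apply/eqP; rewrite -sqrf_eq0 eq_le sqr_ge0 andbT.
  have := sqr_ge0 y; nra.
have E11 : A 1 1 = - A 0 0 by apply/eqP; rewrite -addr_eq0 addrC t0.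
move: dA; rewrite det2 E11 => dA.
have {}dA : A 0 0 * A 0 0 + A 0 1 * A 1 0 = 1.
  by rewrite -[RHS]opprK -dA; ring.
apply/matrixP; apply: ord2P; apply: ord2P; rewrite mx2E ?E11 !mxE /= ?E11.
- by [].
- by ring.
- by ring.
by rewrite -[RHS]dA; ring.
Qed.

End InvariantForm.

(** * Finite groups of fiber-preserving diffeomorphisms *)

Section Forward.
Variables (R : realType) (q p b : int).
Hypotheses (cop_qp : coprimez q p) (q_gt1 : 1 < q).
Local Notation M := (seifert R q p b).
Local Notation Diff := (@Diff_plus_fp R q p b).
Local Notation tau := (pi *+ 2 : R).
Local Notation zeta := (zeta R q p b).
Local Notation lifts := (@lift R q p b).
Opaque kappa pt.
Variables (gT : finGroupType) (G : {group gT}) (act : gT -> M -> M).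
Hypothesis act_fp : fp_action G act.

Let tau_gt0 : 0 < tau.
Proof. by rewrite mulrn_wgt0// pi_gt0. Qed.

Lemma act_Diff x : x \in G -> Diff (act x).
Proof. by case: act_fp => H _ _; exact: H. Qed.

Lemma actM x y : x \in G -> y \in G -> act (x * y)%g = act x \o act y.
Proof. by case: act_fp => _ H _; exact: H. Qed.

Lemma act1 P : act 1%g P = P.
Proof.
have inj1 : injective (act 1%g).
  by case: (act_Diff (group1 G)) => -[_ [f' _ [/can_inj H _]]] _ _.
by apply: inj1; have E := actM (group1 G) (group1 G); rewrite -[in RHS](mulg1 1%g) E.
Qed.

Lemma act_iter x n P : x \in G -> iter n (act x) P = act (x ^+ n)%g P.
Proof.
move=> Gx; elim: n => [|n IH]; first by rewrite expg0 act1.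
by rewrite iterS IH expgS actM// groupX.
Qed.

Lemma act_order x P : x \in G -> iter #|G| (act x) P = P.
Proof. by move=> Gx; rewrite act_iter// expg_cardG// act1. Qed.

Lemma act_eq1 x : x \in G -> (forall P, act x P = P) -> x = 1%g.
Proof.
move=> Gx E; case: act_fp => _ _; apply=> //.
by apply/funext => P; rewrite E act1.
Qed.

Variables (ph : gT -> R -> R) (nd : gT -> 'M[R]_2).
Hypothesis lftP : forall x, x \in G -> lifts (act x) (ph x) (nd x).

Let lftM x y f g A B : x \in G -> y \in G -> lifts (act x) f A -> lifts (act y) g B ->
  lifts (act (x * y)%g) (f \o g) (B *m A).
Proof. by move=> Gx Gy Lx Ly; rewrite actM//; exact: lift_comp Ly Lx. Qed.

Let lft_deck k : lifts (act 1%g) (fun t => t + k%:~R * tau) (zeta k).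
Proof. exact: (lift_deck cop_qp q_gt1 k act1). Qed.

Let lft_det x f A : x \in G -> lifts (act x) f A -> \det A = \det (nd x).
Proof.
move=> Gx L; have [k [_ ->]] := lift_uniq cop_qp q_gt1 (lftP Gx) L.
by rewrite det_mulmx det_zeta mulr1.
Qed.

(** The elements which preserve the orientation of the normal planes, or equivalently that of the
critical fiber. *)
Definition oriented : {set gT} := finset (fun x => (x \in G) && (0 < \det (nd x))).

Lemma orientedP x : x \in oriented -> x \in G /\ 0 < \det (nd x).
Proof. by rewrite inE => /andP. Qed.

Lemma det_ndM x y : x \in G -> y \in G ->
  \det (nd (x * y)%g) = \det (nd x) * \det (nd y).
Proof.
move=> Gx Gy; rewrite -(lft_det (groupM Gx Gy) (lftM Gx Gy (lftP Gx) (lftP Gy))).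
by rewrite det_mulmx mulrC.
Qed.

Lemma oriented_group : group_set oriented.
Proof.
apply/group_setP; split.
  rewrite inE group1 /=; have := lft_det (group1 G) (lft_deck 0) => <-.
  by rewrite det_zeta.
move=> x y /orientedP[Gx dx] /orientedP[Gy dy].
by rewrite inE groupM//= det_ndM// mulr_gt0.
Qed.

Canonical oriented_groupType := Group oriented_group.
Local Notation G0 := oriented_groupType.

Lemma oriented_sub : (G0 \subset G)%g.
Proof. by apply/fintype.subsetP => x /orientedP[]. Qed.

Lemma not_oriented x : x \in G -> x \notin G0 -> \det (nd x) < 0.
Proof.
move=> Gx; rewrite inE Gx /= -leNgt le_eqVlt => /orP[/eqP d0|//].
by have := lift_det (lftP Gx); rewrite d0 eqxx.
Qed.

Lemma oriented_index2 x y : x \in G -> x \notin G0 -> y \in G -> y \notin G0 ->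
  (x * y)%g \in G0.
Proof.
move=> Gx nx Gy ny; rewrite inE groupM//= det_ndM//.
by rewrite nmulr_lgt0 ?not_oriented.
Qed.

(** The average [U] of the lifts conjugates all of them to translations, up to a reindexing of the
sum. It is rescaled to [V] to commute with the translation by [tau]. *)
Let U t : R := \sum_(x in G0) ph x t.

Let U_lift h f A : h \in G0 -> lifts (act h) f A -> exists r, forall t, U (f t) = U t + r.
Proof.
move=> G0h L; have [Gh _] := orientedP G0h.
have Hk x : exists k : int, x \in G0 -> forall t, ph x (f t) = ph (x * h)%g t + k%:~R * tau.
  have [/orientedP[Gx _]|nx] := boolP (x \in G0); last by exists 0.
  have [k [Hk _]] := lift_uniq cop_qp q_gt1 (lftP (groupM Gx Gh)) (lftM Gx Gh (lftP Gx) L).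
  by exists k => _ t; rewrite -Hk.
have [k {}Hk] := choice Hk.
exists (\sum_(x in G0) (k x)%:~R * tau) => t.
rewrite /U (eq_bigr _ (fun x Gx => Hk x Gx t)) big_split /=; congr (_ + _).
rewrite [RHS](reindex_inj (mulIg h)) /=; apply: eq_bigl => x.
by rewrite groupMr.
Qed.

Let U_incr t s : t < s -> U t < U s.
Proof.
move=> ts; apply: ltr_sum.
  by apply/hasP; exists 1%g; rewrite ?mem_index_enum ?group1.
by move=> x /orientedP[Gx dx]; exact: (lift_increasing (lftP Gx) dx ts).
Qed.

Let c : R := U tau - U 0.

Let c_gt0 : 0 < c.
Proof. by rewrite subr_gt0 U_incr. Qed.

Let V t : R := U t * (tau / c).

Let V_incr t s : t < s -> V t < V s.
Proof. by move=> ts; rewrite ltr_pM2r ?U_incr// divr_gt0. Qed.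

Let V_lift h f A : h \in G0 -> lifts (act h) f A -> forall t, V (f t) = V t + (V (f 0) - V 0).
Proof.
move=> G0h L t; have [r E] := U_lift G0h L.
by rewrite /V !E -mulrBl -mulrDl; congr (_ * _); ring.
Qed.

Let V_tau k t : V (t + k%:~R * tau) = V t + k%:~R * tau.
Proof.
have V1 s : V (s + tau) = V s + tau.
  have := V_lift (group1 G0) (lft_deck 1) s; rewrite mul1r add0r => ->.
  by congr (_ + _); rewrite /V -mulrBl -/c mulrCA divff ?mulr1// gt_eqF.
have Vn n s : V (s + n%:R * tau) = V s + n%:R * tau.
  elim: n s => [|n IH] s; first by rewrite mul0r !addr0.
  by rewrite -natr1 mulrDl mul1r addrA V1 IH -[LHS]addrA.
case: k => n; first exact: Vn.
rewrite NegzE mulrNz !mulNr; apply: (addIr (n.+1%:R * tau)).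
by rewrite -Vn -[_%:~R]/(n.+1%:R) !subrK.
Qed.

Let V_inj t s : V t = V s -> t = s.
Proof.
move=> E; have [/V_incr|/V_incr|//] := ltgtP t s; by rewrite E ltxx.
Qed.

(** The usual averaging trick, for the normal differentials. *)
Let S : 'M[R]_2 := \sum_(x in G0) nd x *m (nd x)^T.

Let S_sym : S 1 0 = S 0 1.
Proof.
have : S^T = S.
  rewrite /S raddf_sum; apply: eq_bigr => x _ /=; by rewrite trmx_mul trmxK.
by move=> E; rewrite -[in LHS]E mxE.
Qed.

Let S_pos (v : 'rV[R]_2) : v != 0 -> 0 < (v *m S *m v^T) 0 0.
Proof.
move=> v0; have -> : v *m S *m v^T = \sum_(x in G0) (v *m nd x) *m (v *m nd x)^T.
  rewrite /S mulmx_sumr mulmx_suml; apply: eq_bigr => x _.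
  by rewrite trmx_mul !mulmxA.
have E (w : 'rV[R]_2) : (w *m w^T) 0 0 = w 0 0 ^+ 2 + w 0 1 ^+ 2.
  by rewrite mx2E !mxE !expr2.
rewrite summxE (bigD1 1%g) ?group1//= ltr_pwDl//; last first.
  by apply: sumr_ge0 => x _; rewrite E addr_ge0 ?sqr_ge0.
have n0 : v *m nd 1%g != 0.
  have /lift_det d0 := lftP (group1 G).
  apply: contra v0 => /eqP/(congr1 (mulmx^~ (invmx (nd 1%g)))).
  by rewrite mulmxK ?unitmxE ?unitfE// mul0mx => ->.
rewrite E lt_neqAle addr_ge0 ?sqr_ge0// andbT eq_sym paddr_eq0 ?sqr_ge0// !sqrf_eq0.
apply: contra n0 => /andP[/eqP w0 /eqP w1]; apply/eqP/rowP; apply: ord2P; by rewrite ?w0 ?w1 [RHS]mxE.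
Qed.

Let S00 : 0 < S 0 0.
Proof.
have e0 : (\row_i [:: 1; 0]`_i : 'rV[R]_2) != 0.
  by apply/eqP => /rowP/(_ 0); rewrite !mxE /= => /eqP; rewrite oner_eq0.
by have := S_pos e0; rewrite !mx2E !mxE /= !(mul0r, mul1r, mulr0, mulr1, addr0).
Qed.

Let S_det : 0 < \det S.
Proof.
have e0 : (\row_i [:: - S 0 1; S 0 0]`_i : 'rV[R]_2) != 0.
  by apply/eqP => /rowP/(_ 1); rewrite !mxE /= => /eqP; rewrite gt_eqF.
have := S_pos e0; have -> : (\row_i [:: - S 0 1; S 0 0]`_i *m S *m
    (\row_i [:: - S 0 1; S 0 0]`_i)^T) 0 0 = S 0 0 * \det S.
  by rewrite det2 !mx2E !mxE /= S_sym; ring.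
by rewrite pmulr_rgt0.
Qed.

Let zeta_tr k : zeta k *m (zeta k)^T = 1%:M.
Proof.
have -> : (zeta k)^T = zeta (- k).
  apply/matrixP; apply: ord2P; apply: ord2P; rewrite !mxE /= intrN !mulNr ?cosN ?sinN//.
  by rewrite opprK.
by rewrite -zetaD subrr zeta0.
Qed.

Let S_lift h f A : h \in G0 -> lifts (act h) f A -> preserves S A.
Proof.
move=> G0h L; have [Gh dh] := orientedP G0h.
apply: form_preserves => //; last by rewrite (lft_det Gh L).
rewrite /S mulmx_sumr mulmx_suml [RHS](reindex_inj (mulIg h)) /=.
apply: eq_big => [x|x /orientedP[Gx _]]; first by rewrite groupMr.
have [k [_ E]] := lift_uniq cop_qp q_gt1 (lftP (groupM Gx Gh)) (lftM Gx Gh (lftP Gx) L).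
have -> : A *m (nd x *m (nd x)^T) *m A^T = (A *m nd x) *m (A *m nd x)^T.
  by rewrite trmx_mul !mulmxA.
rewrite E trmx_mul mulmxA -[nd _ *m _ *m _]mulmxA zeta_tr mulmx1.
by [].
Qed.

Let mul := multiplier S.

(** The normal differentials are defined up to the powers of [zeta 1]; [w] is the angle of its
multiplier per unit of translation. *)
Let zeta_mul : exists w : R, forall k, mul (zeta k) = cis (k%:~R * tau * w).
Proof.
have P k : preserves S (zeta k) by exact: S_lift (group1 G0) (lft_deck k).
have [y Ey] := cis_surj (norm_multiplier S_sym S00 S_det (P 1)).
exists (y / tau).
have M1 k : mul (zeta (k + 1)) = mul (zeta k) * cis y by rewrite zetaD /mul multiplierM// Ey.
have Mn (n : nat) : mul (zeta n%:Z) = cis (n%:R * y).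
  elim: n => [|n IH]; first by rewrite zeta0 /mul multiplier1 mul0r cis0.
  by rewrite -natr1 mulrDl mul1r cisD -IH -M1 -addn1.
have tE k : k%:~R * tau * (y / tau) = k%:~R * y.
  by rewrite mulrACA divff ?mulr1// gt_eqF.
case=> n; rewrite tE; first exact: Mn.
rewrite NegzE; apply: (mulIf (cis_neq0 (n.+1%:R * y))).
rewrite -[RHS]cisD -Mn /mul -multiplierM// -zetaD addNr zeta0 multiplier1.
by rewrite -[n.+1%:R]/((n.+1%:Z)%:~R) -mulrDl -intrD addNr mul0r cis0.
Qed.

Let w : R := xget 0 [set w : R | forall k, mul (zeta k) = cis (k%:~R * tau * w)].

Let wP k : mul (zeta k) = cis (k%:~R * tau * w).
Proof.
by have [v Hv] := zeta_mul; rewrite /w; case: xgetP => [x _|/(_ v)]; [exact|].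
Qed.

(** The first character is the translation length modulo [tau], the second one is the multiplier of
the normal differential, corrected so as not to depend on the lift either. *)
Let chi_of (i : bool) (f : R -> R) (A : 'M[R]_2) : R[i] :=
  if i then cis (V (f 0) - V 0) else mul A * cis (- ((V (f 0) - V 0) * w)).

Let chi i x := chi_of i (ph x) (nd x).

Let chiE i x f A : x \in G0 -> lifts (act x) f A -> chi_of i f A = chi i x.
Proof.
move=> G0x L; have [Gx _] := orientedP G0x.
have [k [Ef EA]] := lift_uniq cop_qp q_gt1 (lftP Gx) L.
rewrite /chi /chi_of Ef V_tau EA; case: i; first by rewrite addrAC cis_period.
have P : preserves S (zeta k) by exact: S_lift (group1 G0) (lft_deck k).
rewrite /mul multiplierM// -/mul wP -mulrA -cisD; congr (_ * cis _).
by ring.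
Qed.

Let chiM i : {in G0 &, forall x y, chi i (x * y)%g = chi i x * chi i y}.
Proof.
move=> x y G0x G0y; have [Gx _] := orientedP G0x; have [Gy _] := orientedP G0y.
rewrite -(chiE i (groupM G0x G0y) (lftM Gx Gy (lftP Gx) (lftP Gy))) /chi /chi_of /=.
rewrite (V_lift G0x (lftP Gx)); set r := V (ph x 0) - V 0; set t := V (ph y 0).
have -> : t + r - V 0 = r + (t - V 0) by ring.
case: i; first exact: cisD.
rewrite /mul multiplierM//; last exact: S_lift (lftP Gx).
by rewrite mulrDl opprD cisD -/mul; ring.
Qed.

Let chi1 i : chi i 1%g = 1.
Proof.
rewrite -(chiE i (group1 G0) (lft_deck 0)) /chi_of V_tau mul0r addr0 subrr zeta0.
by case: i; rewrite ?mul0r ?oppr0 cis0// /mul multiplier1 mulr1.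
Qed.

Let rigid h f A : h \in G0 -> lifts (act h) f A -> V (f 0) = V 0 -> A = 1%:M -> h = 1%g.
Proof.
move=> G0h L E A1; have [Gh _] := orientedP G0h; rewrite A1 in L.
apply: act_eq1 => //; apply: (lift_rigid cop_qp q_gt1 (act_Diff Gh) (cardG_gt0 G)).
  by move=> P; exact: act_order.
have fid : f = id by apply/funext => t; apply: V_inj; rewrite (V_lift G0h L) E subrr addr0.
by rewrite -fid.
Qed.

Let chi_inj x : x \in G0 -> (forall i, chi i x = 1) -> x = 1%g.
Proof.
move=> G0x chi_x; have [Gx _] := orientedP G0x.
have [k] : exists k : int, V (ph x 0) - V 0 = 0 + k%:~R * tau.
  by apply: cis_eq; rewrite cis0; exact: (chi_x true).
rewrite add0r => Ek.
have L := lftM (group1 G) Gx (lft_deck (- k)) (lftP Gx); rewrite mul1g in L.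
have E : V (ph x 0 + (- k)%:~R * tau) = V 0.
  by rewrite V_tau intrN mulNr -Ek subKr.
apply: (rigid G0x L E); apply: (multiplier_inj S_sym S00 S_det (S_lift G0x L)).
have := chiE false G0x L; rewrite /chi_of chi_x /= E subrr mul0r oppr0 cis0 mulr1.
exact.
Qed.

(** A map reversing the critical fiber has a fixed point there, so its square, conjugate to a
translation, acts trivially on this fiber. *)
Let involutive x : x \in G -> x \notin G0 -> (x * x = 1)%g.
Proof.
move=> Gx nx; have dx := not_oriented Gx nx; have G0xx := oriented_index2 Gx nx Gx nx.
have L := lftM Gx Gx (lftP Gx) (lftP Gx).
have P := S_lift G0xx L.
have d1 : \det (nd x) = -1.
  have [_ /eqP] := P; rewrite det_mulmx -expr2 sqrf_eq1 => /orP[|]/eqP// d1.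
  by rewrite d1 ltNge ler01 in dx.
have A1 := orientation_reversing_square S_sym S00 S_det d1 P.
have [t Et] := lift_fixpoint (lftP Gx) dx.
have := V_lift G0xx L t; rewrite /= !Et => Vt.
apply: (rigid G0xx L) A1; apply/eqP; rewrite -subr_eq0; apply/eqP.
by apply: (addrI (V t)); rewrite -Vt addr0.
Qed.

Lemma embedding_of_lifts : exists m n : nat, [/\ (0 < m)%N, (0 < n)%N
  & exists H : {group Dih (ZpX_abelian m n)}, G \isog H].
Proof.
exists (#|G| * 2)%N, (#|G| * 2)%N; rewrite muln_gt0 cardG_gt0; split=> //.
exact: dihedral_embedding oriented_sub chiM chi1 chi_inj oriented_index2 involutive.
Qed.

End Forward.

Lemma fp_action_embedding (R : realType) (q p b : int) (cop_qp : coprimez q p) (q_gt1 : 1 < q)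
    (gT : finGroupType) (G : {group gT}) (act : gT -> seifert R q p b -> seifert R q p b) :
  fp_action G act -> exists m n : nat, [/\ (0 < m)%N, (0 < n)%N
    & exists H : {group Dih (ZpX_abelian m n)}, G \isog H].
Proof.
move=> act_fp.
have Hl x : exists L : (R -> R) * 'M[R]_2, x \in G -> lift (act x) L.1 L.2.
  have [Gx|nGx] := boolP (x \in G); last by exists (id, 1%:M).
  have [f [A H]] := lift_exists cop_qp q_gt1 (act_Diff act_fp Gx); by exists (f, A).
have [L {}Hl] := choice Hl.
exact: embedding_of_lifts act_fp _ _ Hl.
Qed.

(** * Compatibility of the charts *)

Section ElemMaps.
Variable R : realType.

Lemma elem_sub n (U V : set 'rV[R]_n) f df : V `<=` U -> elem U f df -> elem V f df.
Proof.
move=> VU; elim=> {f df}; intros; constructor => //; move=> x /VU; by auto.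
Qed.

Lemma elem_map_sdiff m n (U : set 'rV[R]_m) (g : 'rV[R]_m -> 'rV[R]_n) x :
  open U -> elem_map U g -> U x -> exists N, sdiff g x N.
Proof. by move=> oU /choice[d Hd] Ux; eexists; exact: elem_sdiff oU Hd Ux. Qed.

Lemma elem_map_open m n (V : set 'rV[R]_m) (U : set 'rV[R]_n) (g : 'rV[R]_m -> 'rV[R]_n) :
  open V -> open U -> elem_map V g -> open (V `&` g @^-1` U).
Proof.
move=> oV oU Eg; rewrite openE => z [Vz Uz]; apply: filterI.
  exact: open_nbhs_nbhs (conj oV Vz).
have [N dg] := elem_map_sdiff oV Eg Vz.
exact: (near_sdiff dg (open_nbhs_nbhs (conj oU Uz))).
Qed.

Lemma elem_affine m n (U : set 'rV[R]_m) (N : 'M[R]_(m, n)) c :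
  elem_map U (fun x => x *m N + c).
Proof.
move=> j; have [d Hd] : exists d, elem U (fun x : 'rV[R]_m => \sum_i x 0 i * N i j) d.
  elim: (index_enum _) => [|i s [d Hd]].
    exists (fun _ _ => 0); have := ElemCst U 0; congr elem.
    by apply/funext => x; rewrite big_nil.
  eexists; have := ElemAdd (ElemMul (ElemCoord U i) (ElemCst U (N i j))) Hd.
  by congr elem; apply/funext => x; rewrite big_cons.
eexists; have := ElemAdd Hd (ElemCst U (c 0 j)).
by congr elem; apply/funext => x; rewrite !mxE.
Qed.

End ElemMaps.

Section Transitions.
Variables (R : realType) (q p b : int).
Hypotheses (cop_qp : coprimez q p) (q_gt0 : 0 < q).
Local Notation M := (seifert R q p b).
Local Notation chart := (@chart R q p b).
Local Notation mer := (mer q p b).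
Local Notation twi := (twi q p b).
Local Notation slope := (slope R q p b).
Local Notation tau := (pi *+ 2 : R).
Local Notation kappa := (@kappa R q p b).
Implicit Types (e : bool) (f : M -> M) (x y z : 'rV[R]_3).

Definition straight (i : option bool) x : M :=
  if i is Some e then kappa e x else chart None x.

Definition explicit f i j x y : Prop := exists U g N,
  [/\ open U /\ U x, elem_map U g, g x = y,
      forall z, U z -> straight j (g z) = f (straight i z) & sdiff g x N /\ 0 < \det N].

Lemma explicit_comp f f' i j k x y z :
  explicit f i j x y -> explicit f' j k y z -> explicit (f' \o f) i k x z.
Proof.
move=> [U [g [N [[oU Ux] Eg gx Hg [dg Ng]]]]] [U' [g' [N' [[oU' Uy] Eg' gy Hg' [dg' Ng']]]]].
exists (U `&` g @^-1` U'), (g' \o g), (N *m N'); split.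
- by split; [exact: elem_map_open|split=> //; rewrite /preimage /= gx].
- apply: (elem_map_comp (U := U')) Eg' => [j'|w []//].
  by have [d /elem_sub Hd] := Eg j'; exists d; apply: Hd => w [].
- by rewrite /= gx.
- by move=> w [Uw U'w] /=; rewrite Hg'// Hg.
by split; [apply: sdiff_comp dg _; rewrite gx|rewrite det_mulmx mulr_gt0].
Qed.

Lemma explicit_affine f i j (N : 'M[R]_3) c x : 0 < \det N ->
  (forall z, straight j (z *m N + c) = f (straight i z)) -> explicit f i j x (x *m N + c).
Proof.
move=> dN E; exists setT, (fun x => x *m N + c), N; split=> //.
- by split=> //; exact: openT.
- exact: elem_affine.
by split=> //; exact: sdiff_linear.
Qed.

(** Two points of a chart with the same image differ by a deck transformation. *)
Lemma explicit_deck i x y : straight i x = straight i y -> explicit id i i x y.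
Proof.
case: i => [e|].
  have [v [t ->]] := ptP x; have [w [s ->]] := ptP y.
  move=> /(kappa_inj cop_qp q_gt0)[k [-> ->]].
  have E v' t' : pt v' t' *m blk (rotmx (k%:~R * tau * slope e)) 0 1 + pt 0 (k%:~R * tau) =
      pt (v' *m rotmx (k%:~R * tau * slope e)) (t' + k%:~R * tau).
    by rewrite mul_pt_blk mulmx0 mxE add0r mulr1 ptD addr0.
  rewrite -E; apply: explicit_affine => [|z]; first by rewrite det_blk det_rotmx mulr1.
  have [v' [t' ->]] := ptP z; rewrite E; exact: kappa_deck.
rewrite /straight /Defs.chart => /Reg_inj[E0 /esym/expi_eq[k1 E1] /esym/expi_eq[k2 E2]].
have -> : y = x *m 1%:M + row3 0 (k1%:~R * tau) (k2%:~R * tau).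
  by apply: row3_eq; rewrite mulmx1 !mxE /= ?E1 ?E2 -?E0 ?addr0.
apply: explicit_affine => [|z]; first by rewrite det1.
rewrite mulmx1 /straight /Defs.chart; congr Defs.Reg.
- by rewrite !mxE addr0.
- by apply/expi_eq; exists k1; rewrite !mxE.
- by apply/expi_eq; exists k2; rewrite !mxE.
Qed.

(** In logarithmic polar coordinates the change of charts from [F x S^1] to [V_e] is affine. *)
Definition to_end e z : 'rV[R]_3 :=
  polar3 (1 - (end_sign e)%:~R * z 0 0) ((end_sign e)%:~R / (mer e)%:~R * z 0 1)
    ((twi e)%:~R * (end_sign e)%:~R * z 0 1 - (mer e)%:~R * z 0 2).

Let mer_neq0 e : (mer e)%:~R != 0 :> R.
Proof. by rewrite intr_eq0 gt_eqF ?mer_gt0. Qed.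

Lemma to_endP e z : kappa e (to_end e z) = chart None z.
Proof.
rewrite /to_end kappa_polar// /Defs.chart; have := end_sign_unit R e; have := mer_neq0 e.
move: ((end_sign e)%:~R : R) ((mer e)%:~R : R) ((twi e)%:~R : R) => s m w m0 ss.
congr Defs.Reg; first by rewrite subKr mulrA ss mul1r.
  by congr expi; rewrite -[RHS]mul1r -ss; field.
by congr expi; field.
Qed.

Lemma to_end_elem e :
  elem_map setT (to_end e) /\ forall x, exists2 N, sdiff (to_end e) x N & 0 < \det N.
Proof.
have := end_sign_unit R e; have := mer_neq0 e.
rewrite /to_end; move: ((end_sign e)%:~R : R) ((mer e)%:~R : R) ((twi e)%:~R : R) => s m w m0 ss.
pose P z := polar3 (1 - s * z 0 0) (s / m * z 0 1) (w * s * z 0 1 - m * z 0 2).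
have EL := ElemAdd (ElemCst (n := 3) setT 1)
  (elem_opp (ElemMul (ElemCst setT s) (ElemCoord setT 0))).
have EA := ElemMul (ElemCst (n := 3) setT (s / m)) (ElemCoord setT 1).
have E0 := ElemMul (ElemExp EL) (ElemCos EA).
have E1 := ElemMul (ElemExp EL) (ElemSin EA).
have E2 := ElemAdd (ElemMul (ElemCst (n := 3) setT (w * s)) (ElemCoord setT 1))
  (elem_opp (ElemMul (ElemCst setT m) (ElemCoord setT 2))).
have P0 : (fun z => P z 0 0) = (fun z => expR (1 + - (s * z 0 0)) * cos (s / m * z 0 1)).
  by apply/funext => z; rewrite row3E.
have P1 : (fun z => P z 0 1) = (fun z => expR (1 + - (s * z 0 0)) * sin (s / m * z 0 1)).
  by apply/funext => z; rewrite row3E.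
have P2 : (fun z => P z 0 2) = (fun z => w * s * z 0 1 + - (m * z 0 2)).
  by apply/funext => z; rewrite row3E.
move: E0 E1 E2; rewrite -P0 -P1 -P2 => E0 E1 E2.
split=> [|x]; first by apply: elem_map3; eexists; eassumption.
have /= [N dN EN] := sdiff3 openT (I : setT x) E0 E1 E2; exists N => //.
rewrite EN !row3E.
have c2 := cos2Dsin2 (s / m * x 0 1); rewrite -[X in 0 < X](_ : expR (1 + - (s * x 0 0)) ^+ 2 = _).
  by rewrite exprn_gt0// expR_gt0.
move: (expR _) (cos _) (sin _) c2 => E C S c2.
transitivity (E ^+ 2 * (C ^+ 2 + S ^+ 2) * (s * s)); first by rewrite ss c2 !mulr1.
by field.
Qed.

Lemma explicit_to_end e x : explicit id None (Some e) x (to_end e x).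
Proof.
have [Ee /(_ x)[N dN N0]] := to_end_elem e.
exists setT, (to_end e), N; split=> //; first by split=> //; exact: openT.
by move=> z _; exact: to_endP.
Qed.

(** Polar coordinates have a local inverse around any [v != 0]: rotate [v] to the positive
half-axis, around which the angle is an arctangent. *)
Lemma explicit_from_end e (v : 'rV[R]_2) t : v != 0 ->
  exists y, explicit id (Some e) None (pt v t) y.
Proof.
case: (polP v) => [->|[r [a ->]] _]; first by rewrite eqxx.
pose U : set 'rV[R]_3 := [set z | 0 < z 0 0 * cos a + z 0 1 * sin a].
pose W0 z := z 0 0 * cos a + z 0 1 * sin a; pose W1 z := z 0 1 * cos a + - (z 0 0 * sin a).
pose L z := 2^-1 * ln (W0 z * W0 z + W1 z * W1 z); pose A z := a + atan (W1 z * (W0 z)^-1).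
have EW0 (V : set 'rV[R]_3) := ElemAdd (ElemMul (ElemCoord V 0) (ElemCst V (cos a)))
   (ElemMul (ElemCoord V 1) (ElemCst V (sin a))).
have EW1 := ElemAdd (ElemMul (ElemCoord U 1) (ElemCst U (cos a)))
   (elem_opp (ElemMul (ElemCoord U 0) (ElemCst U (sin a)))).
have pW0 z : U z -> W0 z != 0 by rewrite /U /= => /gt_eqF ->.
have pW z : U z -> 0 < W0 z * W0 z + W1 z * W1 z.
  move=> Uz; rewrite -!expr2 ltr_pwDl ?sqr_ge0// exprn_gt0//.
have EL := ElemMul (ElemCst U 2^-1)
  (ElemLn pW (ElemAdd (ElemMul (EW0 U) (EW0 U)) (ElemMul EW1 EW1))).
have EA := ElemAdd (ElemCst U a) (ElemAtan (ElemMul EW1 (ElemInv pW0 (EW0 U)))).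
pose s : R := (end_sign e)%:~R; pose m : R := (mer e)%:~R; pose w : R := (twi e)%:~R.
have ss : s * s = 1 by exact: end_sign_unit.
have m0 : m != 0 := mer_neq0 e.
pose Q z := row3 (s * (1 + - L z)) (s * m * A z) (w * A z + - (z 0 2 * m^-1)).
have EQ : elem_map U Q.
  apply: elem_map3.
  - eexists; have := ElemMul (ElemCst U s) (ElemAdd (ElemCst U 1) (elem_opp EL)).
    by congr elem; apply/funext => z; rewrite row3E.
  - eexists; have := ElemMul (ElemCst U (s * m)) EA.
    by congr elem; apply/funext => z; rewrite row3E.
  eexists; have := ElemAdd (ElemMul (ElemCst U w) EA)
    (elem_opp (ElemMul (ElemCoord U 2) (ElemCst U m^-1))).
  by congr elem; apply/funext => z; rewrite row3E.
have QP z : U z -> to_end e (Q z) = z.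
  move=> Uz; rewrite /to_end !row3E -/s -/m -/w.
  have -> : 1 - s * (s * (1 + - L z)) = L z by rewrite mulrA ss mul1r subKr.
  have -> : s / m * (s * m * A z) = A z.
    by rewrite -[RHS]mul1r -ss; field.
  have -> : w * s * (s * m * A z) - m * (w * A z + - (z 0 2 * m^-1)) = z 0 2.
    transitivity (w * m * A z * (s * s) - m * w * A z + z 0 2); first by field.
    by rewrite ss; ring.
  set u := W1 z * (W0 z)^-1.
  have Lz : expR (L z) ^+ 2 = W0 z * W0 z + W1 z * W1 z.
    by rewrite -expRM_natl mulrA divff ?mul1r ?lnK ?posrE ?pW// pnatr_eq0.
  have ca : 0 < cos (atan u) by apply: cos_gt0_pihalf; rewrite atan_gtNpi2 atan_ltpi2.
  have sa : sin (atan u) = u * cos (atan u).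
    transitivity (tan (atan u) * cos (atan u)); last by rewrite atanK.
    by rewrite /tan divfK// gt_eqF.
  have C : expR (L z) * cos (atan u) = W0 z.
    apply/eqP; rewrite -(@eqrXn2 _ 2)// ?mulr_ge0 ?expR_ge0 ?(ltW ca)//; last exact: ltW.
    rewrite exprMn Lz; have := cos2Dsin2 (atan u); rewrite sa.
    have -> : W1 z = u * W0 z by rewrite /u divfK ?pW0.
    move: (cos _) (W0 z) => C w0 E; apply/eqP.
    transitivity (w0 ^+ 2 * (C ^+ 2 + (u * C) ^+ 2)); first by ring.
    by rewrite E mulr1.
  have S : expR (L z) * sin (atan u) = W1 z.
    by rewrite sa mulrCA C /u divfK ?pW0.
  have c2 := cos2Dsin2 a.
  apply: row3_eq; rewrite row3E //.
    rewrite /A cosD mulrBr !mulrA [_ * cos a * _]mulrAC [_ * sin a * _]mulrAC C S.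
    by rewrite -[RHS]mulr1 -c2 /W0 /W1; ring.
  rewrite /A sinD mulrDr !mulrA [_ * sin a * _]mulrAC [_ * cos a * _]mulrAC C S.
  by rewrite -[RHS]mulr1 -c2 /W0 /W1; ring.
have oU : open U.
  rewrite openE => z Uz.
  have C := differentiable_continuous (elem_differentiable (EW0 setT) (I : setT z)).1.
  exact: (cvgr_gt _ C 0 Uz).
have Ux : U (pt (pol r a) t).
  rewrite /U /= pt0 pt1 !mxE /= -!mulrA -mulrDr -!expr2 cos2Dsin2 mulr1; exact: expR_gt0.
have [N dN] := elem_map_sdiff oU EQ Ux.
exists (Q (pt (pol r a) t)), U, Q, N; split=> //.
  by move=> z Uz; rewrite /= -[in RHS](QP z Uz) to_endP.
split=> //; have [_ /(_ (Q (pt (pol r a) t)))[N' dN' N'0]] := to_end_elem e.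
have := sdiff_comp dN dN' => /sdiff_near H.
have : N *m N' = 1%:M.
  apply: sdiff_uniq (H id _) (sdiff_id _).
  by apply: filterS (open_nbhs_nbhs (conj oU Ux)) => z; exact: QP.
by move/(congr1 determinant); rewrite det_mulmx det1 => H1;
  rewrite -(pmulr_lgt0 _ N'0) H1.
Qed.

(** The charts are compatible: the identity has local expressions in any two charts. Away from
the cores one goes through the chart of [F x S^1]. *)
Lemma transition i j x y : straight j y = straight i x -> explicit id i j x y.
Proof.
move=> E; have trans i1 i2 i3 x1 x2 x3 := @explicit_comp id id i1 i2 i3 x1 x2 x3.
have toend i' z z' : straight i' z' = straight None z -> explicit id None i' z z'.
  case: i' => [e|] E'; last by apply: explicit_deck; rewrite E'.
  apply: (trans _ _ _ _ _ _ (explicit_to_end e z)); apply: explicit_deck.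
  by rewrite [RHS]E' /straight to_endP.
case: i E => [e|] E; last exact: toend.
have [v [t Ex]] := ptP x; rewrite Ex in E *.
have [v0|v0] := eqVneq v 0; last first.
  have [z Hz] := explicit_from_end e t v0; apply: (trans _ _ _ _ _ _ Hz); apply: toend.
  have [U [g [N [[_ Ux] _ gx /(_ _ Ux) H _]]]] := Hz.
  by rewrite E -gx H.
rewrite v0 in E *; case: j E => [e'|].
  rewrite /straight => E; have [w [s Ey]] := ptP y.
  have ee : e' = e by move: E; rewrite Ey kappa_pt0 => /kappa_Core[].
  by rewrite ee in E *; apply: explicit_deck; exact: esym E.
by rewrite /straight kappa_pt0 /Defs.chart.
Qed.

End Transitions.

(** * Rotations and reflections of the fibration *)

Section Explicit.
Variables (R : realType) (q p b : int).
Hypotheses (cop_qp : coprimez q p) (q_gt0 : 0 < q).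
Local Notation M := (seifert R q p b).
Local Notation chart := (@chart R q p b).
Local Notation slope := (slope R q p b).
Local Notation straight := (@straight R q p b).
Local Notation explicit := (@explicit R q p b).
Implicit Types (e : bool) (f : M -> M) (x y z : 'rV[R]_3).

Definition flat (i : option bool) x : 'rV[R]_3 := if i is Some e then twist (slope e) x else x.
Definition unflat (i : option bool) x : 'rV[R]_3 := if i is Some e then twist (- slope e) x else x.

Lemma flatK i : cancel (flat i) (unflat i).
Proof. by case: i => [e|] x //=; rewrite twistK. Qed.

Lemma unflatK i : cancel (unflat i) (flat i).
Proof. by case: i => [e|] x //=; rewrite twistNK. Qed.

Lemma straight_flat i x : straight i (flat i x) = chart i x.
Proof. by case: i => [e|]; [exact: esym (chart_kappa _ _ _ _ _)|]. Qed.

Lemma flat_elem i : (elem_map setT (flat i) /\ forall x, exists2 N, sdiff (flat i) x N & \det N = 1) /\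
  (elem_map setT (unflat i) /\ forall x, exists2 N, sdiff (unflat i) x N & \det N = 1).
Proof.
case: i => [e|]; first by split; exact: elem_twist.
have H : elem_map setT (fun x : 'rV[R]_3 => x) /\
    forall x, exists2 N, sdiff (fun x : 'rV[R]_3 => x) x N & \det N = 1.
  split=> [j|x]; first by exists (fun _ v => v 0 j); exact: ElemCoord.
  by exists 1%:M; [exact: sdiff_id|exact: det1].
by split.
Qed.

Lemma straight_loc_inj i x y : straight i x = straight i y -> `|x - y| < 1 -> x = y.
Proof.
case: i => [e|]; first exact: kappa_loc_inj3.
move=> /Reg_inj[E0 /expi_eq[k E1] /expi_eq[l E2]] xy.
have small j (n : int) : x 0 j = y 0 j + n%:~R * (pi *+ 2) -> x 0 j = y 0 j.
  move=> E; have : `|n%:~R * (pi *+ 2) : R| < pi *+ 2.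
    have -> : n%:~R * (pi *+ 2) = (x - y) 0 j by rewrite !mxE E addrAC subrr add0r.
    apply: le_lt_trans (entry_norm_le _ 0 j) _; apply: lt_le_trans xy _.
    by have := pi_ge2 R; rewrite mulr2n; lra.
  by move/int_tau_small => n0; rewrite E n0 mul0r addr0.
by apply: row3_eq => //; [exact: small E1|exact: small E2].
Qed.

(** Explicit maps are smooth. Since two local expressions of a map in the same charts coincide
near a point if they coincide at the point, the Jacobian of any local expression is positive. *)
Lemma explicit_smooth f :
  (forall i j x y, straight j y = f (straight i x) -> explicit f i j x y) ->
  smooth_map f /\ orientation_preserving f.
Proof.
move=> Hf; split=> [i j x y|i j g x [sg Eg]].
  rewrite -!straight_flat => /Hf[U [g [N [[oU Ux] Eg gx Hg _]]]].
  have [[Ei _] _] := flat_elem i; have [_ [Ej _]] := flat_elem j.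
  have oV : open (setT `&` flat i @^-1` U) by apply: elem_map_open => //; exact: openT.
  exists (unflat j \o (g \o flat i)); first by rewrite /= gx flatK.
  split.
    apply: (elem_smooth oV); last by split.
    apply: (elem_map_comp (U := setT)) Ej => //.
    apply: (elem_map_comp (U := U)) Eg => [k|z []//].
    by have [d Hd] := Ei k; exists d; exact: elem_sub Hd.
  apply: filterS (open_nbhs_nbhs (conj oV (conj I Ux))) => z [_ Uz].
  by rewrite /= -!straight_flat unflatK Hg.
have dJ := sdiff_smooth sg; move: ('J g x) dJ => J dJ.
have [_ [_ /(_ (flat i x))[N1 d1 det1]]] := flat_elem i.
have [[_ /(_ (g x))[N2 d2 det2]] _] := flat_elem j.
have dg : sdiff (flat j \o (g \o unflat i)) (flat i x) (N1 *m J *m N2).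
  have dJ' : sdiff g (unflat i (flat i x)) J by rewrite flatK.
  by apply: sdiff_comp (sdiff_comp d1 dJ') _; rewrite /= flatK.
have Eg' : \forall z \near flat i x,
    straight j ((flat j \o (g \o unflat i)) z) = f (straight i z).
  have := Eg; rewrite -{1}(flatK i x) => /(near_sdiff d1); apply: filterS => z /=.
  by rewrite straight_flat -[in X in _ -> X](unflatK i z) straight_flat unflatK.
have [U [g0 [N [[oU Ux] _ gx Hg [dg0 Ng]]]]] := Hf i j _ _ (nbhs_singleton Eg').
suff : N1 *m J *m N2 = N.
  by move/(congr1 determinant); rewrite !det_mulmx det1 det2 mul1r mulr1 => ->.
apply: sdiff_uniq (dg) _; apply: sdiff_near (dg0).
have h0 : 0 < 2^-1 :> R by rewrite invr_gt0.
have [r1 r10 C1] := sdiff_cvg dg h0; have [r2 r20 C2] := sdiff_cvg dg0 h0.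
have near_x : \forall z \near flat i x, `|z - flat i x| < Num.min r1 r2.
  by apply/near_normP; exists (Num.min r1 r2) => //; rewrite lt_min r10.
have UU := open_nbhs_nbhs (conj oU Ux).
apply: filterS3 UU Eg' near_x => z Uz Ez.
rewrite lt_min => /andP[/C1 c1 /C2 c2]; apply: straight_loc_inj (etrans (Hg _ Uz) (esym Ez)) _.
rewrite gx in c2; set a := g0 z in c2 *; set c := (_ \o _) z in c1 *.
set d := (_ \o _) _ in c1 c2; have -> : a - c = (a - d) - (c - d) by rewrite opprB addrA subrK.
by rewrite (le_lt_trans (ler_normB _ _))// [1 in X in _ < X](splitr 1) ltrD// div1r.
Qed.

End Explicit.

Section Shifts.
Variables (R : realType) (q p b : int).
Hypotheses (cop_qp : coprimez q p) (q_gt0 : 0 < q).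
Local Notation M := (seifert R q p b).
Local Notation Reg := (@Reg R q p b).
Local Notation Core := (@Core R q p b).
Local Notation mer := (mer q p b).
Local Notation twi := (twi q p b).
Local Notation tau := (pi *+ 2 : R).
Local Notation sgn e := ((end_sign e)%:~R : R).
Implicit Types (e : bool) (a c : R) (v : circle R).

Definition turn e a v : circle R := dir (proj1_sig v ^ end_sign e * cis a).

Lemma turn_expi e a x : turn e a (expi x) = expi (sgn e * x + a).
Proof. by rewrite /turn val_expi -cisMz -cisD. Qed.

(** The combination of the angles [a] and [c] by which the core [e] is rotated, as computed from
the gluing map in polar coordinates. *)
Definition core_angle e a c : R := sgn e * (twi e)%:~R * a - (mer e)%:~R * c.

(** The values on the cores are forced by continuity. *)
Definition shift e a c (P : M) : M :=
  match P with
  | Defs.Reg t beta h => Reg t (turn e a beta) (turn e c h)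
  | Defs.Core e' v => Core e' (turn e (core_angle e' a c) v)
  end.

Lemma sgn_eqb e e' : sgn (e == e') = sgn e * sgn e'.
Proof. by case: e; case: e'; rewrite /= ?mulrNN ?mulrN1z ?mul1r ?mulr1. Qed.

Lemma turn_comp e a e' a' v : turn e a (turn e' a' v) = turn (e == e') (sgn e * a' + a) v.
Proof.
have [x ->] := expi_surj v; rewrite !turn_expi sgn_eqb; congr expi; ring.
Qed.

Lemma shift_comp e a c e' a' c' P :
  shift e a c (shift e' a' c' P) = shift (e == e') (sgn e * a' + a) (sgn e * c' + c) P.
Proof.
case: P => [t beta h|e0 v] /=; first by rewrite !turn_comp.
by rewrite turn_comp; congr (Defs.Core _ _ _ _ (turn _ _ _)); rewrite /core_angle; ring.
Qed.

Lemma shift_period e a c (k l : int) P :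
  shift e (a + k%:~R * tau) (c + l%:~R * tau) P = shift e a c P.
Proof.
have turnE x y (n : int) v : x = y + n%:~R * tau -> turn e x v = turn e y v.
  by move=> ->; rewrite /turn cis_period.
case: P => [t beta h|e0 v] /=.
  by rewrite (turnE (a + k%:~R * tau) a k)// (turnE (c + l%:~R * tau) c l).
congr Defs.Core; apply: (turnE _ _ (end_sign e0 * twi e0 * k - mer e0 * l)).
by rewrite /core_angle intrB !intrM; ring.
Qed.

Lemma shift0 P : shift true 0 0 P = P.
Proof.
have turn0 v : turn true 0 v = v.
  by have [x ->] := expi_surj v; rewrite turn_expi mul1r addr0.
by case: P => [t beta h|e v] /=; rewrite /core_angle ?mulr0 ?subr0 !turn0.
Qed.

Lemma shiftK e a c : cancel (shift e a c) (shift e (- (sgn e * a)) (- (sgn e * c))).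
Proof. by move=> P; rewrite shift_comp !subrr eqxx shift0. Qed.

Lemma shiftVK e a c : cancel (shift e (- (sgn e * a)) (- (sgn e * c))) (shift e a c).
Proof.
move=> P; rewrite shift_comp eqxx !mulrN !mulrA end_sign_unit !mul1r !addNr; exact: shift0.
Qed.

(** The action of [shift] on the disc of a straightened chart, up to a rotation. *)
Definition mirror e : 'M[R]_2 := \matrix_(i, j) (if i == j then if i == 0 then 1 else sgn e else 0).

Lemma mul_mirror e (v : 'rV[R]_2) : v *m mirror e = \row_i [:: v 0 0; sgn e * v 0 1]`_i.
Proof. by apply/rowP; apply: ord2P; rewrite mx2E !mxE /=; ring. Qed.

Lemma pol_mirror e rho x : pol rho x *m mirror e = pol rho (sgn e * x).
Proof.
rewrite mul_mirror; apply/rowP; apply: ord2P; rewrite !mxE /=; case: e => /=;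
  by rewrite ?mulN1r ?mul1r ?cosN ?sinN ?mulrN.
Qed.

Lemma det_mirror e : \det (mirror e) = sgn e.
Proof. by rewrite det2 !mxE /=; ring. Qed.

(** In the straightened charts [shift] is affine, so that smoothness is only a matter of changing
charts. *)
Lemma shift_straight e a c i : exists N d, 0 < \det N /\
  forall z : 'rV[R]_3, straight q p b i (z *m N + d) = shift e a c (straight q p b i z).
Proof.
case: i => [e'|].
  exists (blk (mirror e *m rotmx (sgn e' * a / (mer e')%:~R)) 0 (sgn e)).
  exists (pt 0 (core_angle e' a c)).
  rewrite det_blk det_mulmx det_rotmx det_mirror mulr1 end_sign_unit; split=> // z.
  have [v [t ->]] := ptP z; rewrite mul_pt_blk mulmx0 [X in pt _ (X + _)]mxE add0r ptD addr0 mulmxA.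
  have m0 : (mer e')%:~R != 0 :> R by rewrite intr_eq0 gt_eqF ?mer_gt0.
  case: (polP v) => [->|[rho [x ->]]].
    by rewrite !mul0mx /straight !kappa_pt0 /= turn_expi [sgn e * t]mulrC.
  rewrite pol_mirror pol_rot /straight !kappa_pol//= !turn_expi /core_angle.
  have := end_sign_unit R e'.
  move: (sgn e') ((mer e')%:~R : R) ((twi e')%:~R : R) m0 => s m w m0 ss.
  congr (Defs.Reg _ _ _ _ (expi _) (expi _)); last by field.
  transitivity (sgn e * (s * (m * x)) + (s * s) * a); last by rewrite ss mul1r.
  by field.
exists (blk (mirror e) 0 (sgn e)), (row3 0 a c).
rewrite det_blk det_mirror end_sign_unit; split=> // z.
have [v [t ->]] := ptP z; rewrite mul_pt_blk mulmx0 [X in pt _ (X + _)]mxE add0r.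
have -> : row3 0 a c = pt (\row_i [:: 0; a]`_i) c by rewrite ptE !mxE.
rewrite ptD mul_mirror /straight /Defs.chart /= !turn_expi !pt0 !pt1 !pt2 !mxE /= addr0.
by rewrite [t * _]mulrC.
Qed.

Lemma shift_smooth e a c : smooth_map (shift e a c) /\ orientation_preserving (shift e a c).
Proof.
apply: (explicit_smooth cop_qp q_gt0) => i j x y Exy.
have [N [d [dN E]]] := shift_straight e a c i.
have H := explicit_affine x dN E.
apply: (@explicit_comp R q p b _ id _ _ _ _ _ _ H).
by apply: (transition cop_qp q_gt0); rewrite Exy E.
Qed.

Lemma turn_onto e a v : exists w, turn e a w = v.
Proof.
exists (turn e (- (sgn e * a)) v); have [x ->] := expi_surj v.
rewrite !turn_expi; congr expi; rewrite mulrDr mulrN !mulrA end_sign_unit; ring.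
Qed.

Lemma shift_Diff e a c : Diff_plus_fp (shift e a c).
Proof.
have [sm or] := shift_smooth e a c; split=> //.
  split=> //; exists (shift e (- (sgn e * a)) (- (sgn e * c))).
    by have [] := shift_smooth e (- (sgn e * a)) (- (sgn e * c)).
  by split; [exact: shiftK|exact: shiftVK].
move=> L [[t [beta ->]]|[e' ->]].
  left; exists t, (turn e a beta); apply/seteqP; split=> [_ [_ [h _ <-] <-]|_ [h _ <-]] /=.
    by eexists.
  by have [w <-] := turn_onto e c h; exists (Reg t beta w) => //; exists w.
right; exists e'; apply/seteqP; split=> [_ [_ [h _ <-] <-]|_ [h _ <-]] /=.
  by eexists.
by have [w <-] := turn_onto e (core_angle e' a c) h; exists (Core e' w) => //; exists w.
Qed.

Lemma shift_inj e a c e' a' c' : (forall P, shift e a c P = shift e' a' c' P) ->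
  [/\ e = e', expi a = expi a' & expi c = expi c'].
Proof.
move=> H; have H0 := H (Reg 0 (expi 0) (expi 0)).
have H1 := H (Reg 0 (expi (pi / 2)) (expi 0)).
move: H0 H1; rewrite /= !turn_expi !mulr0 !add0r => /Reg_inj[_ Ea Ec] /Reg_inj[_ E1 _].
split=> //; move/expi_eq: Ea => [k Ek]; rewrite Ek in E1.
move/expi_eq: E1 => [l]; move=> El; apply: contrapT => ne.
have p0 := pi_gt0 R.
have {}El : (sgn e - sgn e') * (pi / 2) = (l - k)%:~R * (pi *+ 2).
  by rewrite intrB mulrBl mulrBl -[LHS](addrK (a' + k%:~R * tau)); move: El; lra.
have E2 : (end_sign e - end_sign e')%:~R = (4 * (l - k))%:~R :> R.
  apply: (mulIf (lt0r_neq0 p0)); rewrite !intrM intrB; move: El; rewrite mulr2n.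
  move: ((l - k)%:~R : R) (sgn e) (sgn e') (pi : R) => u s s' P E2.
  by transitivity ((s - s') * (P / 2) * 2); [field|rewrite E2; ring].
move/intr_inj: E2; case: (e) (e') ne => -[] //= _; lia.
Qed.

End Shifts.

(** * The action of a generalized dihedral group *)

Section DihedralAction.
Variables (R : realType) (q p b : int).
Hypotheses (cop_qp : coprimez q p) (q_gt0 : 0 < q).
Local Notation M := (seifert R q p b).
Local Notation tau := (pi *+ 2 : R).
Variables (m n : nat).
Local Notation D := (Dih (ZpX_abelian m n)).

(** Only used on [Zp k], which is trivial for [k = 1], although ['Z_1] has two elements. *)
Definition angle k (x : 'Z_k) : R := tau * (x%:R / k%:R).

Lemma angleD k : {in Zp k &, forall x y : 'Z_k, exists l : int,
  angle (x * y)%g = angle x + angle y + l%:~R * tau}.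
Proof.
move=> x y; rewrite /Zp; case: ifP => [k1 _ _|_]; last first.
  by rewrite !inE => /eqP-> /eqP->; exists 0; rewrite /angle mulg1 /= !mul0r !mulr0 !addr0.
exists (- ((x + y) %/ k)%N%:Z); rewrite /angle.
have k0 : k%:R != 0 :> R by rewrite pnatr_eq0 -lt0n ltnW.
have E : ((x * y)%g : 'Z_k) = ((x + y) %% k)%N :> nat.
  exact: (congr1 (modn _) (Zp_cast k1)).
have {}E : ((x * y)%g : 'Z_k)%:R = x%:R + y%:R - ((x + y) %/ k)%N%:R * k%:R :> R.
  have H := congr1 (fun i => i%:R : R) (divn_eq (x + y)%N k).
  by rewrite natrD [in RHS]natrD natrM in H; rewrite E H; ring.
rewrite E intrN -[_%:~R]/(((x + y) %/ k)%N%:R); by field.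
Qed.

Lemma angle_inj k : {in Zp k &, forall x y : 'Z_k, expi (angle x) = expi (angle y) -> x = y}.
Proof.
move=> x y; rewrite /Zp; case: ifP => [k1 _ _|_]; last by rewrite !inE => /eqP-> /eqP->.
have k0 : 0 < k%:R :> R by rewrite ltr0n ltnW.
have t0 : 0 < tau by rewrite mulrn_wgt0// pi_gt0.
move=> /expi_eq[l E]; have lt1 (z : 'Z_k) : 0 <= (z%:R / k%:R : R) < 1.
  rewrite divr_ge0//= ltr_pdivrMr// mul1r ltr_nat.
  by have := ltn_ord z; rewrite [X in (_ < X)%N](Zp_cast k1).
have {}E : (x%:R / k%:R : R) = y%:R / k%:R + l%:~R.
  by apply: (mulfI (lt0r_neq0 t0)); rewrite mulrDr [tau * l%:~R]mulrC.
have l0 : l = 0.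
  have := lt1 x; have := lt1 y; rewrite E.
  move: (_ / _) => u /andP[u0 u1] /andP[v0 v1].
  have : -1 < l%:~R :> R by lra.
  have : l%:~R < 1 :> R by lra.
  by rewrite ltrz1 -[-1]/((-1)%:~R) ltr_int; lia.
apply: val_inj; apply/eqP; rewrite -(eqr_nat R); apply/eqP.
by apply: (mulIf (invr_neq0 (lt0r_neq0 k0))); rewrite E l0 addr0.
Qed.

Definition sd_coords (u : D) : 'Z_2 * ('Z_m * 'Z_n) := pair_of_sd u.

Lemma sd_coords_in u : (sd_coords u).2 \in ZpX m n.
Proof. by case: u => [[s x] /= /setXP[]]. Qed.

(** The pair [(s, x)] stands for the product of the reflection [s] and of the translation [x], whence
the sign of the angles. *)
Definition dih_act (u : D) : M -> M :=
  let: (s, x) := sd_coords u in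
  shift (s == 1%g) ((end_sign (s == 1%g))%:~R * angle x.1) ((end_sign (s == 1%g))%:~R * angle x.2).

Lemma angle_inversion k (x : 'Z_k) e : x \in Zp k ->
  exists l : int, angle (if e then x else x^-1)%g = (end_sign e)%:~R * angle x + l%:~R * tau.
Proof.
case: e => /= Zx; first by exists 0; rewrite mul1r mul0r addr0.
have Zy : (x^-1)%g \in Zp k by rewrite groupV.
have [l] := angleD Zx Zy; rewrite mulgV => E; exists (- l).
have a1 : angle (1%g : 'Z_k) = 0 by rewrite /angle /= mul0r mulr0.
by rewrite a1 in E; rewrite mulN1r intrN mulNr; move: E; lra.
Qed.

Lemma dih_actM u v P : dih_act (u * v)%g P = dih_act u (dih_act v P).
Proof.
have := sd_coords_in u; have := sd_coords_in v; rewrite /dih_act.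
have -> : sd_coords (u * v)%g = ((sd_coords u).1 * (sd_coords v).1,
  inversion (ZpX m n) (sd_coords u).2 (sd_coords v).1 * (sd_coords v).2)%g by [].
case: (sd_coords u) => s x; case: (sd_coords v) => s' x' /= Zx' Zx.
rewrite /inversion Zx /=; rewrite shift_comp.
have -> : ((s * s' == 1) = ((s == 1) == (s' == 1)))%g.
  by case: s => [[|[|//]] i]; case: s' => [[|[|//]] i'].
move: (s == 1%g) (s' == 1%g) => e e'; rewrite if_neg.
have /setXP[Zx1 Zx2] : (x.1, x.2) \in ZpX m n by rewrite -surjective_pairing.
have /setXP[Zx'1 Zx'2] : (x'.1, x'.2) \in ZpX m n by rewrite -surjective_pairing.
have E k (y y' : 'Z_k) : y \in Zp k -> y' \in Zp k -> exists l : int,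
    (end_sign (e == e'))%:~R * angle ((if e' then y else y^-1) * y')%g =
    (end_sign e)%:~R * ((end_sign e')%:~R * angle y') + (end_sign e)%:~R * angle y + l%:~R * tau.
  move=> Zy Zy'; have [l El] := angle_inversion e' Zy.
  have Zy2 : (if e' then y else y^-1)%g \in Zp k by case: (e'); rewrite ?groupV.
  have [l' ->] := angleD Zy2 Zy'; rewrite El.
  exists (end_sign (e == e') * (l + l')); rewrite intrM intrD sgn_eqb.
  have := end_sign_unit R e'; move: (((end_sign e)%:~R : R)) ((end_sign e')%:~R : R) => r r' rr.
  transitivity (r * (r' * r') * angle y + r * r' * angle y' + r * r' * (l%:~R + l'%:~R) * tau).
    by ring.
  by rewrite rr; ring.
have -> : (if e' then x else x^-1)%g = ((if e' then x.1 else x.1^-1)%g, (if e' then x.2 else x.2^-1)%g).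
  by case: (e'); [exact: surjective_pairing|].
have [k1 /= ->] := E _ _ _ Zx1 Zx'1; have [k2 ->] := E _ _ _ Zx2 Zx'2.
exact: shift_period.
Qed.

Lemma dih_act_inj u v : (forall P, dih_act u P = dih_act v P) -> u = v.
Proof.
rewrite /dih_act; have := sd_coords_in u; have := sd_coords_in v.
move=> Zv Zu H; apply: val_inj; rewrite /= -!/(sd_coords _); move: Zv Zu H.
case: (sd_coords u) => s [x1 x2]; case: (sd_coords v) => s' [y1 y2] /=.
move=> /setXP[Zy1 Zy2] /setXP[Zx1 Zx2] /(shift_inj cop_qp q_gt0)[E].
have -> : s' = s.
  by case: s E => [[|[|//]] i]; case: s' => [[|[|//]] i'] //= _; exact: val_inj.
have sg : (end_sign (s == 1%g))%:~R * (end_sign (s == 1%g))%:~R = 1 :> R by exact: end_sign_unit.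
have H k (x y : 'Z_k) : x \in Zp k -> y \in Zp k ->
    expi ((end_sign (s == 1%g))%:~R * angle x) = expi ((end_sign (s == 1%g))%:~R * angle y) -> x = y.
  move=> Zx Zy /expi_eq[l El]; apply: angle_inj => //; apply/expi_eq.
  by exists (end_sign (s == 1%g) * l); exact: end_sign_flip El.
by move=> /(H _ _ _ Zx1 Zy1)-> /(H _ _ _ Zx2 Zy2)->.
Qed.

Lemma dih_fp_action (gT : finGroupType) (G : {group gT}) (H : {group D}) :
  (G \isog H)%g -> exists phi : gT -> M -> M, fp_action G phi.
Proof.
move=> /isogP[f injf _]; exists (fun x => dih_act (f x)); split.
- by move=> x _; rewrite /dih_act; case: (sd_coords _) => s y; exact: shift_Diff.
- by move=> x y Gx Gy; rewrite morphM//; apply/funext => P; exact: dih_actM.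
move=> x y Gx Gy E; apply: (injmP injf) => //.
by apply: dih_act_inj => P; rewrite E.
Qed.

End DihedralAction.

Theorem corollary4p2 (R : realType) (q p b : int)
    (cop_qp : coprimez q p) (p_bounds : 0 < p < q)
    (gT : finGroupType) (G : {group gT}) :
  (exists phi : gT -> seifert R q p b -> seifert R q p b, fp_action G phi) <->
  (exists m n : nat, [/\ (0 < m)%N, (0 < n)%N
     & exists H : {group Dih (ZpX_abelian m n)}, G \isog H]).
Proof.
have q_gt1 : 1 < q by case/andP: p_bounds; lia.
split=> [[phi Hphi]|[m [n [_ _ [H]]]]]; first exact: (fp_action_embedding cop_qp q_gt1 Hphi).
by apply: dih_fp_action => //; exact: lt_trans ltr01 q_gt1.
Qed.
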